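(* Let $n$ be a positive integer with $n\equiv 0$ or $1 \pmod 3$, and let $c\in\{3,\dots,n\}$. Let $K_n$ be the random knot of the random billiard table model with $n$ crossings, and let $\mathrm{c}(K_n)$ denote its crossing number. Then $$ P\left[\mathrm{c}(K_n)=c\right] \;=\; \sum_{\substack{k\in\{0,\dots,c-2\}\\ c+k\equiv n \ (\mathrm{mod}\ 3)}} \frac{\binom{c-2}{k}}{2^{n-1}}\cdot F\left(\frac{n-c-k}{3},\; c+k\right), $$ where $$ F(m,\ell) \;:=\; \frac{m^2+(\ell+5)m+2}{2}\binom{3m+\ell}{m} \;-\; \frac{m^2+(2\ell+9)m+(\ell^2+7\ell+2)}{2}\binom{3m+\ell}{<m}. $$
   Context: Notation: $\binom{N}{<m} := \binom{N}{0}+\binom{N}{1}+\dots+\binom{N}{m-1}$ (an empty sum, equal to $0$, if $m\le 0$), and $\binom{N}{m}:=0$ for $m<0$. Random model: let $n\equiv 0$ or $1 \pmod 3$, so that $3$ and $n+1$ are coprime. Consider the planar trajectory of a billiard ball in the rectangle of width $n+1$ and height $3$, $[0,n+1]\times[0,3]$, fired at slope one from the lower left corner $(0,0)$, reflecting off the sides until it ends in another corner. This curve has exactly $n$ transversal self-crossings, one on each vertical line $x=1,\dots,n$; they are ordered from left to right. A word $w\in\{0,1\}^n$ assigns crossing information: the $i$th crossing has the strand of positive slope on top if the $i$th letter is $0$, and the strand of negative slope on top if the $i$th letter is $1$. Connecting the two ends of the trajectory by a simple arc outside the rectangle gives a knot diagram. $K_n$ is the knot represented by this diagram when $w$ is chosen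 uniformly at random from $\{0,1\}^n$. The crossing number of a knot is the minimal number of crossings in any of its diagrams. *)

(* Defs.v *)
From Stdlib Require Import Relation_Operators.
From mathcomp Require Import all_boot all_order all_algebra.
From mathcomp Require Import boolp.

Set Implicit Arguments.
Unset Strict Implicit.
Unset Printing Implicit Defensive.

Import Order.TTheory GRing.Theory Num.Theory.

Local Open Scope nat_scope.

(* Knot diagrams (on the sphere) are encoded by signed Gauss codes.  Follow the
   curve once around, from some base point in some direction, and record one
   letter for each passage through a crossing: the name of the crossing,
   whether the passage is the over-strand, and whether the crossing is
   positive, i.e. whether the pair (direction of the over-strand, direction of
   the under-strand) is positively oriented.  The empty code is the diagram
   without crossings. *)

Definition letter : Type := (nat * bool * bool)%type.
Definition name (a : letter) : nat := a.1.1.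
Definition over (a : letter) : bool := a.1.2.
Definition positive (a : letter) : bool := a.2.

(* The other passage through the same crossing. *)
Definition mate (a : letter) : letter := (name a, ~~ over a, positive a).

Definition gauss_code (G : seq letter) : bool :=
  uniq [seq (name a, over a) | a <- G] && all (fun a => mate a \in G) G.

Definition crossings (G : seq letter) : nat := (size G)./2.

Section Faces.
Variable G : seq letter.

Definition mate_pos (i : 'I_(size G)) : 'I_(size G) :=
  insubd i (index (mate (tnth (in_tuple G) i)) G).

(* The pair (i, d) is the oriented edge that leaves the i-th passage forward
   (d = true) or backward (d = false).  [next_side] goes along that edge and
   turns left at its end; the orbits are the boundaries of the faces of the
   surface carrying the diagram.  Seen by somebody who runs forward through a
   letter a, the other strand goes from right to left iff
   over a = positive a. *)
Definition next_side (x : 'I_(size G) * bool) : 'I_(size G) * bool :=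
  let j := if x.2 then ordS x.1 else ord_pred x.1 in
  let a := tnth (in_tuple G) j in
  (mate_pos j, (over a == positive a) == x.2).

Definition faces : nat := fcard next_side predT.

(* Euler's formula V - E + F = 2, with E = size G. *)
Definition spherical : bool :=
  (G == [::]) || (crossings G + faces == size G + 2).

End Faces.

Definition diagram (G : seq letter) : bool := gauss_code G && spherical G.

Definition rename (f : nat -> nat) (a : letter) : letter :=
  (f (name a), over a, positive a).

Definition ordered_pair (b : bool) (x y : letter) : seq letter :=
  if b then [:: x; y] else [:: y; x].

(* The three strands of a third Reidemeister move: the top strand passes over
   crossings i and j, the middle one under i and over k, the bottom one under j
   and k.  The booleans a, b, c tell whether these crossings are met in the
   listed order on the top, middle and bottom strand.  For three lines in the
   plane, writing the vectors between the vertices of the triangle as multiples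
   of the directions of the lines shows that the signs of i, j, k are, up to a
   common factor (here e), those of c, b, a respectively; all 16
   configurations arise. *)
Section ThirdMove.
Variables (i j k : nat) (si sj sk : bool).
Definition top_strand (a : bool) : seq letter :=
  ordered_pair a (i, true, si) (j, true, sj).
Definition middle_strand (b : bool) : seq letter :=
  ordered_pair b (i, false, si) (k, true, sk).
Definition bottom_strand (c : bool) : seq letter :=
  ordered_pair c (j, false, sj) (k, false, sk).
End ThirdMove.

(* The first three constructors change the arbitrary choices (base point,
   direction, names of the crossings) made in writing down the code of a
   diagram; the others are the Reidemeister moves. *)
Inductive move : seq letter -> seq letter -> Prop :=
| MoveBasePoint m G : move G (rot m G)
| MoveReverse G : move G (rev G)
| MoveRename f G : injective f -> move G (map (rename f) G)
| MoveR1 i o s A :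
    move ([:: (i, o, s); (i, ~~ o, s)] ++ A) A
| MoveR2 i j s d A B :
    move ([:: (i, true, s); (j, true, ~~ s)] ++ A ++
          ordered_pair d (i, false, s) (j, false, ~~ s) ++ B)
         (A ++ B)
| MoveR3 i j k a b c e A B C :
    let T := top_strand i j (e == c) (e == b) in
    let M := middle_strand i k (e == c) (e == a) in
    let L := bottom_strand j k (e == b) (e == a) in
    move (T a ++ A ++ M b ++ B ++ L c ++ C)
         (T (~~ a) ++ A ++ M (~~ b) ++ B ++ L (~~ c) ++ C)
| MoveR3' i j k a b c e A B C :
    let T := top_strand i j (e == c) (e == b) in
    let M := middle_strand i k (e == c) (e == a) in
    let L := bottom_strand j k (e == b) (e == a) in
    move (T a ++ A ++ L c ++ B ++ M b ++ C)
         (T (~~ a) ++ A ++ L (~~ c) ++ B ++ M (~~ b) ++ C).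

(* Two diagrams represent the same (unoriented) knot iff they are related by
   Reidemeister moves.  Requiring both ends of each step to be diagrams makes
   the inverse of a second move legal only along a common face. *)
Definition same_knot : seq letter -> seq letter -> Prop :=
  clos_refl_sym_trans _ (fun G H => [/\ diagram G, diagram H & move G H]).

Lemma same_knot_diagram G H : same_knot G H -> diagram G = diagram H.
Proof. by elim=> // [x y [-> ->]|x y z _ -> _ ->]. Qed.

Lemma has_crossings G :
  exists m, `[< exists2 H, same_knot G H & crossings H = m >].
Proof. by exists (crossings G); apply/asboolP; exists G => //; apply: rst_refl. Qed.

(* The crossing number of the knot represented by the diagram G. *)
Definition crossing_number (G : seq letter) : nat := ex_minn (has_crossings G).

(* Coordinate at time t, and its derivative just after time t, of a point that
   moves at unit speed in the interval [0, p] starting from 0. *)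
Definition bounce (p t : nat) : nat :=
  let r := t %% (2 * p) in if r <= p then r else 2 * p - r.
Definition bounce_dir (p t : nat) : int :=
  if t %% (2 * p) < p then 1%R else (-1)%R.

Section Billiard.
Variables (n : nat) (w : n.-tuple bool).

Definition ball (t : nat) : nat * nat := (bounce n.+1 t, bounce 3 t).
Definition velocity (t : nat) : int * int :=
  (bounce_dir n.+1 t, bounce_dir 3 t).

(* The first positive time at which the ball is in a corner is
   lcmn 3 n.+1 = 3 * n.+1.  Strands lie on lines x - y = 2a or x + y = 2b, so
   they cross at integral points, at integral times. *)
Definition times : seq nat := iota 0 (lcmn 3 n.+1).+1.

Definition other_times (t : nat) : seq nat :=
  [seq t' <- times | (t' != t) && (ball t' == ball t)].

Definition ascending (t : nat) : bool := (velocity t).1 == (velocity t).2.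

(* The i-th crossing is on the line x = i; the letters 0 and 1 of w are false
   and true. *)
Definition on_top (t : nat) : bool :=
  let one := nth false w (ball t).1.-1 in
  if one then ~~ ascending t else ascending t.

Definition det2 (u v : int * int) : int := (u.1 * v.2 - u.2 * v.1)%R.

Definition passage (t : nat) : letter :=
  let t' := head t (other_times t) in
  let: (u, v) := if on_top t then (velocity t, velocity t')
                 else (velocity t', velocity t) in
  ((ball t).1, on_top t, (0 < det2 u v)%R).

(* The arc that closes up the trajectory outside of the rectangle has no
   crossings, hence contributes no letters. *)
Definition billiard_diagram : seq letter :=
  [seq passage t | t <- times & other_times t != [::]].

End Billiard.

Local Open Scope ring_scope.

Definition uniform_prob (T : finType) (E : T -> Prop) : rat :=
  #|[pred x | `[< E x >]]|%:R / #|T|%:R.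

Definition binz (N : nat) (m : int) : nat :=
  if m is Posz k then 'C(N, k) else 0%N.

Definition binz_lt (N : nat) (m : int) : nat :=
  if m is Posz k then (\sum_(i < k) 'C(N, i))%N else 0%N.

(* Only used when 3 m + l >= 0, so that the absolute value is harmless. *)
Definition F (m : int) (l : nat) : rat :=
  let N := absz (3 * m + l%:Z) in
  let x : rat := m%:~R in
  let y : rat := l%:R in
  (x ^+ 2 + (y + 5) * x + 2) / 2 * (binz N m)%:R
  - (x ^+ 2 + (2 * y + 9) * x + (y ^+ 2 + 7 * y + 2)) / 2 * (binz_lt N m)%:R.

(* Main.v *)
(** A word in {0,1}^n describes a plat on three strands whose crossings lie
alternately between the two lower and the two upper strands.  A half twist of
the three strands can be pushed to the right end and absorbed there, so three
consecutive equal letters may be deleted, and so may the first or last three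
letters if the outermost two of them agree; a block of two equal letters
inside the word is a single crossing followed by a half twist.  What remains
is a word with single letters at both ends and inner blocks of one or two
letters, which gives an alternating plat with one crossing per block.

That this diagram is minimal follows from the Kauffman bracket.  For a Gauss
code the loops of a state are counted by the 2-colourings of the arcs that are
constant on loops; such a colouring amounts to a subset of the crossings (those
where the colour changes), and the subsets coming from the all-A and from the
all-B state meet only in 0.  Hence the bracket of a diagram with c crossings
has span at most 4c, with equality for the plats above by a 2x2 transfer
matrix.  Sphericity of all plats follows from Euler's inequality, again by
2-colourings, and from an explicit labelling of the regions.

Finally the words that reduce to a given word satisfy a ballot recursion. *)
Require Import Defs.
From mathcomp Require Import all_boot all_order all_algebra.
From mathcomp Require Import zify ring boolp.
From Stdlib Require Import Relation_Operators.

Set Implicit Arguments.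
Unset Strict Implicit.
Unset Printing Implicit Defensive.

(* [over] is also a constant of the ssreflect library. *)
Import Defs.
Import Order.TTheory GRing.Theory Num.Theory.

Local Open Scope nat_scope.

(** * Assignments of bits to crossings *)

(** The bracket is set up for every Gauss code, planar or not: the loops of a state are counted by
    the dimension of the solution space of a linear system over F_2, with one unknown and one
    equation per crossing. Invariance under the moves and the bound on the span are then linear
    algebra and finite checks. Planarity enters because [same_knot] asks that both ends of each step
    be diagrams; the reduction of a word passes through many plats, so each plat has to be shown
    spherical. With t = A^2 and the factor A^(3c), the bracket is a polynomial in t, which the moves
    change by a sign and a power of t, and the bound 4c on the span becomes 2c in degrees of t.

    All deletions remove three letters, so the residue of the length mod 3, on which the order of
    the strands at the left end depends, is preserved. The number of words reducing to a given word
    depends on the length of that word alone; F arises by summing it twice, over what is deleted at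
    the left and at the right end. The denominator 2^(n-1) rather than 2^n comes from the two
    choices of the first letter of a reduced word. *)

Definition upd (x : nat -> bool) i b k := if k == i then b else x k.
Definition addx (x y : nat -> bool) k := x k (+) y k.
Definition zerox : nat -> bool := fun=> false.
Definition supp (ns : seq nat) (x : nat -> bool) := forall k, k \notin ns -> x k = false.

(** Assignments are total functions that vanish outside [ns], so that the same assignment makes
    sense for codes with different sets of crossings. *)
Fixpoint asg (ns : seq nat) : seq (nat -> bool) :=
  if ns is i :: ns' then
    [seq upd x i false | x <- asg ns'] ++ [seq upd x i true | x <- asg ns']
  else [:: zerox].

Definition cnt ns (P : pred (nat -> bool)) : nat := \sum_(x <- asg ns) P x.

Lemma addxA x y z : addx x (addx y z) = addx (addx x y) z.
Proof. by apply: funext => k; rewrite /addx addbA. Qed.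
Lemma addxC x y : addx x y = addx y x.
Proof. by apply: funext => k; rewrite /addx addbC. Qed.
Lemma addxx x : addx x x = zerox.
Proof. by apply: funext => k; rewrite /addx addbb. Qed.
Lemma addx0 x : addx x zerox = x.
Proof. by apply: funext => k; rewrite /addx addbF. Qed.
Lemma addxK x y : addx (addx x y) y = x.
Proof. by rewrite -addxA addxx addx0. Qed.

Lemma upd_addx x y i b c : upd (addx x y) i (b (+) c) = addx (upd x i b) (upd y i c).
Proof. by apply: funext => k; rewrite /upd /addx; case: ifP. Qed.

Lemma updC x i j b c : i != j -> upd (upd x i b) j c = upd (upd x j c) i b.
Proof.
move=> nij; apply: funext => k; rewrite /upd; case: (eqVneq k j) => // ->.
by rewrite eq_sym (negbTE nij).
Qed.

Lemma upd_id x i : upd x i (x i) = x.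
Proof. by apply: funext => k; rewrite /upd; case: eqP => [->|]. Qed.

Section Sums.
Local Open Scope ring_scope.
Variable V : nmodType.
Implicit Type F : (nat -> bool) -> V.

Lemma asum_cons i ns F :
  \sum_(x <- asg (i :: ns)) F x =
  \sum_(x <- asg ns) F (upd x i false) + \sum_(x <- asg ns) F (upd x i true).
Proof. by rewrite /= big_cat !big_map. Qed.

Lemma eq_asum ns F1 F2 : (forall x, supp ns x -> F1 x = F2 x) ->
  \sum_(x <- asg ns) F1 x = \sum_(x <- asg ns) F2 x.
Proof.
elim: ns F1 F2 => [|i ns IH] F1 F2 eqF; first by rewrite !big_seq1 eqF.
rewrite !asum_cons; congr (_ + _); apply: IH => x sx; apply: eqF => k;
  rewrite inE negb_or => /andP[ki kns]; rewrite /upd (negbTE ki); exact: sx.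
Qed.

Lemma asum_catCA i j ns F :
  \sum_(x <- asg (i :: j :: ns)) F x = \sum_(x <- asg (j :: i :: ns)) F x.
Proof.
have [->//|nij] := eqVneq i j.
rewrite !asum_cons; under eq_bigr => x _ do rewrite updC 1?eq_sym //.
rewrite addrACA; congr (_ + _ + (_ + _)); apply: eq_bigr => x _; rewrite updC // eq_sym //.
Qed.

Lemma asum_perm ns ns' F : perm_eq ns ns' ->
  \sum_(x <- asg ns) F x = \sum_(x <- asg ns') F x.
Proof.
have mid i s1 s2 (F' : (nat -> bool) -> V) :
    \sum_(x <- asg (s1 ++ i :: s2)) F' x = \sum_(x <- asg (i :: s1 ++ s2)) F' x.
  elim: s1 F' => [//|j s1 IH] F'; rewrite cat_cons.
  by rewrite asum_cons !IH -asum_cons asum_catCA.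
elim: ns ns' F => [|i ns IH] ns' F pe.
  by move: pe; rewrite perm_sym => /perm_nilP ->.
have: i \in ns' by rewrite -(perm_mem pe) mem_head.
move=> i_ns'; case/splitPr: i_ns' pe => s1 s2 pe.
rewrite mid !asum_cons !(IH (s1 ++ s2)) //.
all: by move: pe; rewrite -[_ :: s2]cat1s perm_sym perm_catCA perm_sym /= perm_cons.
Qed.

(** Translation by [y] preserves the two halves [x i = 0] and [x i = 1] or exchanges them. *)
Lemma asum_shift ns y F : supp ns y ->
  \sum_(x <- asg ns) F (addx x y) = \sum_(x <- asg ns) F x.
Proof.
elim: ns y F => [|i ns IH] y F sy.
  rewrite !big_seq1; congr (F _); apply: funext => k; rewrite /addx sy //.
pose y' := upd y i false.
have sy' : supp ns y'.
  move=> k kns; rewrite /y' /upd; case: eqP => // /eqP ki.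
  by apply: sy; rewrite inE negb_or ki.
have E b x : addx (upd x i b) y = upd (addx x y') i (b (+) y i).
  by rewrite -[in LHS](upd_id y i) -upd_addx /y'; apply: funext => k;
     rewrite /upd /addx; case: eqP.
rewrite !asum_cons; under eq_bigr => x _ do rewrite E.
under [X in _ + X]eq_bigr => x _ do rewrite E.
rewrite !(IH _ (fun x => F (upd x i _)) sy').
by case: (y i) => //=; rewrite addrC.
Qed.

Lemma asum_pull (f : nat -> nat) ns F' F : injective f ->
  (forall x, F x = F' (x \o f)) ->
  \sum_(x <- asg (map f ns)) F x = \sum_(x <- asg ns) F' x.
Proof.
move=> injf; elim: ns F F' => [|i ns IH] F F' E; first by rewrite !big_seq1 E.
rewrite [map _ _]/= !asum_cons.
congr (_ + _); apply: IH => x; rewrite E; congr F'; apply: funext => k;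
  by rewrite /upd /= (inj_eq injf).
Qed.

End Sums.

Lemma cnt_cons i ns P :
  cnt (i :: ns) P = cnt ns (fun x => P (upd x i false)) + cnt ns (fun x => P (upd x i true)).
Proof. exact: (asum_cons i ns (fun x => nat_of_bool (P x))). Qed.

Lemma cnt_le ns P : cnt ns P <= 2 ^ size ns.
Proof.
elim: ns P => [|i ns IH] P; first by rewrite /cnt big_seq1 leq_b1.
by rewrite cnt_cons /= expnS mul2n -addnn leq_add.
Qed.

Lemma cnt_mono ns (P Q : pred (nat -> bool)) : (forall x, P x -> Q x) -> cnt ns P <= cnt ns Q.
Proof.
move=> PQ; apply: leq_sum => x _; case: (P x) (PQ x) => // -> //.
Qed.

Lemma eq_cnt ns (P Q : pred (nat -> bool)) : (forall x, supp ns x -> P x = Q x) -> cnt ns P = cnt ns Q.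
Proof. by move=> PQ; apply: eq_asum => x sx; rewrite PQ. Qed.

Lemma cnt_gt0 ns P : 0 < cnt ns P -> exists2 y, supp ns y & P y.
Proof.
elim: ns P => [|i ns IH] P.
  by rewrite /cnt big_seq1 => Pz; exists zerox => //; move: Pz; case: (P _).
rewrite cnt_cons addn_gt0 => /orP[] /IH [y sy Py]; eexists; try exact: Py;
  by move=> k; rewrite inE negb_or => /andP[ki kns]; rewrite /upd (negbTE ki) sy.
Qed.

Definition lin (P : pred (nat -> bool)) :=
  P zerox /\ forall x y, P x -> P y -> P (addx x y).

Lemma lin_addr P x y : lin P -> P y -> P (addx x y) = P x.
Proof.
move=> [_ linP] Py; apply/idP/idP => Px; last exact: linP.
by rewrite -(addxK x y); apply: linP.
Qed.

Lemma cnt0_gt0 ns (P : pred (nat -> bool)) : P zerox -> 0 < cnt ns P.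
Proof.
elim: ns P => [|i ns IH] P P0; first by rewrite /cnt big_seq1 P0.
rewrite cnt_cons addn_gt0 IH //; congr (is_true (P _)): P0.
by apply: funext => k; rewrite /upd; case: ifP.
Qed.

Lemma lin_cnt_gt0 ns P : lin P -> 0 < cnt ns P.
Proof. by case=> P0 _; apply: cnt0_gt0. Qed.

Lemma lin_upd P i : lin P -> lin (fun x => P (upd x i false)).
Proof.
move=> [P0 PD]; split.
  by congr (is_true (P _)): P0; apply: funext => k; rewrite /upd; case: ifP.
by move=> x y Px Py; rewrite -[false](addbb false) upd_addx; apply: PD.
Qed.

(** Among the members of a linear [P], those with [x i = 1] are either absent or a translate of
    those with [x i = 0]. *)
Lemma lin_pow2 ns P : lin P -> exists l, cnt ns P = 2 ^ l.
Proof.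
elim: ns P => [|i ns IH] P lP.
  by exists 0; rewrite /cnt big_seq1; case: lP => ->.
have [l El] := IH _ (lin_upd i lP).
rewrite cnt_cons El; case: (posnP (cnt ns (fun x => P (upd x i true)))) => [->|].
  by exists l; rewrite addn0.
move=> /cnt_gt0[y sy Py]; exists l.+1.
rewrite expnS mul2n -addnn; congr (_ + _); rewrite -El.
rewrite /cnt -[LHS](asum_shift (fun x => nat_of_bool (P (upd x i true))) sy).
apply: eq_bigr => x _; congr nat_of_bool.
by rewrite -[true]/(false (+) true) upd_addx lin_addr.
Qed.

(** [P] is a subspace and [q] a linear form on it: the part where [q] is 1 is empty or a translate
    of the kernel. *)
Lemma cnt_half ns (P : pred (nat -> bool)) (q : (nat -> bool) -> bool) :
  lin P -> (forall x y, q (addx x y) = q x (+) q y) ->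
  cnt ns P <= 2 * cnt ns (fun x => P x && ~~ q x).
Proof.
move=> lP qD.
have -> : cnt ns P = cnt ns (fun x => P x && ~~ q x) + cnt ns (fun x => P x && q x).
  by rewrite /cnt -big_split; apply: eq_bigr => x _; case: (P x) (q x) => [] [].
rewrite mul2n -addnn leq_add2l.
case: (posnP (cnt ns (fun x => P x && q x))) => [->//|/cnt_gt0[y sy /andP[Py qy]]].
rewrite /cnt -(asum_shift (fun x => nat_of_bool (P x && q x)) sy).
by apply: leq_sum => x _; rewrite lin_addr // qD qy addbT.
Qed.

Lemma supp_upd i ns x b : supp ns x -> supp (i :: ns) (upd x i b).
Proof.
by move=> sx k; rewrite inE negb_or => /andP[ki kns]; rewrite /upd (negbTE ki) sx.
Qed.

Lemma cnt_le1 ns (P : pred (nat -> bool)) : uniq ns ->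
  (forall x y, supp ns x -> supp ns y -> P x -> P y -> x = y) -> cnt ns P <= 1.
Proof.
elim: ns P => [|i ns IH] P /=; first by rewrite /cnt big_seq1 leq_b1.
case/andP=> i_ns u_ns inj.
have aux b : cnt ns (fun x => P (upd x i b)) <= 1.
  apply: IH => // x y sx sy Px Py.
  have E : upd x i b = upd y i b by apply: inj => //; apply: supp_upd.
  apply: funext => k; have := congr1 (fun z => z k) E; rewrite /upd.
  by case: eqP => // ->; rewrite sx ?sy.
rewrite cnt_cons; case: (posnP (cnt ns (fun x => P (upd x i false)))) => [->|].
  by rewrite add0n.
case/cnt_gt0=> y sy Py; case: (posnP (cnt ns (fun x => P (upd x i true)))) => [->|].
  by rewrite addn0.
case/cnt_gt0=> z sz Pz.
have /(congr1 (fun f => f i)) := inj _ _ (@supp_upd _ _ _ _ sy) (@supp_upd _ _ _ _ sz) Py Pz.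
by rewrite /upd eqxx.
Qed.

(** Two subspaces that meet only in 0: each [z] is in at most one way the sum of a member of [P] and
    a member of [Q], so the pairs inject into the assignments. *)
Lemma cnt_transversal ns (P Q : pred (nat -> bool)) : uniq ns -> lin P -> lin Q ->
  (forall z, supp ns z -> P z -> Q z -> z = zerox) -> cnt ns P * cnt ns Q <= 2 ^ size ns.
Proof.
move=> u_ns lP lQ PQ.
have -> : cnt ns P * cnt ns Q = \sum_(z <- asg ns) cnt ns (fun x => P x && Q (addx z x)).
  rewrite /cnt exchange_big big_distrl /=; apply: eq_asum => x sx.
  rewrite -(asum_shift (fun z => nat_of_bool (Q z)) sx) big_distrr /=.
  by apply: eq_bigr => z _; rewrite -mulnb.
apply: (@leq_trans (\sum_(z <- asg ns) 1)).
  apply: leq_sum => z _; apply: cnt_le1 => // x y sx sy /andP[Px Qx] /andP[Py Qy].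
  have E : addx x y = zerox.
    apply: PQ; first by move=> k kns; rewrite /addx sx ?sy.
      by rewrite lin_addr.
    have -> : addx x y = addx (addx z x) (addx z y).
      by rewrite (addxC z y) addxA -(addxA z) (addxC z) addxK.
    by rewrite lin_addr.
  by rewrite -(addxK x y) E addxC addx0.
elim: ns {u_ns PQ} => [|i ns IH]; first by rewrite big_seq1.
by rewrite asum_cons expnS mul2n -addnn leq_add.
Qed.

(** * The bracket of a Gauss code *)

Lemma updE x i b : upd x i b i = b.
Proof. by rewrite /upd eqxx. Qed.

Lemma updN x i b k : k != i -> upd x i b k = x k.
Proof. by rewrite /upd => /negbTE ->. Qed.

Definition csum (x : nat -> bool) (g : seq nat) : bool := odd (count x g).

(* The bits x record at which crossings the colour of the arcs changes; starting
   with colour c, [dev x i c g] is the sum of the colours of the arcs by which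
   the code g enters its passages through i. *)
Fixpoint dev (x : nat -> bool) (i : nat) (c : bool) (g : seq nat) : bool :=
  if g is a :: g' then ((a == i) && c) (+) dev x i (c (+) x a) g' else false.

Lemma csum_cat x g1 g2 : csum x (g1 ++ g2) = csum x g1 (+) csum x g2.
Proof. by rewrite /csum count_cat oddD. Qed.

Lemma csum_cons x a g : csum x (a :: g) = x a (+) csum x g.
Proof. by rewrite /csum /= oddD oddb. Qed.

Lemma dev_cat x i c g1 g2 :
  dev x i c (g1 ++ g2) = dev x i c g1 (+) dev x i (c (+) csum x g1) g2.
Proof.
elim: g1 c => [|a g1 IH] c /=; first by rewrite addbF.
by rewrite IH csum_cons !addbA.
Qed.

Lemma dev_notin x i c g : i \notin g -> dev x i c g = false.
Proof.
elim: g c => //= a g IH c; rewrite inE negb_or eq_sym => /andP[/negbTE-> /IH->] //.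
Qed.

Lemma dev_col x i c g : dev x i c g = dev x i false g (+) (c && odd (count_mem i g)).
Proof.
elim: g c => [|a g IH] c /=; first by rewrite andbF.
rewrite (IH (c (+) x a)) (IH (false (+) x a)) oddD oddb.
by case: (a == i) c (x a) (dev _ _ _ _) (odd _) => [] [] [] [] [].
Qed.

Lemma dev_addx x y i c d g :
  dev (addx x y) i (c (+) d) g = dev x i c g (+) dev y i d g.
Proof.
elim: g c d => //= a g IH c d.
have -> : c (+) d (+) addx x y a = (c (+) x a) (+) (d (+) y a) by rewrite /addx addbACA.
rewrite IH; by case: (a == i) c d (dev _ _ _ _) (dev _ _ _ _) => [] [] [] [] [].
Qed.

Lemma dev_upd x j b i c g : j \notin g -> dev (upd x j b) i c g = dev x i c g.
Proof.
elim: g c => //= a g IH c; rewrite inE negb_or => /andP[ja jg].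
by rewrite IH // /upd [a == j]eq_sym (negbTE ja).
Qed.

Lemma csum_upd x j b g : j \notin g -> csum (upd x j b) g = csum x g.
Proof.
elim: g => // a g IH; rewrite inE negb_or !csum_cons => /andP[ja jg].
by rewrite IH // /upd [a == j]eq_sym (negbTE ja).
Qed.

(* The two arcs entering a crossing have different colours exactly when the
   colour changes there (oriented smoothing), or equal colours (the other
   smoothing).  The A-smoothing, s i = true, is the oriented one iff the crossing
   is positive.  There are twice as many 2-colourings as solutions. *)
Definition sol ns (sg : nat -> bool) g (s x : nat -> bool) :=
  all (fun i => dev x i false g == ((s i == sg i) && x i)) ns.

Lemma csum0 g : csum zerox g = false.
Proof. by rewrite /csum count_pred0. Qed.

Lemma dev0 i g : dev zerox i false g = false.
Proof. by elim: g => //= a g ->; rewrite andbF. Qed.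

Lemma lin_sol ns sg g s : lin (sol ns sg g s).
Proof.
split; first by apply/allP => i _; rewrite dev0 andbF.
move=> x y /allP sx /allP sy; apply/allP => i ins.
rewrite -[X in dev _ _ X](addbb false) dev_addx (eqP (sx _ ins)) (eqP (sy _ ins)).
by rewrite /addx; case: (s i == sg i).
Qed.

Section Bracket.
Local Open Scope ring_scope.

(* With t = A^2 and c crossings, this is A^(3c) times the Kauffman bracket:
   a state with a A-smoothings and l + 1 loops contributes
   t^a t^(c - l) (- (1 + t^2))^l. *)
Definition loopv : {poly int} := - (1 + 'X^2).
Definition wt (c N : nat) : {poly int} := 'X^(c - logn 2 N) * loopv ^+ logn 2 N.

Definition bk ns sg g : {poly int} :=
  \sum_(s <- asg ns) 'X^(count s ns) * wt (size ns) (cnt ns (sol ns sg g s)).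

Lemma logn2_le N c : (N <= 2 ^ c)%N -> (logn 2 N <= c)%N.
Proof.
case: (posnP N) => [->|N0 NL]; first by rewrite logn0.
rewrite -(@leq_exp2l 2) //; apply: leq_trans NL.
by apply: dvdn_leq => //; apply: pfactor_dvdnn.
Qed.

Lemma wt_dbl c N : (0 < N)%N -> wt c.+1 (2 * N) = loopv * wt c N.
Proof.
by move=> N0; rewrite /wt lognM // logn_prime //= add1n subSS exprS mulrCA.
Qed.

(** The bound on [N] keeps the truncated subtraction in [wt] exact. *)
Lemma wt_sgl c N : (N <= 2 ^ c)%N -> wt c.+1 N = 'X * wt c N.
Proof. by move=> /logn2_le lN; rewrite /wt subSn // exprS mulrA. Qed.

Lemma eq_bk ns sg sg' g : {in ns, sg =1 sg'} -> bk ns sg g = bk ns sg' g.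
Proof.
move=> E; rewrite /bk; apply: eq_bigr => s _; congr (_ * wt _ _).
by apply: eq_cnt => x _; apply: eq_in_all => i /E ->.
Qed.

Lemma bk_perm ns ns' sg g : perm_eq ns ns' -> bk ns sg g = bk ns' sg g.
Proof.
move=> pe; rewrite /bk (asum_perm _ pe); apply: eq_bigr => s _.
rewrite (permP pe) (perm_size pe) /cnt (asum_perm _ pe).
by congr (_ * wt _ _); apply: eq_bigr => x _; rewrite /sol (perm_all _ pe).
Qed.

Lemma count_upd s i b ns : i \notin ns -> count (upd s i b) ns = count s ns.
Proof.
move=> i_ns; apply: eq_in_count => k kns; rewrite /upd; case: eqP => // E.
by rewrite -E kns in i_ns.
Qed.

Lemma bk_cons i ns sg g : i \notin ns ->
  bk (i :: ns) sg g = \sum_(s <- asg ns) 'X^(count s ns) *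
    (wt (size ns).+1 (cnt (i :: ns) (sol (i :: ns) sg g (upd s i false)))
     + 'X * wt (size ns).+1 (cnt (i :: ns) (sol (i :: ns) sg g (upd s i true)))).
Proof.
move=> i_ns; rewrite /bk asum_cons -big_split; apply: eq_bigr => s _ /=.
rewrite !count_upd // /upd eqxx add0n add1n exprS mulrDr; congr (_ + _).
by rewrite -mulrA mulrCA.
Qed.

(** The oriented smoothing of a kink splits off a circle and so doubles the number of solutions; the
    other smoothing just removes the kink. *)
Lemma bk_R1 i ns sg A : i \notin ns -> i \notin A ->
  bk (i :: ns) sg (i :: i :: A) = (if sg i then - 'X^3 else -1) * bk ns sg A.
Proof.
move=> i_ns iA; rewrite bk_cons // /bk big_distrr /=; apply: eq_bigr => s _.
rewrite [RHS]mulrCA; congr (_ * _).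
have E b : cnt (i :: ns) (sol (i :: ns) sg (i :: i :: A) (upd s i b)) =
    if b == sg i then (2 * cnt ns (sol ns sg A s))%N else cnt ns (sol ns sg A s).
  have solE c x : sol (i :: ns) sg (i :: i :: A) (upd s i b) (upd x i c) =
      ((b == sg i) || ~~ c) && sol ns sg A s x.
    rewrite /sol /= eqxx !dev_notin // {1 2 3 4}/upd eqxx /=; congr (_ && _).
      by case: c b (sg i) => [] [] [].
    apply: eq_in_all => k kns; have ki : (k == i) = false.
      by apply: contraNF i_ns => /eqP <-.
    by rewrite [i == k]eq_sym ki dev_upd //= /upd ki eqxx addbb.
  rewrite cnt_cons.
  rewrite (@eq_cnt _ _ (sol ns sg A s)); last by move=> x _; rewrite solE orbT.
  case: (b == sg i) solE => solE.
    by rewrite mul2n -addnn; congr (_ + _)%N; apply: eq_cnt => x _; rewrite solE.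
  have -> : cnt ns (fun x => sol (i :: ns) sg (i :: i :: A) (upd s i b) (upd x i true)) = 0%N.
    by apply: big1 => x _; rewrite solE.
  by rewrite addn0.
rewrite !E; have Npos := lin_cnt_gt0 ns (lin_sol ns sg A s).
case: (sg i) => /=; rewrite wt_dbl // wt_sgl ?cnt_le // /loopv; ring.
Qed.

Lemma bk_cons2 i j ns sg g : i \notin j :: ns -> j \notin ns ->
  let N s a b := cnt (i :: j :: ns) (sol (i :: j :: ns) sg g (upd (upd s j b) i a)) in
  bk (i :: j :: ns) sg g = \sum_(s <- asg ns) 'X^(count s ns) *
  (wt (size ns).+2 (N s false false) + 'X * wt (size ns).+2 (N s false true)
   + 'X * wt (size ns).+2 (N s true false) + 'X^2 * wt (size ns).+2 (N s true true)).
Proof.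
move=> i_ns j_ns N; rewrite bk_cons // asum_cons -big_split; apply: eq_bigr => s _ /=.
rewrite !count_upd // !updE add0n add1n (exprS _ (count _ _)) /N; ring.
Qed.

Lemma bk_cons3 i j k ns sg g : i \notin j :: k :: ns -> j \notin k :: ns -> k \notin ns ->
  let N s a b c := wt (size ns).+3 (cnt (i :: j :: k :: ns)
    (sol (i :: j :: k :: ns) sg g (upd (upd (upd s k c) j b) i a))) in
  bk (i :: j :: k :: ns) sg g = \sum_(s <- asg ns) 'X^(count s ns) *
  (N s false false false + 'X * N s false false true
   + 'X * N s false true false + 'X^2 * N s false true true
   + 'X * N s true false false + 'X^2 * N s true false true
   + 'X^2 * N s true true false + 'X^3 * N s true true true).
Proof.
move=> i_ns j_ns k_ns N; rewrite bk_cons2 // asum_cons -big_split; apply: eq_bigr => s _ /=.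
rewrite !count_upd // !updE add0n add1n (exprS _ (count _ _)) /N; ring.
Qed.

Lemma all_consE (T : Type) (P : pred T) a l : all P (a :: l) = P a && all P l.
Proof. by []. Qed.

Lemma cnt_cons2 i j ns P : cnt (i :: j :: ns) P = (\sum_(x <- asg ns)
  (P (upd (upd x j false) i false) + P (upd (upd x j true) i false)
   + P (upd (upd x j false) i true) + P (upd (upd x j true) i true)))%N.
Proof. by rewrite !cnt_cons !big_split /= !addnA. Qed.

Lemma cnt_cons3 i j k ns P : cnt (i :: j :: k :: ns) P = (\sum_(x <- asg ns)
  (P (upd (upd (upd x k false) j false) i false) + P (upd (upd (upd x k true) j false) i false)
   + P (upd (upd (upd x k false) j true) i false) + P (upd (upd (upd x k true) j true) i false)
   + P (upd (upd (upd x k false) j false) i true) + P (upd (upd (upd x k true) j false) i true)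
   + P (upd (upd (upd x k false) j true) i true) + P (upd (upd (upd x k true) j true) i true)))%N.
Proof. by rewrite !cnt_cons !big_split /= !addnA. Qed.

Lemma notin_neq (T : eqType) (i k : T) (ns : seq T) : i \notin ns -> k \in ns -> (k == i) = false.
Proof. by move=> i_ns kns; apply: contraNF i_ns => /eqP <-. Qed.

(** Of the four states of the two crossings, one joins the strands as in [A ++ B]. The other three
    all reconnect them the other way, one of them with an additional circle, and cancel by the value
    of [loopv]. *)
Lemma bk_R2 i j ns sg d A B : i \notin j :: ns -> j \notin ns ->
    i \notin A ++ B -> j \notin A ++ B -> sg j = ~~ sg i ->
  bk (i :: j :: ns) sg ([:: i; j] ++ A ++ (if d then [:: i; j] else [:: j; i]) ++ B)
  = 'X^3 * bk ns sg (A ++ B).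
Proof.
move=> i_ns j_ns; rewrite !mem_cat !negb_or => /andP[iA iB] /andP[jA jB] sgj.
have nji : j != i by move: i_ns; rewrite inE negb_or eq_sym => /andP[].
have /andP[nij i_ns'] : (i != j) && (i \notin ns) by rewrite inE negb_or in i_ns.
rewrite bk_cons2 // /bk big_distrr /=; apply: eq_bigr => s _.
rewrite [RHS]mulrCA; congr (_ * _).
set g := i :: j :: A ++ _.
pose rest u x := all (fun k => dev x k u A (+) dev x k (csum x A) B == (s k == sg k) && x k) ns.
have solE si sj xi xj x :
    sol (i :: j :: ns) sg g (upd (upd s j sj) i si) (upd (upd x j xj) i xi) =
    [&& xi (+) xj (+) csum x A (+) (~~ d && xj) == (si == sg i) && xi,
        xi (+) (xi (+) xj (+) csum x A (+) (d && xi)) == (sj == sg j) && xj &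
        rest (xi (+) xj) x].
  set y := upd _ i xi.
  have yi : y i = xi by rewrite /y updE.
  have yj : y j = xj by rewrite /y updN 1?eq_sym // updE.
  have ydev D k c : i \notin D -> j \notin D -> dev y k c D = dev x k c D.
    by move=> iD jD; rewrite /y !dev_upd.
  have yA : csum y A = csum x A by rewrite /y !csum_upd.
  have yN k : (k == i) = false -> (k == j) = false -> y k = x k.
    by move=> ki kj; rewrite /y !updN ?ki ?kj.
  clearbody y.
  have gi : dev y i false g = xi (+) xj (+) csum x A (+) (~~ d && xj).
    rewrite /g /= dev_cat (@dev_notin _ i _ A) // yi yj yA.
    by case: d {g} => /=; rewrite ?eqxx eq_sym (negbTE nij) /= ?eqxx dev_notin //= ?yj ?addbF.
  have gj : dev y j false g = xi (+) (xi (+) xj (+) csum x A (+) (d && xi)).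
    rewrite /g /= dev_cat (@dev_notin _ j _ A) // yi yj yA.
    by case: d {g gi} => /=; rewrite ?eqxx (negbTE nij) /= ?eqxx dev_notin //= ?yi ?addbF.
  rewrite /sol !all_consE gi gj updE (updN _ _ nji) updE yi yj; congr [&& _, _ & _].
  rewrite /rest; apply: eq_in_all => k kns.
  have ki := notin_neq i_ns' kns; have kj := notin_neq j_ns kns.
  rewrite /g /= [i == k]eq_sym [j == k]eq_sym ki kj /= dev_cat yA yi yj (ydev A) //.
  rewrite yN // !updN ?ki ?kj //; congr (_ (+) _ == _).
  case: d {g gi gj} => /=; rewrite [i == k]eq_sym [j == k]eq_sym ki kj /= yi yj ydev //;
    by congr dev; case: xi xj (csum x A) {y yi yj yA ydev yN} => [] [] [].
(* The numbers of solutions when the strands run through as in [A ++ B], and when they are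
   reconnected the other way; [p] is the colour of the arc with which [A] starts. *)
pose N0 := cnt ns (rest false).
pose psi x p := (if d then p == csum x A else ~~ csum x A) && rest p x.
pose N1 := (cnt ns (psi^~ false) + cnt ns (psi^~ true))%N.
have cntE si sj : cnt (i :: j :: ns) (sol (i :: j :: ns) sg g (upd (upd s j sj) i si)) =
    if (si == sg i) == (sj == sg j) then (if (si == sg i) == d then N0 else (2 * N1)%N)
    else N1.
  rewrite cnt_cons2 /N0 /N1 /cnt.
  under eq_bigr => x _ do rewrite !solE.
  rewrite /psi.
  case: ifP => E1; [case: ifP => E2 | ]; rewrite ?mul2n -?addnn -?big_split /=;
    apply: eq_bigr => x _; move: E1 {solE}; try move: E2;
    case: (si == sg i) (sj == sg j) (d) (csum x A) => [] [] [] [] //= _;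
    do ?[move=> _]; case: (rest false x) (rest true x) => [] [] //.
have N0E : cnt ns (sol ns sg (A ++ B) s) = N0.
  by apply: eq_cnt => x _; apply: eq_in_all => k _; rewrite dev_cat.
have N1pos : (0 < N1)%N.
  rewrite addn_gt0; apply/orP; left; apply: cnt0_gt0; rewrite /psi csum0.
  apply/andP; split; first by case: (d).
  by apply/allP => k _; rewrite !dev0 csum0 dev0 andbF.
have N0le : (N0 <= 2 ^ size ns)%N by apply: cnt_le.
have N1le : (N1 <= 2 ^ (size ns).+1)%N by rewrite expnS mul2n -addnn leq_add ?cnt_le.
have W1 : wt (size ns).+2 N1 = 'X * wt (size ns).+1 N1 by rewrite wt_sgl.
have W2 : wt (size ns).+2 (2 * N1) = loopv * wt (size ns).+1 N1 by rewrite wt_dbl.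
have W0 : wt (size ns).+2 N0 = 'X^2 * wt (size ns) N0.
  rewrite wt_sgl ?wt_sgl ?mulrA // (leq_trans N0le) // leq_exp2l //.
by rewrite !cntE N0E sgj; case: (sg i); case: (d) => /=; rewrite W0 W1 W2 /loopv; ring.
Qed.

End Bracket.

(** * The third Reidemeister move *)

Definition swap2 (T : Type) (b : bool) (x y : T) := if b then [:: x; y] else [:: y; x].

(* The rest of the code sees the three crossings of a third move only through
   the total colour changes u, v along the first two strands (the third is their
   sum); al and be are the colour changes between the strands.  A state of the
   three crossings is thus determined by the table of the number (0, 1 or 2) of
   local solutions for each (al, be, u, v), a table with entries 2 giving an
   additional loop; the boolean o distinguishes MoveR3 from MoveR3'. *)
Section ThirdMoveTables.
Variables (o a b c oi oj ok : bool).

Definition eqs3 (al be xi xj xk : bool) : bool :=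
  let p := xi (+) xj (+) al in
  let q := p (+) be (+) (if o then xi (+) xk else xj (+) xk) in
  [&& (~~ a && xj) (+) (if o then p else q) (+) (~~ b && xk) == oi && xi,
      (a && xi) (+) (if o then q else p) (+) (~~ c && xk) == oj && xj &
      (if o then p else q) (+) (b && xi) (+) ((if o then q else p) (+) (c && xj))
        == ok && xk].

Definition tau (al be u v : bool) : nat :=
  let f xi := eqs3 al be xi (xi (+) u) (if o then xi (+) v else xi (+) u (+) v) in
  f false + f true.

Definition tab3 : seq nat :=
  [:: tau false false false false; tau false false false true;
      tau false false true false; tau false false true true;
      tau false true false false; tau false true false true;
      tau false true true false; tau false true true true;
      tau true false false false; tau true false false true;
      tau true false true false; tau true false true true;
      tau true true false false; tau true true false true;
      tau true true true false; tau true true true true].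

End ThirdMoveTables.

Definition tab_entry (l : seq nat) (al be u v : bool) : nat :=
  nth 0 l (8 * al + 4 * be + 2 * u + v).

Section TableSum.
Local Open Scope ring_scope.
Variables (R : comNzRingType) (t : R) (w : seq nat -> R).

(** The weight of a local state, with [w] standing for the rest of the code: a table with entries 0
    and 2 is twice another table and has one more loop. *)
Definition tab_val (l : seq nat) : R :=
  if all (fun q => q <= 1)%N l then t * w l else - (1 + t ^+ 2) * w (map half l).

Definition tab_sum (o a b c e : bool) : R :=
  let v x y z := tab_val (tab3 o a b c (x == (e == c)) (y == (e == b)) (z == (e == a))) in
  v false false false + t * v false false true + t * v false true false
  + t ^+ 2 * v false true true + t * v true false false + t ^+ 2 * v true false true
  + t ^+ 2 * v true true false + t ^+ 3 * v true true true.

(** All 32 cases are decided by computing the tables. The values [w l] remain unknowns, so the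
    identity holds whatever the rest of the code is. *)
Lemma tab_sum_flip o a b c e :
  tab_sum o a b c e =
  let v x y z := tab_val (tab3 o (~~ a) (~~ b) (~~ c)
    (x == (e == c)) (y == (e == b)) (z == (e == a))) in
  v false false false + t * v false false true + t * v false true false
  + t ^+ 2 * v false true true + t * v true false false + t ^+ 2 * v true false true
  + t ^+ 2 * v true true false + t ^+ 3 * v true true true.
Proof.
rewrite /tab_sum.
case: o a b c e => [] [] [] [] [] /=;
  repeat match goal with |- context [tab_val (tab3 ?o ?a ?b ?c ?x ?y ?z)] =>
    let l := eval vm_compute in (tab3 o a b c x y z) in
    change (tab3 o a b c x y z) with l end;
  rewrite /tab_val /=;
  repeat match goal with |- context [w ?l] => move: (w l) => ? end; ring.
Qed.
End TableSum.

Section ThirdMove.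
Variables (i j k : nat) (ns : seq nat) (sg : nat -> bool) (A B C : seq nat).
Hypotheses (i_ns : i \notin j :: k :: ns) (j_ns : j \notin k :: ns) (k_ns : k \notin ns).
Hypotheses (iABC : i \notin A ++ B ++ C) (jABC : j \notin A ++ B ++ C)
  (kABC : k \notin A ++ B ++ C).

Definition code3 (o a b c : bool) : seq nat :=
  swap2 a i j ++ A ++ (if o then swap2 b i k else swap2 c j k) ++ B ++
    (if o then swap2 c j k else swap2 b i k) ++ C.

(** The third strand changes the colour by the sum of [u] and [v], so [C] starts with the changes
    along [A] and [B] only. *)
Let rest s u v x := all (fun m =>
  dev x m u A (+) dev x m (u (+) csum x A (+) v) B (+) dev x m (csum x A (+) csum x B) C
  == (s m == sg m) && x m) ns.

Let N s l := \sum_(x <- asg ns)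
  (tab_entry l (csum x A) (csum x B) false false * rest s false false x
 + tab_entry l (csum x A) (csum x B) false true * rest s false true x
 + tab_entry l (csum x A) (csum x B) true false * rest s true false x
 + tab_entry l (csum x A) (csum x B) true true * rest s true true x).

Lemma sol3E o a b c s si sj sk xi xj xk x :
  sol (i :: j :: k :: ns) sg (code3 o a b c) (upd (upd (upd s k sk) j sj) i si)
    (upd (upd (upd x k xk) j xj) i xi) =
  eqs3 o a b c (si == sg i) (sj == sg j) (sk == sg k) (csum x A) (csum x B) xi xj xk
  && rest s (xi (+) xj) (if o then xi (+) xk else xj (+) xk) x.
Proof.
move: iABC jABC kABC; rewrite !mem_cat !negb_or.
move=> /and3P[iA iB iC] /and3P[jA jB jC] /and3P[kA kB kC].
move: i_ns j_ns; rewrite !inE !negb_or => /and3P[nij nik i_ns'] /andP[njk j_ns'].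
have nji : j != i by rewrite eq_sym.
have nki : k != i by rewrite eq_sym.
have nkj : k != j by rewrite eq_sym.
set y := upd _ i xi.
have yi : y i = xi by rewrite /y updE.
have yj : y j = xj by rewrite /y /upd (negbTE nji) eqxx.
have yk : y k = xk by rewrite /y /upd (negbTE nki) (negbTE nkj) eqxx.
have ydev D m d : i \notin D -> j \notin D -> k \notin D -> dev y m d D = dev x m d D.
  by move=> *; rewrite /y !dev_upd.
have ycsum D : i \notin D -> j \notin D -> k \notin D -> csum y D = csum x D.
  by move=> *; rewrite /y !csum_upd.
have yN m : (m == i) = false -> (m == j) = false -> (m == k) = false -> y m = x m.
  by move=> mi mj mk; rewrite /y !updN ?mi ?mj ?mk.
clearbody y.
have devE m : dev y m false (code3 o a b c) =
  dev y m false (swap2 a i j) (+)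
  dev y m (xi (+) xj) A (+)
  dev y m (xi (+) xj (+) csum x A) (if o then swap2 b i k else swap2 c j k) (+)
  dev y m (xi (+) xj (+) csum x A (+) (if o then xi (+) xk else xj (+) xk)) B (+)
  dev y m (xi (+) xj (+) csum x A (+) (if o then xi (+) xk else xj (+) xk) (+) csum x B)
    (if o then swap2 c j k else swap2 b i k) (+)
  dev y m (csum x A (+) csum x B) C.
  have sT : csum y (swap2 a i j) = xi (+) xj.
    by rewrite /swap2; case: ifP => _; rewrite !csum_cons yi yj addbF // addbC.
  have sM : csum y (if o then swap2 b i k else swap2 c j k) = if o then xi (+) xk else xj (+) xk.
    by rewrite /swap2; do 2?case: ifP => _; rewrite !csum_cons ?yi ?yj yk addbF // addbC.
  have sL : csum y (if o then swap2 c j k else swap2 b i k) = if o then xj (+) xk else xi (+) xk.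
    by rewrite /swap2; do 2?case: ifP => _; rewrite !csum_cons ?yi ?yj yk addbF // addbC.
  rewrite /code3 !dev_cat sT sM sL !ycsum // -!addbA; do 5!congr (_ (+) _).
  by congr dev; case: (o) xi xj xk (csum x A) (csum x B) {yi yj yk sT sM sL}
    => [] [] [] [] [] [].
have sw d m u v p : dev y m d (swap2 p u v) =
    ((u == m) && (d (+) (~~ p && y v))) (+) ((v == m) && (d (+) (p && y u))).
  by rewrite /swap2; case: p => /=; rewrite !addbF // addbC.
rewrite /sol !all_consE updE !(updN _ _ nji) !(updN _ _ nki) !(updN _ _ nkj) !updE yi yj yk.
rewrite !devE !(dev_notin _ _ iA) !(dev_notin _ _ iB) !(dev_notin _ _ iC).
rewrite !(dev_notin _ _ jA) !(dev_notin _ _ jB) !(dev_notin _ _ jC).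
rewrite !(dev_notin _ _ kA) !(dev_notin _ _ kB) !(dev_notin _ _ kC).
rewrite /eqs3 -!andbA; congr [&& _, _, _ & _].
- rewrite !sw; case: (o); rewrite !sw !eqxx ?(negbTE nji) ?(negbTE nki) ?yi ?yj ?yk;
    by congr (_ == _); case: xi xj xk (csum x A) (csum x B) (a) (b) (c) {devE yi yj yk}
    => [] [] [] [] [] [] [] [].
- rewrite !sw; case: (o); rewrite !sw !eqxx ?(negbTE nij) ?(negbTE nkj) ?yi ?yj ?yk;
    by congr (_ == _); case: xi xj xk (csum x A) (csum x B) (a) (b) (c) {devE yi yj yk}
    => [] [] [] [] [] [] [] [].
- rewrite !sw; case: (o); rewrite !sw !eqxx ?(negbTE nik) ?(negbTE njk) ?yi ?yj ?yk;
    by congr (_ == _); case: xi xj xk (csum x A) (csum x B) (a) (b) (c) {devE yi yj yk}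
    => [] [] [] [] [] [] [] [].
apply: eq_in_all => m mns.
have mi := notin_neq i_ns' mns; have mj := notin_neq j_ns' mns; have mk := notin_neq k_ns mns.
rewrite devE yN // !updN ?mi ?mj ?mk // (ydev A) // (ydev B) // (ydev C) // !sw [i == m]eq_sym [j == m]eq_sym mi mj /=.
by case: (o); rewrite !sw [i == m]eq_sym [j == m]eq_sym [k == m]eq_sym mi mj mk /= !addbF.
Qed.

Lemma cnt3E o a b c s si sj sk :
  cnt (i :: j :: k :: ns) (sol (i :: j :: k :: ns) sg (code3 o a b c)
    (upd (upd (upd s k sk) j sj) i si)) =
  N s (tab3 o a b c (si == sg i) (sj == sg j) (sk == sg k)).
Proof.
rewrite cnt_cons3; apply: eq_bigr => x _; rewrite !sol3E.
set E := eqs3 _ _ _ _ _ _ _.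
have tE al be u v : tab_entry (tab3 o a b c (si == sg i) (sj == sg j) (sk == sg k)) al be u v
    = tau o a b c (si == sg i) (sj == sg j) (sk == sg k) al be u v.
  by case: al be u v => [] [] [] [].
rewrite !tE /tau -/E -!mulnb; case: (o) => /=;
  do ?[move: (nat_of_bool _) => ?]; ring.
Qed.

(** What [tab_val] needs: the entries 2 occur without entries 1, and the first entry, to which the
    zero solution contributes, is positive, so that halving the table adds exactly one loop. *)
Definition tab_ok (l : seq nat) : bool :=
  [&& size l == 16, 0 < head 0 l &
     all (fun q => q <= 1) l || all (fun q => (q == 0) || (q == 2)) l].

Lemma tab3_ok o a b c oi oj ok : tab_ok (tab3 o a b c oi oj ok).
Proof. by case: o a b c oi oj ok => [] [] [] [] [] [] []. Qed.

Lemma rest_zero s : rest s false false zerox.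
Proof. by apply/allP => m _; rewrite !csum0 !dev0 andbF. Qed.

Lemma N_gt0 s l : 0 < head 0 l -> 0 < N s l.
Proof.
move=> l0; apply: leq_trans (cnt0_gt0 ns (P := fun x =>
  [&& ~~ csum x A, ~~ csum x B & rest s false false x]) _) _.
  by rewrite !csum0 rest_zero.
apply: leq_sum => x _; case: (csum x A) (csum x B) (rest s false false x) => [] [] [] //=.
by rewrite /tab_entry /= nth0 muln1; case: (head 0 l) l0.
Qed.

Lemma N_le s l : all (fun q => q <= 1) l -> N s l <= 2 ^ (size ns).+2.
Proof.
move=> /allP l1; have le1 al be u v : tab_entry l al be u v <= 1.
  rewrite /tab_entry; case: (ltnP (8 * al + 4 * be + 2 * u + v) (size l)) => L.
    by apply: l1; apply: mem_nth.
  by rewrite nth_default.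
apply: (@leq_trans (\sum_(x <- asg ns) 4)).
  apply: leq_sum => x _; have m1 q r : q <= 1 -> q * nat_of_bool r <= 1.
    by case: r => q1; rewrite ?muln1 ?muln0.
  by rewrite -[4]/(1 + 1 + 1 + 1) !leq_add ?m1.
elim: (ns) => [|h t IH]; first by rewrite big_seq1.
by rewrite asum_cons /= expnS mul2n -addnn leq_add.
Qed.

Lemma N_half s l : all (fun q => (q == 0) || (q == 2)) l -> N s l = 2 * N s (map half l).
Proof.
move=> /allP l2; have tE al be u v : tab_entry l al be u v = 2 * tab_entry (map half l) al be u v.
  rewrite /tab_entry; case: (ltnP (8 * al + 4 * be + 2 * u + v) (size l)) => L.
    by rewrite (nth_map 0) //; case/orP: (l2 _ (mem_nth 0 L)) => /eqP ->.
  by rewrite !nth_default ?size_map.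
by rewrite /N big_distrr /=; apply: eq_bigr => x _; rewrite !tE; lia.
Qed.

Local Open Scope ring_scope.

Let W s l := wt (size ns).+2 (N s l).
Lemma wt_tab s l : tab_ok l -> wt (size ns).+3 (N s l) = tab_val 'X (W s) l.
Proof.
rewrite /tab_val /W => /and3P[/eqP l16 l0]; case: ifP => [l1 _|_ l2].
  by rewrite wt_sgl // N_le.
rewrite N_half // wt_dbl // N_gt0 //.
case: l l16 l0 l2 => // h t _ /= h0 /andP[/orP[]/eqP E _]; by rewrite E in h0 *.
Qed.

Lemma bk_R3 o a b c e : sg i = (e == c) -> sg j = (e == b) -> sg k = (e == a) ->
  bk (i :: j :: k :: ns) sg (code3 o a b c) =
  bk (i :: j :: k :: ns) sg (code3 o (~~ a) (~~ b) (~~ c)).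
Proof.
move=> sgi sgj sgk; rewrite !bk_cons3 //; apply: eq_bigr => s _; congr (_ * _).
rewrite !cnt3E !wt_tab ?tab3_ok // sgi sgj sgk.
exact: (tab_sum_flip 'X (W s)).
Qed.
End ThirdMove.

(** * Invariance of the bracket under all moves *)

Lemma eq_bk_dev ns sg g g' :
  (forall x i, i \in ns -> dev x i false g = dev x i false g') -> bk ns sg g = bk ns sg g'.
Proof.
move=> E; apply: eq_bigr => s _; congr (_ * wt _ _)%R; apply: eq_cnt => x _.
by apply: eq_in_all => i ins; rewrite E.
Qed.

(** Reversal exchanges the arcs entering and leaving a passage through [i], whose colours differ by
    [x i]. *)
Lemma dev_rev x i c g :
  dev x i c (rev g) = dev x i (c (+) csum x g) g (+) (odd (count_mem i g) && x i).
Proof.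
elim: g c => [|a g IH] c //=.
rewrite rev_cons -cats1 dev_cat IH csum_cons /= addbF.
have -> : csum x (rev g) = csum x g by rewrite /csum count_rev.
rewrite oddD oddb [c (+) (x a (+) _)]addbCA -addbA [_ (+) x a]addbC !addbA addbb /=.
by case: eqP => [->|_] /=; rewrite ?addbF //; case: (x i) c (csum x g) (dev _ _ _ _) (odd _)
  => [] [] [] [] [].
Qed.

Lemma bk_catC ns sg g1 g2 : (forall x, csum x (g1 ++ g2) = false) ->
  bk ns sg (g1 ++ g2) = bk ns sg (g2 ++ g1).
Proof.
move=> even; apply: eq_bk_dev => x i _; rewrite !dev_cat /=.
rewrite (dev_col _ _ (csum x g1)) (dev_col _ _ (csum x g2)).
(* Evenness is used twice: for [x], the two pieces shift each other's starting colour by the same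
   amount; for [pred1 i], they meet [i] equally often mod 2. *)
have := even x; have := even (pred1 i); rewrite !csum_cat {1 2}/csum /=.
by case: (csum x g1) (csum x g2) (dev _ _ _ _) (dev _ _ _ _) (odd _) (odd _)
  => [] [] [] [] [] [].
Qed.

Lemma bk_rev ns sg g : (forall x, csum x g = false) -> bk ns sg (rev g) = bk ns sg g.
Proof.
move=> even; apply: eq_bk_dev => x i _; rewrite dev_rev even.
by have := even (pred1 i); rewrite /csum /= => ->; rewrite addbF.
Qed.

Lemma dev_map f x i c g : injective f -> dev x (f i) c (map f g) = dev (x \o f) i c g.
Proof.
by move=> injf; elim: g c => //= a g IH c; rewrite IH (inj_eq injf).
Qed.

Lemma bk_map f ns sg g : injective f -> bk (map f ns) sg (map f g) = bk ns (sg \o f) g.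
Proof.
move=> injf; apply: asum_pull => // s; rewrite count_map size_map; congr (_ * wt _ _)%R.
apply: asum_pull => // x; congr nat_of_bool; rewrite /sol all_map.
by apply: eq_all => i /=; rewrite dev_map.
Qed.

Lemma uniq_map_inj_in (T1 T2 : eqType) (f : T1 -> T2) (s : seq T1) :
  uniq [seq f x | x <- s] -> {in s &, injective f}.
Proof.
elim: s => //= a s IH /andP[fa us] x y; rewrite !inE.
move=> /orP[/eqP->|xs] /orP[/eqP->|ys] // E; last exact: IH.
- by move: fa; rewrite E map_f.
- by move: fa; rewrite -E map_f.
Qed.

Definition key (a : letter) := (name a, over a).

Section GaussCode.
Variable G : seq letter.
Hypothesis gaussG : gauss_code G.

Lemma gauss_uniq : uniq [seq key a | a <- G].
Proof. by case/andP: gaussG. Qed.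

Lemma mateK : involutive mate.
Proof. by move=> [[i o] s]; rewrite /mate /name /over /positive /= negbK. Qed.

Lemma gauss_mate_perm : perm_eq (map mate G) G.
Proof.
have uG : uniq G by apply: (@map_uniq _ _ key); apply: gauss_uniq.
have uM : uniq (map mate G) by rewrite map_inj_uniq //; apply: can_inj mateK.
apply: uniq_perm => //; apply: (uniq_min_size uM _ _).2; last by rewrite size_map.
by move=> a /mapP[b bG ->]; case/andP: gaussG => _ /allP; apply.
Qed.

Lemma gauss_count (x : pred nat) :
  count x [seq name a | a <- G] = 2 * count (fun a => x (name a) && over a) G.
Proof.
have -> : count x [seq name a | a <- G] =
    count (fun a => x (name a) && over a) G + count (fun a => x (name a) && ~~ over a) G.
  by rewrite count_map; elim: (G) => //= a s ->; case: (x _) (over _) => [] []; lia.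
rewrite mul2n -addnn; congr (_ + _); rewrite -(permP gauss_mate_perm) count_map.
by apply: eq_count => -[[i o] s] /=; rewrite /mate /name /over /= negbK.
Qed.

Lemma gauss_even x : csum x [seq name a | a <- G] = false.
Proof. by rewrite /csum gauss_count mul2n odd_double. Qed.

Lemma gauss_size : size G = 2 * size (undup [seq name a | a <- G]).
Proof.
rewrite -(size_map name) -count_predT gauss_count -size_filter -(size_map name).
congr (2 * _); apply: perm_size; apply: uniq_perm; last 1 first.
- move=> k; rewrite mem_undup; apply/mapP/mapP => -[a].
    by rewrite mem_filter => /andP[_ aG] ->; exists a.
  case: (boolP (over a)) => [oa aG ->|oa aG ->]; first by exists a => //; rewrite mem_filter oa.
  by exists (mate a) => //; rewrite mem_filter; apply/andP; split=> //; case/andP: gaussG => _ /allP; apply.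
- rewrite map_inj_in_uniq ?filter_uniq ?(map_uniq gauss_uniq) //.
  move=> a b; rewrite !mem_filter => /andP[/= oa aG] /andP[/= ob bG] nab.
  by apply: (uniq_map_inj_in gauss_uniq) => //; rewrite /key nab oa ob.
- exact: undup_uniq.
Qed.

End GaussCode.

Definition sgn (G : seq letter) (i : nat) : bool :=
  has (fun a => (name a == i) && positive a) G.

Lemma sgnE G a : gauss_code G -> a \in G -> sgn G (name a) = positive a.
Proof.
move=> gG aG; apply/hasP/idP => [[b bG /andP[/eqP nab pb]]|pa]; last by exists a; rewrite ?eqxx.
have mG : mate b \in G by case/andP: gG => _ /allP; apply.
have inj := uniq_map_inj_in (gauss_uniq gG).
have [oab|oab] := eqVneq (over b) (over a).
  by rewrite -(inj _ _ bG aG) // /key nab oab.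
rewrite -(inj _ _ mG aG) //; move: nab oab; rewrite /key /mate /name /over /= => ->.
by case: b.1.2 a.1.2 => [] [].
Qed.

Definition names (G : seq letter) := [seq name a | a <- G].
Definition brk (G : seq letter) := bk (undup (names G)) (sgn G) (names G).

(** Equality up to sign and a power of t; the powers stand on both sides to avoid negative
    exponents. *)
Definition requiv (p q : {poly int}) : Prop :=
  exists i j (b : bool), ('X^i * p = (-1) ^+ b * 'X^j * q)%R.

Lemma requiv_refl p : requiv p p.
Proof. by exists 0, 0, false; rewrite !expr0 !mul1r. Qed.

Lemma requiv_sym p q : requiv p q -> requiv q p.
Proof.
case=> i [j [b E]]; exists j, i, b; rewrite -mulrA E !mulrA -expr2 sqrr_sign mul1r //.
Qed.

Lemma requiv_trans q p r : requiv p q -> requiv q r -> requiv p r.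
Proof.
case=> i [j [b E]] [i' [j' [b' E']]]; exists (i + i'), (j' + j), (b (+) b').
have aux (R : comNzRingType) (xi xi' xj xj' u v p' q' r' : R) : (xi * p' = u * xj * q' ->
    xi' * q' = v * xj' * r' -> xi * xi' * p' = u * v * (xj' * xj) * r')%R.
  move=> e e'; have -> : (xi * xi' * p' = xi' * (xi * p'))%R by ring.
  have -> : (xi' * (xi * p') = u * xj * (xi' * q'))%R by rewrite e; ring.
  by rewrite e'; ring.
by rewrite !exprD signr_addb; apply: aux E E'.
Qed.

Lemma brk_rot m G : gauss_code G -> brk (rot m G) = brk G.
Proof.
move=> gG; rewrite /brk /names map_rot.
rewrite (@bk_perm _ (undup (names G))); last first.
  by apply: perm_undup => k; rewrite mem_rot.
rewrite (@eq_bk _ _ (sgn G)); last first.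
  by move=> k _; apply: perm_has; rewrite perm_rot.
rewrite /rot -bk_catC ?cat_take_drop // => x; exact: gauss_even.
Qed.

Lemma brk_rev G : gauss_code G -> brk (rev G) = brk G.
Proof.
move=> gG; rewrite /brk /names map_rev.
rewrite (@bk_perm _ (undup (names G))); last by apply: perm_undup => k; rewrite mem_rev.
rewrite (@eq_bk _ _ (sgn G)); last by move=> k _; rewrite /sgn has_rev.
by rewrite bk_rev // => x; apply: gauss_even.
Qed.

Lemma brk_rename f G : injective f -> brk (map (rename f) G) = brk G.
Proof.
move=> injf; rewrite /brk.
have -> : names (map (rename f) G) = map f (names G) by rewrite /names -!map_comp.
rewrite undup_map_inj // bk_map //; apply: eq_bk => k _.
by rewrite /= /sgn has_map; apply: eq_has => a /=; rewrite /rename /name /= (inj_eq injf).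
Qed.

Lemma gauss_notin (L A : seq letter) i s s' : uniq [seq key a | a <- L ++ A] ->
  (i, true, s) \in L -> (i, false, s') \in L -> i \notin names A.
Proof.
rewrite map_cat cat_uniq => /and3P[_ /hasPn H _] iT iF; apply/mapP => -[a aA Ei].
have := H _ (map_f key aA); apply/negP; rewrite negbK /key -Ei.
by case: (over a); [have := map_f key iT | have := map_f key iF].
Qed.

Lemma sgn_sub G H i : gauss_code G -> gauss_code H -> {subset H <= G} -> i \in names H ->
  sgn G i = sgn H i.
Proof. by move=> gG gH sub /mapP[a aH ->]; rewrite !sgnE // sub. Qed.

Lemma brk_R1 i o s A : let G := [:: (i, o, s); (i, ~~ o, s)] ++ A in
  gauss_code G -> gauss_code A -> requiv (brk G) (brk A).
Proof.
move=> G gG gA.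
have iA : i \notin names A.
  by apply: (@gauss_notin _ _ _ s s (gauss_uniq gG)); rewrite !inE; case: (o); rewrite eqxx ?orbT.
have E : brk G = bk (i :: undup (names A)) (sgn G) [:: i, i & names A].
  by rewrite /brk /= mem_head (negbTE iA).
rewrite E bk_R1 ?mem_undup // (@eq_bk _ (sgn G) (sgn A)); last first.
  by move=> k; rewrite mem_undup; apply: sgn_sub => // a aA; rewrite !inE aA !orbT.
case: (sgn G i); [exists 0, 3, true|exists 0, 0, true]; rewrite /= /brk; ring.
Qed.

Lemma brk_R2 i j s d A B :
  let G := [:: (i, true, s); (j, true, ~~ s)] ++ A ++
          ordered_pair d (i, false, s) (j, false, ~~ s) ++ B in
  gauss_code G -> gauss_code (A ++ B) -> requiv (brk G) (brk (A ++ B)).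
Proof.
move=> G gG gH; set H := A ++ B in gH *.
pose L := [:: (i, true, s); (j, true, ~~ s); (i, false, s); (j, false, ~~ s)].
have pG : perm_eq G (L ++ H).
  rewrite /G /H /L; apply/permP => a; rewrite /ordered_pair.
  by case: (d) => /=; rewrite !count_cat /= ?count_cat /=; lia.
have u : uniq [seq key a | a <- L ++ H].
  by rewrite -(perm_uniq (perm_map _ pG)); apply: gauss_uniq.
have iH : i \notin names H by apply: (@gauss_notin _ _ _ s s u); rewrite !inE eqxx ?orbT.
have jH : j \notin names H by apply: (@gauss_notin _ _ _ (~~ s) (~~ s) u); rewrite !inE eqxx ?orbT.
have nij : i != j by move: u; rewrite /= !inE /key /= !negb_or; case: eqP => // ->; rewrite eqxx.
have iG : (i, true, s) \in G by rewrite mem_head.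
have jG : (j, true, ~~ s) \in G by rewrite !inE eqxx orbT.
have si : sgn G i = s := sgnE gG iG; have sj : sgn G j = ~~ s := sgnE gG jG.
have -> : brk G = bk (i :: j :: undup (names H)) (sgn G)
    ([:: i; j] ++ names A ++ (if d then [:: i; j] else [:: j; i]) ++ names B).
  have -> : [:: i; j] ++ names A ++ (if d then [:: i; j] else [:: j; i]) ++ names B = names G.
    by rewrite /G /names !map_cat /ordered_pair; case: (d).
  apply: bk_perm; have -> : i :: j :: undup (names H) = undup (i :: j :: names H).
    by rewrite /= inE (negbTE nij) (negbTE iH) (negbTE jH).
  apply: perm_undup => k; rewrite /names (perm_mem (perm_map name pG)) /= !inE.
  by case: eqP => //= _; case: eqP.
rewrite bk_R2 ?mem_undup //; last 4 first.
- by rewrite inE negb_or nij mem_undup.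
- by rewrite /names -map_cat.
- by rewrite /names -map_cat.
- by rewrite si sj.
have HE : names H = names A ++ names B by rewrite /names -map_cat.
exists 0, 3, false; rewrite !expr0 !mul1r /brk -HE; congr (_ * _)%R; apply: eq_bk.
by move=> k; rewrite mem_undup; apply: sgn_sub => // a aA; rewrite (perm_mem pG) mem_cat aA orbT.
Qed.

Lemma brk_R3 (o : bool) i j k a b c e A B C :
  let T := top_strand i j (e == c) (e == b) in
  let M := middle_strand i k (e == c) (e == a) in
  let L := bottom_strand j k (e == b) (e == a) in
  let code a b c := T a ++ A ++ (if o then M b else L c) ++ B ++ (if o then L c else M b) ++ C in
  gauss_code (code a b c) -> gauss_code (code (~~ a) (~~ b) (~~ c)) ->
  brk (code a b c) = brk (code (~~ a) (~~ b) (~~ c)).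
Proof.
move=> T M L code gG gH; set G := code a b c in gG *; set H := code _ _ _ in gH *.
pose K := A ++ B ++ C.
pose X := [:: (i, true, e == c); (j, true, e == b); (i, false, e == c); (k, true, e == a);
  (j, false, e == b); (k, false, e == a)].
have pc a' b' c' : perm_eq (code a' b' c') (X ++ K).
  rewrite /code /X /K /T /M /L /top_strand /middle_strand /bottom_strand /ordered_pair.
  apply/permP => x; case: (o) (a') (b') (c') => [] [] [] [] /=;
    rewrite !count_cat /= ?count_cat /= ?count_cat /=; lia.
have u : uniq [seq key a | a <- X ++ K].
  by rewrite -(perm_uniq (perm_map _ (pc a b c))); apply: gauss_uniq.
have iK : i \notin names K by apply: (@gauss_notin _ _ _ (e == c) (e == c) u); rewrite !inE eqxx ?orbT.
have jK : j \notin names K by apply: (@gauss_notin _ _ _ (e == b) (e == b) u); rewrite !inE eqxx ?orbT.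
have kK : k \notin names K by apply: (@gauss_notin _ _ _ (e == a) (e == a) u); rewrite !inE eqxx ?orbT.
have nij : i != j by apply: contraTneq u => Eij; rewrite /X Eij /= !inE eqxx.
have nik : i != k by apply: contraTneq u => Eij; rewrite /X Eij /= !inE eqxx ?orbT ?andbF.
have njk : j != k by apply: contraTneq u => Eij; rewrite /X Eij /= !inE eqxx ?orbT ?andbF.
have inX x a' b' c' : x \in X -> x \in code a' b' c' by rewrite (perm_mem (pc _ _ _)) mem_cat => ->.
have sgc a' b' c' : gauss_code (code a' b' c') -> [/\ sgn (code a' b' c') i = (e == c),
    sgn (code a' b' c') j = (e == b) & sgn (code a' b' c') k = (e == a)].
  move=> g; split; [apply: (@sgnE _ (i, true, e == c) g)|apply: (@sgnE _ (j, true, e == b) g)|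
    apply: (@sgnE _ (k, true, e == a) g)]; by apply: inX; rewrite !inE eqxx ?orbT.
have E a' b' c' : brk (code a' b' c') = bk (i :: j :: k :: undup (names K)) (sgn (code a' b' c'))
    (code3 i j k (names A) (names B) (names C) o a' b' c').
  have -> : code3 i j k (names A) (names B) (names C) o a' b' c' = names (code a' b' c').
    rewrite /code /code3 /names !map_cat.
    by case: (o) (a') (b') (c') => [] [] [] [].
  apply: bk_perm; have -> : i :: j :: k :: undup (names K) = undup (i :: j :: k :: names K).
    by rewrite /= !inE (negbTE nij) (negbTE nik) (negbTE njk) (negbTE iK) (negbTE jK) (negbTE kK).
  apply: perm_undup => m; rewrite /names (perm_mem (perm_map name (pc _ _ _))) /= !inE.
  by do 3?case: eqP => //= _.
have [si sj sk] := sgc _ _ _ gG; have [si' sj' sk'] := sgc _ _ _ gH.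
have KE : names K = names A ++ names B ++ names C by rewrite /names !map_cat.
rewrite E (bk_R3 _ _ _ _ _ _ _ si sj sk) -?KE ?mem_undup //; last 2 first.
- by rewrite !inE !negb_or nij nik mem_undup.
- by rewrite !inE !negb_or njk mem_undup.
rewrite /H E; apply: eq_bk => m; rewrite !inE mem_undup.
case/or4P=> [/eqP->|/eqP->|/eqP->|]; rewrite ?si ?sj ?sk ?si' ?sj' ?sk' // => /mapP[x xK ->].
by rewrite !sgnE // (perm_mem (pc _ _ _)) mem_cat xK orbT.
Qed.

Lemma brk_move G H : gauss_code G -> gauss_code H -> move G H -> requiv (brk G) (brk H).
Proof.
move=> gG gH mv; case: mv gG gH => {G H}.
- by move=> m G gG _; rewrite brk_rot //; apply: requiv_refl.
- by move=> G gG _; rewrite brk_rev //; apply: requiv_refl.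
- by move=> f G injf _ _; rewrite brk_rename //; apply: requiv_refl.
- by move=> i o s A; apply: brk_R1.
- by move=> i j s d A B; apply: brk_R2.
- move=> i j k a b c e A B C T M L gG gH.
  by rewrite (brk_R3 (o := true) gG gH); apply: requiv_refl.
- move=> i j k a b c e A B C T M L gG gH.
  by rewrite (brk_R3 (o := false) gG gH); apply: requiv_refl.
Qed.

Lemma brk_same_knot G H : same_knot G H -> requiv (brk G) (brk H).
Proof.
elim=> [x y [/andP[gx _] /andP[gy _] mv]|x|x y _|x y z _ IH1 _ IH2].
- exact: brk_move.
- exact: requiv_refl.
- exact: requiv_sym.
- exact: requiv_trans IH1 IH2.
Qed.

(** * Bounds for the span of the bracket *)

Lemma linI P Q : lin P -> lin Q -> lin (fun x => P x && Q x).
Proof.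
case=> P0 PD [Q0 QD]; split; first by rewrite P0 Q0.
by move=> x y /andP[Px Qx] /andP[Py Qy]; rewrite PD ?QD.
Qed.

(** One smoothing changes one equation: dropping the old one loses no solutions, imposing the new
    one at most halves their number. The subspace [P] carries the equations already treated. *)
Lemma cnt_sol_le ns L sg g s s' P : lin P ->
  cnt ns (fun x => sol L sg g s x && P x) <=
  2 ^ count (fun i => s i != s' i) L * cnt ns (fun x => sol L sg g s' x && P x).
Proof.
elim: L P => [|i L IH] P lP /=; first by rewrite mul1n.
pose Q (s : nat -> bool) x := dev x i false g == (s i == sg i) && x i.
have lQ t : lin (Q t).
  have := lin_sol [:: i] sg g t; rewrite /sol /= => -[z h]; split; first by move: z; rewrite andbT.
  by move=> x y Qx Qy; have := h x y; rewrite !andbT; apply.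
have E t : cnt ns (fun x => Q t x && sol L sg g t x && P x) =
    cnt ns (fun x => sol L sg g t x && (Q t x && P x)).
  by apply: eq_cnt => x _; rewrite andbCA andbA.
rewrite -/(Q s _) -/(Q s' _) !E; have [ss'|ss'] := eqVneq (s i) (s' i).
  have -> : cnt ns (fun x => sol L sg g s x && (Q s x && P x)) =
            cnt ns (fun x => sol L sg g s x && (Q s' x && P x)).
    by apply: eq_cnt => x _; rewrite /Q ss'.
  by rewrite add0n; apply: IH; apply: linI.
apply: (@leq_trans (cnt ns (fun x => sol L sg g s x && P x))).
  by apply: cnt_mono => x /and3P[-> _ ->].
apply: leq_trans (IH _ lP) _; rewrite add1n expnSr -mulnA leq_mul2l; apply/orP; right.
pose q x := dev x i false g (+) ((s' i == sg i) && x i).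
apply: leq_trans (@cnt_half ns _ q (linI (lin_sol L sg g s') lP) _) _.
  move=> x y; rewrite /q -[X in dev (addx x y) _ X](addbb false) dev_addx /addx.
  by case: (s' i == sg i); rewrite ?addbF //= addbACA.
rewrite leq_mul2l; apply/orP; right; apply: cnt_mono => x /andP[/andP[-> ->] nq] /=.
by move: nq; rewrite /q /Q negb_add andbT.
Qed.

Definition loops ns sg g s := logn 2 (cnt ns (sol ns sg g s)).

Lemma cnt_loops ns sg g s : cnt ns (sol ns sg g s) = 2 ^ loops ns sg g s.
Proof.
by rewrite /loops; have [l ->] := lin_pow2 ns (lin_sol ns sg g s); rewrite pfactorK.
Qed.

Lemma loops_le ns sg g s s' :
  loops ns sg g s <= count (fun i => s i != s' i) ns + loops ns sg g s'.
Proof.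
rewrite -(@leq_exp2l 2) // expnD -!cnt_loops.
have linT : lin predT by [].
have := @cnt_sol_le ns ns sg g s s' predT linT.
by do 2!rewrite (eq_cnt (Q := sol ns sg g _) (fun x _ => andbT _)).
Qed.

(** Since [loops] is one less than the number of loops, this is the bound c + 2 for the loops of the
    all-A and the all-B state together. At each crossing one of the two equations has right hand
    side 0 and the other [z k], so a common solution vanishes. *)
Lemma loops_dual ns sg g : uniq ns ->
  loops ns sg g (fun=> true) + loops ns sg g (fun=> false) <= size ns.
Proof.
move=> u_ns; rewrite -(@leq_exp2l 2) // expnD -!cnt_loops.
apply: cnt_transversal => //; try exact: lin_sol.
move=> z sz /allP solA /allP solB; apply: funext => k.
have [kns|/sz //] := boolP (k \in ns).
move: (solA _ kns) (solB _ kns) => /eqP -> /eqP.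
by rewrite /zerox; case: (sg k) (z k) => [] [].
Qed.

Section Window.
Local Open Scope ring_scope.

Lemma coef_state a c l k : (l <= c)%N -> (k < a + c - l)%N || (a + c + l < k)%N ->
  ('X^a * ('X^(c - l) * loopv ^+ l))`_k = 0.
Proof.
move=> lc hk; rewrite mulrA -exprD coefXnM; case: ltnP => // ka.
case/orP: hk => hk; first by exfalso; lia.
apply: nth_default; apply: leq_trans (size_poly_exp_leq _ _) _.
have sz : (size loopv <= 3)%N.
  rewrite /loopv size_polyN; apply: leq_trans (size_polyD _ _) _.
  by rewrite size_poly1 size_polyXn.
have : ((size loopv).-1 * l <= 2 * l)%N by rewrite leq_mul2r; apply/orP; right; lia.
by lia.
Qed.

(** A state with a A-smoothings, b B-smoothings and [loops] equal to l lives in degrees a + c - l to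
    a + c + l. Comparison with the extreme states gives l at most a + lB and at most b + lA, hence
    degrees from c - lB to 2c + lA. *)
Lemma bk_window ns sg g k k' : uniq ns -> (bk ns sg g)`_k != 0 -> (bk ns sg g)`_k' != 0 ->
  (k' <= k + 2 * size ns)%N.
Proof.
move=> u_ns.
pose lA := loops ns sg g (fun=> true); pose lB := loops ns sg g (fun=> false).
have W i : (bk ns sg g)`_i != 0 -> (size ns - lB <= i <= 2 * size ns + lA)%N.
  apply: contraNT => hi; rewrite /bk coef_sum big1 // => s _; apply: coef_state.
    by apply: logn2_le; apply: cnt_le.
  have cs := count_predC s ns.
  have := loops_le ns sg g s (fun=> true); have := loops_le ns sg g s (fun=> false).
  rewrite -/lA -/lB.
  have -> : count (fun i => s i != false) ns = count s ns by apply: eq_count => j; case: (s j).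
  have -> : count (fun i => s i != true) ns = count (predC s) ns.
    by apply: eq_count => j /=; case: (s j).
  rewrite /loops; move: hi cs; rewrite negb_and -!ltnNge; clearbody lA lB.
  move: (count s _) (count (predC s) _) (size _) (logn 2 _) => a b c l; lia.
move=> /W + /W; have := loops_dual sg g u_ns; rewrite -/lA -/lB; lia.
Qed.

Lemma brk_window G k k' : gauss_code G -> (brk G)`_k != 0 -> (brk G)`_k' != 0 ->
  (k' <= k + 2 * crossings G)%N.
Proof.
move=> gG h h'.
have -> : crossings G = size (undup (names G)) by rewrite /crossings (gauss_size gG) mul2n doubleK.
by apply: bk_window h h'; apply: undup_uniq.
Qed.

Lemma requiv_coef p q k k' : requiv p q -> p`_k != 0 -> p`_(k + k') != 0 ->
  exists m, q`_m != 0 /\ q`_(m + k') != 0.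
Proof.
case=> i [j [b E]] h h'.
have C n : p`_n != 0 -> (j <= i + n)%N && (q`_(i + n - j) != 0).
  have := congr1 (fun r : {poly int} => r`_(i + n)) E.
  rewrite coefXnM ltnNge leq_addr /= addKn => ->.
  rewrite -mulrA mulr_sign; case: b {E} => /=; rewrite ?coefN coefXnM; case: ltnP => //= _;
    by rewrite ?oppr0 ?oppr_eq0 ?eqxx.
have /andP[jk Q] := C _ h; have /andP[jk' Q'] := C _ h'.
exists (i + k - j)%N; split => //; move: Q'; congr (q`_ _ != 0); lia.
Qed.

End Window.

Lemma crossings_lower G H k c : same_knot G H -> diagram G ->
  ((brk G)`_k != 0)%R -> ((brk G)`_(k + 2 * c) != 0)%R -> c <= crossings H.
Proof.
move=> sGH dG h h'; have /andP[gH _] : diagram H by rewrite -(same_knot_diagram sGH).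
have [m [q q']] := requiv_coef (brk_same_knot sGH) h h'.
by have := brk_window gH q q'; lia.
Qed.

(** * Plats on three strands *)

(* The knot is followed from the lower left end along the strand U to the
   right, along Q back to the left and along R to the right again.  A state lists
   the strands from bottom to top; the item (i, (h, s)) is a crossing named i
   of the two lower (h = false) or the two upper strands whose ascending strand
   is on top iff s. *)
Definition role := option bool.
Notation roleU := (None : role).
Notation roleQ := (Some false : role).
Notation roleR := (Some true : role).
Definition state := (role * role * role)%type.
Definition item := (nat * (bool * bool))%type.

Definition asc (h : bool) (p : state) : role := if h then p.1.2 else p.1.1.
Definition desc (h : bool) (p : state) : role := if h then p.2 else p.1.2.
Definition turn (h : bool) (p : state) : state :=
  if h then (p.1.1, p.2, p.1.2) else (p.1.2, p.1.1, p.2).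
Definition isperm (p : state) := uniq [:: p.1.1; p.1.2; p.2].

(** Two strands running in the same horizontal direction form a negative crossing when the ascending
    one is on top; reversing one of them, as for Q, changes the sign. *)
Definition item_sign (h s : bool) (p : state) : bool :=
  s == ((asc h p == roleQ) (+) (desc h p == roleQ)).

Definition item_letter (r : role) (p : state) (t : item) : seq letter :=
  let: (i, (h, s)) := t in
  if r == asc h p then [:: (i, s, item_sign h s p)]
  else if r == desc h p then [:: (i, ~~ s, item_sign h s p)] else [::].

Fixpoint strand (r : role) (p : state) (T : seq item) : seq letter :=
  if T is t :: T' then item_letter r p t ++ strand r (turn t.2.1 p) T' else [::].

Definition code (p : state) (T : seq item) : seq letter :=
  strand roleU p T ++ rev (strand roleQ p T) ++ strand roleR p T.

Definition final (p : state) (T : seq item) : state := foldl (fun q t => turn t.2.1 q) p T.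

Definition tnames (T : seq item) : seq nat := map fst T.

Lemma isperm_turn h p : isperm (turn h p) = isperm p.
Proof. by case: p => [[a b] c]; case: h a b c => [] [[]|] [[]|] [[]|]. Qed.

Lemma isperm_final p T : isperm (final p T) = isperm p.
Proof. by elim: T p => //= t T IH p; rewrite IH isperm_turn. Qed.

Lemma strand_cat r p T1 T2 : strand r p (T1 ++ T2) = strand r p T1 ++ strand r (final p T1) T2.
Proof. by elim: T1 p => //= t T1 IH p; rewrite IH catA. Qed.

Definition item_pair (p : state) (t : item) : seq letter :=
  let: (i, (h, s)) := t in [:: (i, s, item_sign h s p); (i, ~~ s, item_sign h s p)].

Fixpoint item_pairs (p : state) (T : seq item) : seq letter :=
  if T is t :: T' then item_pair p t ++ item_pairs (turn t.2.1 p) T' else [::].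

Lemma code_perm p T : isperm p -> perm_eq (code p T) (item_pairs p T).
Proof.
elim: T p => //= [[i [h s]]] T IH p pp.
have pp' : isperm (turn h p) by rewrite isperm_turn.
apply/permP => P; have := permP (IH _ pp') P; rewrite /code !rev_cat !count_cat !count_rev /=.
move: (count P (strand _ _ _)) (count P (strand _ _ _)) (count P (strand _ _ _)) => n1 n2 n3 <-.
move: pp {IH pp'}; case: p => [[a b] c].
by case: h a b c => [] [[]|] [[]|] [[]|] //= _; lia.
Qed.

Lemma names_item_pairs p T : names (item_pairs p T) =i tnames T.
Proof.
elim: T p => //= [[i [h s]]] T IH p k; rewrite /= !inE IH orbA orbb //.
Qed.

Lemma item_pairs_gauss p T : uniq (tnames T) -> gauss_code (item_pairs p T).
Proof.
elim: T p => //= [[i [h s]]] T IH p /andP[iT uT].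
have /andP[u m] := IH (turn h p) uT.
have notin o : (i, o) \notin [seq (name a, over a) | a <- item_pairs (turn h p) T].
  apply: contra iT => /mapP[a aT [Ei _]]; rewrite -(names_item_pairs (turn h p)).
  by rewrite /= Ei map_f.
apply/andP; split.
  rewrite /= inE negb_or !notin u !andbT; apply/eqP => -[]; by case: (s).
rewrite /= !inE; apply/and3P; split.
- by rewrite eqxx orbT.
- by rewrite /mate /= negbK eqxx.
- by apply: sub_all m => a; rewrite !inE => ->; rewrite !orbT.
Qed.

Lemma gauss_perm G H : perm_eq G H -> gauss_code G = gauss_code H.
Proof.
move=> pGH; rewrite /gauss_code (perm_uniq (perm_map _ pGH)) (perm_all _ pGH).
by congr (_ && _); apply: eq_all => a; rewrite (perm_mem pGH).
Qed.

Lemma code_gauss p T : isperm p -> uniq (tnames T) -> gauss_code (code p T).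
Proof. by move=> pp uT; rewrite (gauss_perm (code_perm T pp)); apply: item_pairs_gauss. Qed.

Lemma names_code p T : isperm p -> names (code p T) =i tnames T.
Proof.
by move=> pp k; rewrite -(names_item_pairs p) (perm_mem (perm_map name (code_perm T pp))).
Qed.

(** * The bracket of a plat, computed from left to right *)

Definition colors := (bool * bool * bool)%type.

Definition getc (r : role) (p : state) (c : colors) : bool :=
  if r == p.1.1 then c.1.1 else if r == p.1.2 then c.1.2 else c.2.

Definition cstep (h b : bool) (c : colors) : colors :=
  if h then (c.1.1, c.2 (+) b, c.1.2 (+) b) else (c.1.2 (+) b, c.1.1 (+) b, c.2).

Definition active (r : role) h p := (r == asc h p) || (r == desc h p).

Lemma getc_step r p h b c : isperm p ->
  getc r (turn h p) (cstep h b c) = getc r p c (+) (active r h p && b).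
Proof.
case: p c => [[u v] w] [[c0 c1] c2].
by case: r => [[]|]; case: h u v w => [] [[]|] [[]|] [[]|] //= _;
   rewrite /getc /active /asc /desc /= ?addbF.
Qed.

(* The strands change colour together at a crossing.  The smoothing that keeps
   the strands horizontal forces the colour change; the other one forces equal
   colours on the left and leaves the new colour free. *)
Definition smooth_ok (h s st b : bool) (c : colors) : bool :=
  let u := if h then c.1.2 else c.1.1 in
  let v := if h then c.2 else c.1.2 in
  if st == s then u == v else b == u (+) v.

Definition closed_ok (p : state) (c : colors) := getc roleU p c == getc roleQ p c.

Fixpoint proc (T : seq item) (st x : nat -> bool) (p : state) (c : colors) : bool :=
  if T is (i, (h, s)) :: T' then
    smooth_ok h s (st i) (x i) c && proc T' st x (turn h p) (cstep h (x i) c)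
  else closed_ok p c.

Definition strand_names r p T := names (strand r p T).

(** This is [dev] of the whole code, strand by strand and read from left to right; the last term
    corrects for Q, which the code traverses backwards. *)
Definition devp x k p c T : bool :=
  dev x k (getc roleU p c) (strand_names roleU p T)
  (+) dev x k (getc roleQ p c) (strand_names roleQ p T)
  (+) dev x k (getc roleR p c) (strand_names roleR p T)
  (+) (odd (count_mem k (strand_names roleQ p T)) && x k).

Lemma strand_names_cons r p i h s T : strand_names r p ((i, (h, s)) :: T) =
  nseq (active r h p) i ++ strand_names r (turn h p) T.
Proof.
rewrite /strand_names /names /= map_cat; congr (_ ++ _).
by rewrite /active; do 2?case: ifP.
Qed.

Lemma devp_cons x k p c i h s T : isperm p ->
  devp x k p c ((i, (h, s)) :: T) =
  ((i == k) && (getc (asc h p) p c (+) getc (desc h p) p c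
     (+) (active roleQ h p && x k))) (+) devp x k (turn h p) (cstep h (x i) c) T.
Proof.
move=> pp; rewrite /devp !strand_names_cons !getc_step //.
have E r c' L : dev x k c' (nseq (active r h p) i ++ L) =
    ([&& active r h p, i == k & c']) (+) dev x k (c' (+) (active r h p && x i)) L.
  by case: (active r h p); rewrite /= ?addbF.
rewrite !E count_cat oddD.
have -> : odd (count_mem k (nseq (active roleQ h p) i)) = active roleQ h p && (i == k).
  by case: (active roleQ h p) => //=; rewrite addn0 oddb.
move: (dev _ _ _ _) (dev _ _ _ _) (dev _ _ _ _) (odd _) => d1 d2 d3 d4.
have -> : getc (asc h p) p c (+) getc (desc h p) p c = (active roleU h p && getc roleU p c) (+)
   (active roleQ h p && getc roleQ p c) (+) (active roleR h p && getc roleR p c).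
  case: p c pp {E} => [[u v] w] [[c0 c1] c2].
  by case: h u v w => [] [[]|] [[]|] [[]|] //= _; rewrite /getc /active /asc /desc /=;
    case: c0 c1 c2 => [] [] [].
case: (i == k) => /=; last by rewrite !andbF.
move: (active roleU h p) (active roleQ h p) (active roleR h p) => a1 a2 a3.
move: (getc _ _ _) (getc _ _ _) (getc _ _ _) => g1 g2 g3.
by case: a1 a2 a3 g1 g2 g3 (x k) d1 d2 d3 d4 => [] [] [] [] [] [] [] [] [] [] [].
Qed.

Lemma devp_notin x k p c T : isperm p -> k \notin tnames T -> devp x k p c T = false.
Proof.
elim: T p c => [|[i [h s]] T IH] p c pp.
  by rewrite /devp /=.
rewrite /= inE negb_or eq_sym => /andP[/negbTE ik kT].
by rewrite devp_cons // ik IH ?isperm_turn.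
Qed.

Fixpoint csteps (T : seq item) (x : nat -> bool) (c : colors) : colors :=
  if T is (i, (h, s)) :: T' then csteps T' x (cstep h (x i) c) else c.

Lemma getc_final r T x p c : isperm p ->
  getc r (final p T) (csteps T x c) = getc r p c (+) csum x (strand_names r p T).
Proof.
elim: T p c => [|[i [h s]] T IH] p c pp; first by rewrite /= addbF.
rewrite /= IH ?isperm_turn // getc_step // strand_names_cons csum_cat.
by case: (active r h p); rewrite /= ?csum_cons /= ?addbF ?addbA.
Qed.

Fixpoint signs_ok (sg : nat -> bool) p (T : seq item) : bool :=
  if T is (i, (h, s)) :: T' then (sg i == item_sign h s p) && signs_ok sg (turn h p) T'
  else true.

Lemma signs_code p T : isperm p -> uniq (tnames T) -> signs_ok (sgn (code p T)) p T.
Proof.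
move=> pp uT; have sub := code_gauss pp uT.
have {sub}: forall a, a \in item_pairs p T -> sgn (code p T) (name a) = positive a.
  by move=> a; rewrite -(perm_mem (code_perm T pp)) => aT; apply: sgnE.
move: (sgn _) => sg; elim: T p {pp uT} => //= [[i [h s]]] T IH p H.
rewrite -[item_sign _ _ _]/(positive (i, s, item_sign h s p)) -H ?mem_head // eqxx /=.
by apply: IH => a aT; apply: H; rewrite !inE aT !orbT.
Qed.

(** An equation of the system involves only the colours at its own crossing, so the system can be
    solved by sweeping the plat from left to right. *)
Lemma sol_proc sg st x p c T : isperm p -> uniq (tnames T) -> signs_ok sg p T ->
  all (fun k => devp x k p c T == ((st k == sg k) && x k)) (tnames T)
    && closed_ok (final p T) (csteps T x c)
  = proc T st x p c.
Proof.
elim: T p c => [|[i [h s]] T IH] p c pp //= /andP[iT uT] /andP[/eqP sgi sgT].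
have pp' : isperm (turn h p) by rewrite isperm_turn.
rewrite -IH // devp_cons // eqxx devp_notin // addbF -andbA; congr [&& _, _ & _].
  rewrite sgi /smooth_ok /item_sign; move: (st i) (x i) pp.
  case: p c {IH sgT sgi pp'} => [[u v] w] [[c0 c1] c2] si xi.
  by case: h u v w => [] [[]|] [[]|] [[]|] //= _; rewrite /getc /active /asc /desc /=;
    case: s si xi c0 c1 c2 => [] [] [] [] [] [].
apply: eq_in_all => k kT; rewrite devp_cons // [i == k]eq_sym (notin_neq iT kT) //.
Qed.

Lemma asg_cnt_two (ns : seq nat) (P1 P2 P : pred (nat -> bool)) :
  (forall x, P x = P1 x (+) P2 x) -> (forall x, ~~ (P1 x && P2 x)) ->
  cnt ns P = cnt ns P1 + cnt ns P2.
Proof.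
move=> E D; rewrite /cnt -big_split; apply: eq_bigr => x _ /=.
by rewrite E; case: (P1 x) (P2 x) (D x) => [] [].
Qed.

(** U starts at the bottom with colour 0; Q and R are joined at the left end and share the colour
    [g]. *)
Definition left_colors (g : bool) : colors := (false, g, g).

(** The colour at the left end is no free choice: the join of U and Q at the right end forces it, so
    at most one of the two sweeps succeeds. *)
Lemma sol_code sg st x b T : let p := if b then (roleU, roleQ, roleR) else (roleU, roleR, roleQ) in
  uniq (tnames T) -> signs_ok sg p T ->
  sol (tnames T) sg (names (code p T)) st x =
  proc T st x p (left_colors false) (+) proc T st x p (left_colors true)
  /\ ~~ (proc T st x p (left_colors false) && proc T st x p (left_colors true)).
Proof.
move=> p uT sgT; have pp : isperm p by rewrite /p; case: (b).
pose cU := csum x (strand_names roleU p T); pose cQ := csum x (strand_names roleQ p T).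
have cl g : closed_ok (final p T) (csteps T x (left_colors g)) = (g == cU (+) cQ).
  rewrite /closed_ok !getc_final // -/cU -/cQ.
  have -> : getc roleU p (left_colors g) = false by rewrite /p; case: (b).
  have -> : getc roleQ p (left_colors g) = g by rewrite /p; case: (b).
  by case: g cU cQ => [] [] [].
have nm : names (code p T) = strand_names roleU p T ++ rev (strand_names roleQ p T)
    ++ strand_names roleR p T by rewrite /names /code !map_cat map_rev.
have dE k g : g = cU (+) cQ -> dev x k false (names (code p T)) = devp x k p (left_colors g) T.
  move=> gE; rewrite nm !dev_cat dev_rev /devp /=.
  have -> : csum x (rev (strand_names roleQ p T)) = cQ by rewrite /csum count_rev.
  rewrite -/cU -/cQ -gE.
  have -> : getc roleU p (left_colors g) = false by rewrite /p; case: (b).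
  have -> : getc roleQ p (left_colors g) = g by rewrite /p; case: (b).
  have -> : getc roleR p (left_colors g) = g by rewrite /p; case: (b).
  by rewrite -!addbA; congr (_ (+) _); congr (_ (+) _); rewrite addbC.
rewrite -!(sol_proc _ _ _ pp uT sgT) !cl.
have [E|E] : cU (+) cQ = false \/ cU (+) cQ = true by case: (cU (+) cQ); [right|left].
  rewrite E /= !andbT !andbF addbF; split => //.
  by apply: eq_all => k; rewrite (dE k false) // E.
rewrite E /= !andbT !andbF; split => //.
by apply: eq_all => k; rewrite (dE k true) // E.
Qed.

Lemma proc_upd T st x p c i b : i \notin tnames T -> proc T st (upd x i b) p c = proc T st x p c.
Proof.
elim: T p c => //= [[j [h s]]] T IH p c; rewrite inE negb_or => /andP[ij iT].
by rewrite updN 1?eq_sym // IH.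
Qed.

Definition pcnt T st p c := cnt (tnames T) (fun x => proc T st x p c).

Lemma pcnt_cons i h s T st p c : i \notin tnames T ->
  pcnt ((i, (h, s)) :: T) st p c =
  smooth_ok h s (st i) false c * pcnt T st (turn h p) (cstep h false c) +
  smooth_ok h s (st i) true c * pcnt T st (turn h p) (cstep h true c).
Proof.
move=> iT; rewrite /pcnt /= cnt_cons.
have E b : cnt (tnames T) (fun x => smooth_ok h s (st i) (upd x i b i) c &&
    proc T st (upd x i b) (turn h p) (cstep h (upd x i b i) c)) =
    smooth_ok h s (st i) b c * cnt (tnames T) (fun x => proc T st x (turn h p) (cstep h b c)).
  rewrite /cnt big_distrr /=; apply: eq_bigr => x _.
  by rewrite updE proc_upd // mulnb.
by rewrite !E.
Qed.

Definition cap_colors (cap g : bool) : colors := if cap then (false, g, g) else (g, g, false).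
Definition cap_cnt cap T st p :=
  pcnt T st p (cap_colors cap false) + pcnt T st p (cap_colors cap true).

(* cap tells whether the smoothed prefix joins the two upper (true) or the two
   lower strands, ec whether the right end of the plat does. *)
Fixpoint nloops (ec cap : bool) (T : seq item) (st : nat -> bool) : nat :=
  if T is (i, (h, s)) :: T' then
    if st i == s then (if h == cap then (nloops ec cap T' st).+1 else nloops ec h T' st)
    else nloops ec cap T' st
  else (cap == ec).

Definition end_cap p T := (final p T).1.1 == roleR.
(** U and Q are joined at the right end and must be neighbours there, so R ends at the bottom or at
    the top. *)
Definition valid p T := (final p T).1.2 != roleR.

(** Apart from closed loops, a smoothed prefix is a cap and a single further strand. A smoothing
    that turns back closes a loop at the height of the cap and moves the cap at the other height;
    this is the Temperley-Lieb algebra on three strands acting on its two-dimensional module. *)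
Lemma cap_cntE cap T st p : isperm p -> uniq (tnames T) -> valid p T ->
  cap_cnt cap T st p = 2 ^ nloops (end_cap p T) cap T st.
Proof.
elim: T p cap => [|[i [h s]] T IH] p cap pp.
  rewrite /cap_cnt /pcnt /= /cnt !big_seq1 /closed_ok /valid /end_cap /final /= => _.
  by case: p pp => [[[[]|] [[]|]] [[]|]] //= _; rewrite /getc /=; case: cap.
move=> /= /andP[iT uT] vT.
have pp' : isperm (turn h p) by rewrite isperm_turn.
have {}IH cap' : cap_cnt cap' T st (turn h p) = 2 ^ nloops (end_cap p ((i, (h, s)) :: T)) cap' T st.
  exact: IH.
rewrite /cap_cnt !pcnt_cons // /smooth_ok; have [_|_] := eqVneq (st i) s.
  have [Eh|] := eqVneq h cap.
    subst cap; rewrite expnS -IH /cap_cnt; move: (pcnt T st (turn h p)) => f.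
    by case: h {IH pp' vT}; rewrite /=; lia.
  rewrite -IH /cap_cnt; move: (pcnt T st (turn h p)) => f.
  by case: h cap {IH pp' vT} => [] [] //= _; lia.
rewrite -IH /cap_cnt; move: (pcnt T st (turn h p)) => f.
by case: h cap {IH pp' vT} => [] [] /=; lia.
Qed.

Lemma nloops_le ec cap T st : nloops ec cap T st <= (size T).+1.
Proof.
elim: T cap => [|[i [h s]] T IH] cap /=; first by case: eqP.
do 2?case: ifP => _; rewrite ?ltnS //; exact: leq_trans (IH _) _.
Qed.

Lemma nloops_upd ec cap T st i b : i \notin tnames T ->
  nloops ec cap T (upd st i b) = nloops ec cap T st.
Proof.
elim: T cap => [|[j [h s]] T IH] cap //=; rewrite inE negb_or => /andP[ij iT].
by rewrite updN 1?eq_sym // !IH.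
Qed.

Section Transfer.
Local Open Scope ring_scope.

Fixpoint transfer (ec cap : bool) (W : seq (bool * bool)) : {poly int} :=
  if W is (h, s) :: W' then
    'X^s * (if h == cap then loopv * transfer ec cap W' else 'X * transfer ec h W')
    + 'X^(~~ s) * ('X * transfer ec cap W')
  else if cap == ec then loopv else 'X.

Lemma transferE ec cap T : uniq (tnames T) ->
  \sum_(st <- asg (tnames T)) 'X^(count st (tnames T)) *
    ('X^((size T).+1 - nloops ec cap T st) * loopv ^+ nloops ec cap T st)
  = transfer ec cap (map snd T).
Proof.
elim: T cap => [|[i [h s]] T IH] cap /=.
  by rewrite big_seq1 expr0 mul1r; case: eqP => _; rewrite /= ?subn1 ?expr0 ?mul1r ?mulr1.
case/andP=> iT uT; rewrite -!IH // asum_cons.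
have E b : \sum_(st <- asg (tnames T)) 'X^(count (upd st i b) (i :: tnames T)) *
    ('X^((size T).+2 - nloops ec cap ((i, (h, s)) :: T) (upd st i b)) *
     loopv ^+ nloops ec cap ((i, (h, s)) :: T) (upd st i b)) =
  'X^b * (if b == s then (if h == cap then loopv * transfer ec cap (map snd T)
                           else 'X * transfer ec h (map snd T))
          else 'X * transfer ec cap (map snd T)).
  have S1 st c : 'X^((size T).+2 - nloops ec c T st) * loopv ^+ nloops ec c T st =
      'X * ('X^((size T).+1 - nloops ec c T st) * loopv ^+ nloops ec c T st).
    by rewrite subSn ?nloops_le // exprS mulrA.
  have S2 st c : 'X^((size T).+2 - (nloops ec c T st).+1) * loopv ^+ (nloops ec c T st).+1 =
      loopv * ('X^((size T).+1 - nloops ec c T st) * loopv ^+ nloops ec c T st).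
    by rewrite subSS exprS mulrCA.
  rewrite -!IH // !mulr_sumr; case: ifP => Eb; [case: ifP => Eh |];
    rewrite ?mulr_sumr; apply: eq_bigr => st _;
    rewrite /= updE Eb ?Eh !nloops_upd // count_upd // exprD -mulrA ?S1 ?S2;
    by congr (_ * _); rewrite mulrCA.
rewrite !E -!IH //; case: (s); rewrite /= expr0 expr1 !mul1r //.
by rewrite addrC.
Qed.

(** The recursion bounds [nloops] only by [(size T).+1], so [transfer] is normalised as if there
    were one more crossing; hence the factor ['X]. *)
Lemma brk_code b T : let p := if b then (roleU, roleQ, roleR) else (roleU, roleR, roleQ) in
  uniq (tnames T) -> valid p T ->
  'X * brk (code p T) = transfer (end_cap p T) true (map snd T).
Proof.
move=> p uT vT; have pp : isperm p by rewrite /p; case: (b).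
rewrite /brk (@bk_perm _ (tnames T)); last first.
  apply: uniq_perm; rewrite ?undup_uniq // => k; rewrite mem_undup; exact: names_code.
rewrite -transferE // /bk mulr_sumr; apply: eq_bigr => st _.
have E : cnt (tnames T) (sol (tnames T) (sgn (code p T)) (names (code p T)) st) =
    (2 ^ nloops (end_cap p T) true T st)%N.
  rewrite -cap_cntE //; apply: asg_cnt_two => x.
    by have [] := sol_code st x uT (signs_code pp uT).
  by have [] := sol_code st x uT (signs_code pp uT).
have := cnt_le (tnames T) (sol (tnames T) (sgn (code p T)) (names (code p T)) st).
rewrite E /wt pfactorK // leq_exp2l // size_map => le.
by rewrite subSn // exprS mulrCA -!mulrA.
Qed.

End Transfer.

(** * The span of the bracket of an alternating plat *)

Section AlternatingSpan.
Local Open Scope ring_scope.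
Implicit Types P Q : {poly int}.

Definition window P (lo hi : nat) := forall k, P`_k != 0 -> (lo <= k <= hi)%N.

(** The induction invariant for the two entries of the transfer vector: [P] carries the lowest term
    and [Q] the highest. *)
Definition spread P Q lo hi :=
  [/\ window P lo hi, window Q lo.+1 hi.+1, P`_lo != 0 & Q`_hi.+1 != 0].

Lemma window_zero P lo hi k : window P lo hi -> ~~ (lo <= k <= hi)%N -> P`_k = 0.
Proof. by move=> w; case: (eqVneq P`_k 0) => // /w ->. Qed.

Lemma coef_comb P Q k : ('X * P + 'X^2 * Q)`_k =
  (if (k < 1)%N then 0 else P`_(k - 1)) + (if (k < 2)%N then 0 else Q`_(k - 2)).
Proof. by rewrite coefD -['X]expr1 !coefXnM. Qed.

(** In degree [lo.+1] only [P] contributes and in degree [hi.+3] only [Q], so neither extreme term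
    cancels. *)
Lemma spread_comb P Q lo hi : spread P Q lo hi ->
  [/\ window ('X * P + 'X^2 * Q) lo.+1 hi.+3, ('X * P + 'X^2 * Q)`_lo.+1 != 0 &
      ('X * P + 'X^2 * Q)`_hi.+3 != 0].
Proof.
case=> wP wQ P0 Q0; split.
- move=> k; rewrite coef_comb; apply: contraR => hk.
  have -> : (if (k < 1)%N then 0 else P`_(k - 1)) = 0.
    by case: ltnP => // k1; apply: window_zero wP _; lia.
  have -> : (if (k < 2)%N then 0 else Q`_(k - 2)) = 0.
    by case: ltnP => // k1; apply: window_zero wQ _; lia.
  by rewrite addr0.
- rewrite coef_comb /= subn1 /= (window_zero (k := (lo.+1 - 2)%N) wQ) ?if_same ?addr0 //; lia.
- rewrite coef_comb /= (window_zero (k := (hi.+3 - 1)%N) wP) ?add0r; last by lia.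
  by rewrite subSS subSS subn0.
Qed.

Lemma spread_low P Q lo hi : spread P Q lo hi ->
  spread ('X * P + 'X^2 * Q) (- 'X^3 * Q) lo.+1 hi.+3.
Proof.
move=> s; have [w l _] := spread_comb s; case: s => wP wQ P0 Q0; split=> //.
- move=> k; rewrite mulNr coefN coefXnM oppr_eq0; case: ltnP => [|k3 /wQ]; rewrite ?eqxx //; lia.
- by rewrite mulNr coefN coefXnM oppr_eq0 /= subSS subSS subSS subn0.
Qed.

Lemma spread_high P Q lo hi : spread P Q lo hi ->
  spread (- P) ('X * P + 'X^2 * Q) lo hi.+2.
Proof.
move=> s; have [w _ h] := spread_comb s; case: s => wP wQ P0 Q0; split=> //.
- by move=> k; rewrite coefN oppr_eq0 => /wP; lia.
- by rewrite coefN oppr_eq0.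
Qed.

(** In an alternating plat the ascending strand is on top at one height and below at the other;
    [kap] tells which. *)
Definition typed (kap : bool) (hs : seq bool) := [seq (h, h (+) kap) | h <- hs].

Lemma typed_last ec kap :
  spread (transfer ec kap (typed kap [:: ~~ ec])) (transfer ec (~~ kap) (typed kap [:: ~~ ec])) 1 3.
Proof.
have -> : transfer ec kap (typed kap [:: ~~ ec]) = - 'X^1.
  by case: ec kap => [] []; rewrite /= /loopv ?expr0 ?expr1; ring.
have -> : transfer ec (~~ kap) (typed kap [:: ~~ ec]) = - 'X^4.
  by case: ec kap => [] []; rewrite /= /loopv ?expr0 ?expr1; ring.
split; rewrite /window ?coefN ?coefXn //.
  by move=> k; rewrite coefN coefXn oppr_eq0; have [->|] := eqVneq k 1%N; rewrite ?eqxx.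
by move=> k; rewrite coefN coefXn oppr_eq0; have [->|] := eqVneq k 4%N; rewrite ?eqxx.
Qed.

(** The last crossing avoids the height joined at the right end, where it would be a kink. Each
    crossing added on the left changes only one of the two entries into a combination of both, and
    widens the spread by 2. *)
Lemma typed_spread ec kap hs : exists lo,
  spread (transfer ec kap (typed kap (rcons hs (~~ ec))))
         (transfer ec (~~ kap) (typed kap (rcons hs (~~ ec)))) lo (lo + 2 + 2 * size hs).
Proof.
elim: hs => [|h hs [lo IH]]; first by exists 1; apply: typed_last.
move: IH; rewrite /=; set P := transfer _ kap _; set Q := transfer _ (~~ kap) _ => IH.
have [Eh|Eh] := eqVneq h kap.
  exists lo; have -> : (lo + 2 + 2 * (size hs).+1)%N = (lo + 2 + 2 * size hs).+2 by lia.
  have := spread_high IH; congr (spread _ _ _ _).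
    by rewrite Eh -/P addbb /= expr0 expr1 /loopv; ring.
  by rewrite Eh -/P -/Q addbb; case: (kap); rewrite /= expr0 expr1; ring.
have {}Eh : h = ~~ kap by case: h kap Eh {P Q IH} => [] [].
exists lo.+1; have -> : (lo.+1 + 2 + 2 * (size hs).+1)%N = (lo + 2 + 2 * size hs).+3 by lia.
have := spread_low IH; congr (spread _ _ _ _).
  by rewrite Eh -/P -/Q; case: (kap); rewrite /= expr0 expr1; ring.
by rewrite Eh -/P -/Q eqxx addNb addbb /= expr0 expr1 /loopv; ring.
Qed.

(** The left end joins the upper strands, so the first crossing has to be at the lower height.
    Together with the last one it accounts for 4 in the span, every inner one for 2. *)
Lemma alternating_coef b kap hs T : let p := if b then (roleU, roleQ, roleR) else (roleU, roleR, roleQ) in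
  uniq (tnames T) -> valid p T ->
  map snd T = typed kap (false :: rcons hs (~~ end_cap p T)) ->
  exists k, ((brk (code p T))`_k != 0) /\ ((brk (code p T))`_(k + 2 * size T) != 0).
Proof.
move=> p uT vT ET; have := brk_code uT vT; rewrite -/p ET.
have sT : size T = (size hs).+2.
  by rewrite -(size_map snd) ET size_map /= size_rcons.
have [lo] := typed_spread (end_cap p T) kap hs.
set P := transfer _ kap _; set Q := transfer _ (~~ kap) _ => s.
have -> : transfer (end_cap p T) true (typed kap (false :: rcons hs (~~ end_cap p T)))
    = 'X * P + 'X^2 * Q.
  by rewrite /P /Q /=; case: (kap); rewrite /= expr0 expr1; ring.
have [_ l h] := spread_comb s => E; exists lo; rewrite sT.
have C k : (brk (code p T))`_k = ('X * P + 'X^2 * Q)`_k.+1.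
  by rewrite -E coefXM.
by rewrite !C; split=> //; move: h; congr (_`_ _ != 0); lia.
Qed.

End AlternatingSpan.

(** * Plats are spherical *)

Section Faces.
Variable G : seq letter.
Hypothesis gG : gauss_code G.

Let L := tnth (in_tuple G).
Definition left_turn (a : letter) : bool := over a == positive a.

Lemma mate_posE (i : 'I_(size G)) : L (mate_pos i) = mate (L i).
Proof.
rewrite /L /mate_pos (tnth_nth (mate (L i))) /insubd.
have mG : mate (L i) \in G by case/andP: gG => _ /allP; apply; apply: mem_tnth.
have lt : index (mate (L i)) G < size G by rewrite index_mem.
by rewrite insubT /= nth_index.
Qed.

Lemma letter_inj : injective L.
Proof.
apply: (tuple_uniqP _ _); exact: map_uniq (gauss_uniq gG).
Qed.

Lemma mate_posK : involutive (@mate_pos G).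
Proof. by move=> i; apply: letter_inj; rewrite !mate_posE mateK. Qed.

Lemma left_turn_mate a : left_turn (mate a) = ~~ left_turn a.
Proof. by case: a => [[i o] s]; rewrite /left_turn /mate /over /positive /=; case: o s => [] []. Qed.

Lemma next_side_inj : injective (@next_side G).
Proof.
move=> [i d] [i' d']; rewrite /next_side /=; case=> /(can_inj mate_posK) E; rewrite E => Ed.
have {Ed}dd' : d = d' by move: Ed; case: (_ == positive _); case: d d' {E} => [] [].
by subst d'; case: d E => /= [/ordS_inj|/ord_pred_inj] ->.
Qed.

Section Colouring.
Variable phi : 'I_(size G) * bool -> bool.
Hypothesis phiE : forall x, phi (next_side x) = phi x.

Lemma colour_prev j : phi (ord_pred j, true) = phi (mate_pos j, left_turn (L j)).
Proof. by rewrite -[LHS]phiE /next_side /= ord_predK eqb_id. Qed.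

Lemma colour_next j : phi (ordS j, false) = phi (mate_pos j, ~~ left_turn (L j)).
Proof. by rewrite -[LHS]phiE /next_side /= ordSK eqbF_neg. Qed.

Definition edge_jump j := phi (j, true) (+) phi (ordS j, false).
Definition corner_sum j :=
  phi (j, true) (+) phi (j, false) (+) phi (mate_pos j, true) (+) phi (mate_pos j, false).

(* The jumps of a face colouring across the edges of a code are determined by
   one of them and one bit per crossing. *)
Lemma edge_jump_step j : edge_jump j = edge_jump (ord_pred j) (+) corner_sum j.
Proof.
rewrite /edge_jump /corner_sum ord_predK colour_prev colour_next.
case: (left_turn _); case: (phi (j, true)) (phi (j, false)) (phi (mate_pos j, true))
  (phi (mate_pos j, false)) => [] [] [] [] //.
Qed.

Lemma ord_cyclic_ind (P : 'I_(size G) -> Prop) j0 :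
  P j0 -> (forall j, P (ord_pred j) -> P j) -> forall j, P j.
Proof.
move=> P0 PS j.
have [k ->] : exists k, j = iter k (@ordS _) j0.
  exists (j + size G - j0).
  have val_iter k : val (iter k (@ordS _) j0) = (j0 + k) %% size G.
    elim: k => [|k IH]; first by rewrite addn0 modn_small.
    by rewrite iterS /= IH -addn1 modnDml addn1 addnS.
  apply: val_inj; rewrite val_iter subnKC ?modnDr ?modn_small //.
  by rewrite (leq_trans (ltnW (ltn_ord j0))) // leq_addl.
by elim: k => //= k IH; apply: PS; rewrite ordSK.
Qed.

(** The hypotheses make every jump vanish. Then faces that meet along an edge have equal colours,
    and going once around the code reaches every edge. *)
Lemma colour_rigid j0 : phi (j0, true) = false -> edge_jump j0 = false ->
  (forall j, over (L j) -> corner_sum j = false) -> forall x, phi x = false.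
Proof.
move=> p0 e0 cs.
have cs' j : corner_sum j = false.
  case: (boolP (over (L j))) => [/cs//|noj].
  rewrite -[RHS](cs (mate_pos j)); last by rewrite mate_posE.
  by rewrite /corner_sum mate_posK; move: (phi _) (phi _) (phi _) (phi _) => [] [] [] [].
have ej j : edge_jump j = false.
  apply: (@ord_cyclic_ind (fun j => edge_jump j = false) j0) => // {}j IH.
  by rewrite edge_jump_step IH cs'.
have corner j : [/\ phi (j, true) = phi (ord_pred j, true) & phi (j, false) = phi (j, true)].
  have := ej j; have := ej (ord_pred j); have := ej (mate_pos j); have := ej (ord_pred (mate_pos j)).
  rewrite /edge_jump !ord_predK !colour_prev !colour_next mate_posE left_turn_mate mate_posK.
  by case: (left_turn _); case: (phi (j, true)) (phi (j, false)) (phi (mate_pos j, true))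
    (phi (mate_pos j, false)) => [] [] [] [].
have T j : phi (j, true) = false.
  apply: (@ord_cyclic_ind (fun j => phi (j, true) = false) j0) => // {}j IH.
  by have [-> _] := corner j.
by case=> j [] //; have [_ ->] := corner j.
Qed.

End Colouring.

Lemma crossings_over : crossings G = count over G.
Proof.
by rewrite /crossings -(size_map name) -count_predT (gauss_count gG) mul2n doubleK.
Qed.

(** Sets of faces, as 2-colourings, are told apart by [data]: one colour, one jump and one bit per
    crossing. Hence two to the number of faces is at most 2^(c+2). *)
Lemma faces_le : 0 < size G -> faces G <= crossings G + 2.
Proof.
move=> G0; pose j0 := Ordinal G0; pose f := @next_side G.
have fs := fconnect_sym next_side_inj.
pose Rt := [set x | x \in froots f].
pose phi (A : {set 'I_(size G) * bool}) x := froot f x \in A.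
have phiE A x : phi A (f x) = phi A x.
  by rewrite /phi; congr (_ \in A); apply/eqP; rewrite root_connect // fs fconnect1.
pose O := [set j | over (L j)].
pose data A := (phi A (j0, true), edge_jump (phi A) j0, [set j in O | corner_sum (phi A) j]).
have inj : {in powerset Rt &, injective data}.
  move=> A B; rewrite !inE => sA sB [e1 e2 e3].
  pose chi x := phi A x (+) phi B x.
  have chiE x : chi (f x) = chi x by rewrite /chi !phiE.
  have z : forall x, chi x = false.
    apply: (@colour_rigid _ chiE j0).
    - by rewrite /chi e1 addbb.
    - by move: e2; rewrite /edge_jump /chi; do 4!case: (phi _ _).
    - move=> j oj; move/setP/(_ j): e3; rewrite !inE oj /= /corner_sum /chi.
      by do 8!case: (phi _ _).
  have inRt (A' : {set 'I_(size G) * bool}) x : A' \subset Rt -> (x \in A') = (x \in Rt) && phi A' x.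
    move=> /subsetP sA'; apply/idP/andP => [xA|[xR]].
      have xR := sA' _ xA; split=> //; rewrite /phi.
      by move: xR; rewrite inE => /eqP ->.
    by rewrite /phi; move: xR; rewrite inE => /eqP ->.
  apply/setP => x; rewrite (inRt A) // (inRt B) //; congr (_ && _).
  by have := z x; rewrite /chi; do 2!case: (phi _ _).
have sub : data @: powerset Rt \subset setX setT (powerset O).
  apply/subsetP => _ /imsetP[A _ ->]; rewrite !inE /=; apply/subsetP => j.
  by rewrite !inE => /andP[].
have := subset_leq_card sub; rewrite card_in_imset // cardsX !card_powerset cardsT.
have -> : #|Rt| = faces G.
  by rewrite /faces cardsE; apply: eq_card => x; rewrite !inE andbT.
have -> : #|O| = crossings G.
  rewrite crossings_over; have GE : [seq L j | j <- enum 'I_(size G)] = G by exact: map_tnth_enum.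
  have -> : count over G =
      count (fun j => over (L j)) (enum 'I_(size G)) by rewrite -[X in count _ X = _]GE count_map.
  by rewrite cardsE cardE -size_filter enumT.
by rewrite card_prod card_bool -(expnD 2 2) leq_exp2l // addnC.
Qed.

End Faces.

Section Labels.
Variable lab : letter -> bool -> nat.

(** The two oriented edges between consecutive letters, each followed by the left turn at its end as
    in [next_side]. *)
Definition label_edge (a b : letter) : bool :=
  (lab a true == lab (mate b) (left_turn b)) && (lab b false == lab (mate a) (~~ left_turn a)).

(** The labels are constant along the boundary of a face, so there are at least as many faces as
    values. *)
Lemma faces_ge G vals : gauss_code G -> cycle label_edge G -> uniq vals ->
  (forall v, v \in vals -> exists a d, a \in G /\ lab a d = v) -> size vals <= faces G.
Proof.
move=> gG cyc uv hit; pose L := tnth (in_tuple G).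
have edge j : label_edge (L j) (L (ordS j)).
  rewrite /L; case: {hit gG L} G cyc j => [|a G'] /= cyc j; first by case: j.
  move/(pathP a): cyc => H; have := H j; rewrite size_rcons => /(_ (ltn_ord j)).
  rewrite !(tnth_nth a) /= -rcons_cons nth_rcons /= ltn_ord.
  have [lt|ge] := ltnP j (size G').
    by rewrite nth_rcons lt modn_small // ltnS.
  have ej : nat_of_ord j = size G' by apply/eqP; rewrite eqn_leq ge -ltnS ltn_ord.
  by rewrite nth_rcons ej ltnn eqxx modnn.
pose lam (x : 'I_(size G) * bool) := lab (L x.1) x.2.
have lamE x : lam (next_side x) = lam x.
  case: x => j [] ; rewrite /lam /next_side /= /L mate_posE // -/L.
    by case/andP: (edge j) => /eqP -> _; rewrite /left_turn eqb_id.
  by have /andP[_ /eqP] := edge (ord_pred j); rewrite ord_predK => ->; rewrite eqbF_neg.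
have lamC x y : fconnect (@next_side G) x y -> lam x = lam y.
  by case/connectP=> p; elim: p x => [|z p IH] x /=; [move=> _ -> | case/andP=> /eqP <- /IH{}IH /IH <-].
have -> : faces G = #|froots (@next_side G)|.
  by rewrite /faces; apply: eq_card => x; rewrite !inE andbT.
rewrite -(size_image lam); apply: uniq_leq_size => // v /hit[a [d [aG <-]]].
have [j Lj] : exists j, a = L j by case/(tnthP (in_tuple G)): aG => j ->; exists j.
have fs := fconnect_sym (next_side_inj gG).
apply/imageP; exists (froot (@next_side G) (j, d)); first exact: roots_root.
by rewrite -(lamC (j, d)) ?connect_root // /lam Lj.
Qed.

(* s and s' are the labels on the left and on the right before and after the
   code G. *)
Fixpoint tchain (s : nat * nat) (G : seq letter) (s' : nat * nat) : bool :=
  if G is b :: G' then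
    [&& lab (mate b) (left_turn b) == s.1, lab b false == s.2 &
      tchain (lab b true, lab (mate b) (~~ left_turn b)) G' s']
  else s == s'.

Lemma tchain_cat s1 s2 s3 G1 G2 : tchain s1 G1 s2 -> tchain s2 G2 s3 -> tchain s1 (G1 ++ G2) s3.
Proof.
elim: G1 s1 => [|b G1 IH] s1 /=; first by move/eqP->.
by case/and3P=> -> -> /IH{}IH /IH ->.
Qed.

Lemma tchain_cycle s G : tchain s G s -> cycle label_edge G.
Proof.
case: G => // a G /= /and3P[/eqP a1 /eqP a2].
have gen b : tchain (lab b true, lab (mate b) (~~ left_turn b)) G s ->
  lab (mate a) (left_turn a) = s.1 -> lab a false = s.2 -> path label_edge b (rcons G a).
  elim: G b => [|b' G IH] b /=.
    by move/eqP <- => /= h1 h2; rewrite /label_edge h1 h2 !eqxx.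
  case/and3P=> /eqP e1 /eqP e2 t h1 h2; rewrite IH // andbT.
  by rewrite /label_edge e1 e2 !eqxx.
by move=> t; apply: gen.
Qed.

End Labels.

(** The regions met by a vertical line, from bottom to top; the region of index k < 3 lies just
    below the strand at height k. *)
Definition regions := (nat * nat * nat * nat)%type.
Definition region (r : regions) (k : nat) : nat :=
  match k with 0 => r.1.1.1 | 1 => r.1.1.2 | 2 => r.1.2 | _ => r.2 end.
Definition new_region (h : bool) (i : nat) (r : regions) : regions :=
  if h then (r.1.1, i.+3, r.2) else (r.1.1.1, i.+3, r.1.2, r.2).

(* The region on the left of the half-edge that leaves the crossing i on the
   passage o in direction d: right-up sees the region above the crossing,
   left-down the one below, right-down the new one, named i + 3, to its right,
   and left-up the one to its left.  Regions 0, 1, 2 are there at the start. *)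
Definition quadrant (h s : bool) (p : state) (r : regions) (i : nat) (o d : bool) : nat :=
  let is_asc := o == s in
  let right := ((if is_asc then asc h p else desc h p) != roleQ) == d in
  if is_asc then (if right then region r h.+2 else region r h)
  else (if right then i.+3 else region r h.+1).

Section PlatLabels.
Variable mu : nat -> nat.

Fixpoint labs_ok (lab : letter -> bool -> nat) (T : seq item) p r : Prop :=
  if T is (i, (h, s)) :: T' then
    (forall o d, lab (i, o, item_sign h s p) d = mu (quadrant h s p r i o d)) /\
    labs_ok lab T' (turn h p) (new_region h i r)
  else True.

Fixpoint plat_label (T : seq item) p r (a : letter) (d : bool) : nat :=
  if T is (i, (h, s)) :: T' then
    if name a == i then mu (quadrant h s p r i (over a) d)
    else plat_label T' (turn h p) (new_region h i r) a d
  else 0.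

Lemma plat_labelP T p r : uniq (tnames T) -> labs_ok (plat_label T p r) T p r.
Proof.
have ext lab lab' T' p' r' : (forall a d, name a \in tnames T' -> lab a d = lab' a d) ->
    labs_ok lab' T' p' r' -> labs_ok lab T' p' r'.
  elim: T' p' r' => //= [[i [h s]]] T' IH p' r' H [H1 H2]; split.
    by move=> o d; rewrite H ?mem_head.
  by apply: IH H2 => a d aT; apply: H; rewrite inE aT orbT.
elim: T p r => //= [[i [h s]]] T IH p r /andP[iT uT]; split.
  by move=> o d; rewrite /name /= eqxx.
by apply: ext (IH _ _ uT) => a d aT; rewrite (notin_neq iT aT).
Qed.

Definition position (x : role) (p : state) : nat :=
  if x == p.1.1 then 0 else if x == p.1.2 then 1 else 2.
Definition above x p r := mu (region r (position x p).+1).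
Definition below x p r := mu (region r (position x p)).
Definition final_regions (T : seq item) (r : regions) : regions :=
  foldl (fun r t => new_region t.2.1 t.1 r) r T.

(** A strand has the region above it on its left when it runs to the right, and the region below it
    when, like Q, it runs to the left. *)
Lemma tchain_strand lab x T p r : isperm p -> labs_ok lab T p r ->
  if x == roleQ then
    tchain lab (below x (final p T) (final_regions T r), above x (final p T) (final_regions T r))
      (rev (strand x p T)) (below x p r, above x p r)
  else
    tchain lab (above x p r, below x p r) (strand x p T)
      (above x (final p T) (final_regions T r), below x (final p T) (final_regions T r)).
Proof.
elim: T p r => [|[i [h s]] T IH] p r pp; first by case: ifP => _ /=.
move=> [H1 H2].
have {}IH := IH (turn h p) (new_region h i r).
have := IH; rewrite isperm_turn => /(_ pp H2); rewrite -[strand x p _]/(_ ++ _).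
rewrite -[final p (_ :: _)]/(final (turn h p) T) -[final_regions (_ :: _) r]/(final_regions T (new_region h i r)).
case: ifP => xQ; last first.
  apply: tchain_cat; rewrite /item_letter /above /below; move: xQ pp H1 {IH H2}.
  case: p r => [[u v] w] [[[r0 r1] r2] r3].
  case: x => [[]|] // _; case: h u v w => [] [[]|] [[]|] [[]|] //= _ H1; rewrite ?eqxx //;
    rewrite /mate /name /over /positive /left_turn /= !H1 /item_sign /quadrant /over /positive /=;
    by case: (s); rewrite /= !eqxx.
move/tchain_cat; rewrite rev_cat; apply; rewrite /item_letter /above /below; move: xQ pp H1 {IH H2}.
case: p r => [[u v] w] [[[r0 r1] r2] r3].
case: x => [[]|] // _; case: h u v w => [] [[]|] [[]|] [[]|] //= _ H1; rewrite ?eqxx //;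
  rewrite /mate /name /over /positive /left_turn /= !H1 /item_sign /quadrant /over /positive /=;
  by case: (s); rewrite /= !eqxx.
Qed.

Lemma quadrant_hit lab i h s T p r v : labs_ok lab ((i, (h, s)) :: T) p r ->
  v \in [:: region r h; region r h.+1; region r h.+2; i.+3] ->
  exists a d, a \in item_pairs p ((i, (h, s)) :: T) /\ lab a d = mu v.
Proof.
move=> [H _]; rewrite !inE => v4.
have nss : (~~ s == s) = false by case: (s).
pose rA := asc h p != roleQ; pose rD := desc h p != roleQ.
case/or4P: v4 => /eqP ->.
- exists (i, s, item_sign h s p), (~~ rA); rewrite mem_head H /quadrant eqxx -/rA.
  by case: rA.
- exists (i, ~~ s, item_sign h s p), (~~ rD); rewrite !inE eqxx orbT H /quadrant nss -/rD.
  by case: rD.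
- exists (i, s, item_sign h s p), rA; rewrite mem_head H /quadrant eqxx -/rA.
  by case: rA.
- exists (i, ~~ s, item_sign h s p), rD; rewrite !inE eqxx orbT H /quadrant nss -/rD.
  by case: rD.
Qed.

Lemma new_hit lab T p r i : labs_ok lab T p r -> i \in tnames T ->
  exists a d, a \in item_pairs p T /\ lab a d = mu i.+3.
Proof.
elim: T p r => //= [[j [h s]]] T IH p r ok; rewrite inE => /orP[/eqP ->|iT].
  by apply: quadrant_hit ok _; rewrite !inE eqxx !orbT.
have [a [d [aT E]]] := IH _ _ ok.2 iT.
by exists a, d; rewrite !inE aT !orbT.
Qed.

Lemma bottom_hit lab T p r : labs_ok lab T p r -> has (fun t => ~~ t.2.1) T ->
  exists a d, a \in item_pairs p T /\ lab a d = mu (region r 0).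
Proof.
elim: T p r => //= [[j [h s]]] T IH p r ok /=; case: h ok => [] ok /=.
  move/(IH _ _ ok.2) => [a [d [aT E]]].
  by exists a, d; rewrite !inE aT !orbT.
by move=> _; apply: quadrant_hit ok _; rewrite !inE eqxx.
Qed.

End PlatLabels.

Lemma final_regions03 T r :
  region (final_regions T r) 0 = region r 0 /\ region (final_regions T r) 3 = region r 3.
Proof.
elim: T r => //= [[i [h s]]] T IH r; have [-> ->] := IH (new_region h i r).
by case: r => [[[? ?] ?] ?]; case: h.
Qed.

Lemma final_regions_in T r k : region (final_regions T r) k \in
  [:: region r 0; region r 1; region r 2; region r 3] ++ [seq i.+3 | i <- tnames T].
Proof.
elim: T r => [|[i [h s]] T IH] r.
  by rewrite cats0 !inE; case: k => [|[|[|k]]]; rewrite eqxx ?orbT.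
have := IH (new_region h i r); rewrite !mem_cat !inE.
by case: r => [[[a b] c] d]; case: (h) => /=; case/orP=> [/or4P[]|] ->; rewrite ?orbT.
Qed.

(** With all crossings at the upper height, region 0 is a quadrant of none of them. It is then
    reached as the last region between Q and R, which is merged into it. *)
Lemma all_top_final T p r : T != [::] -> ~~ has (fun t => ~~ t.2.1) T ->
  (final p T).1.1 = p.1.1 /\ exists2 i, i \in tnames T & region (final_regions T r) 2 = i.+3.
Proof.
elim/last_ind: T => // T [i [h s]] IH _; rewrite has_rcons negb_or negbK /= => /andP[hT nT].
rewrite /final /final_regions !foldl_rcons /= hT; split.
  case: (T =P [::]) => [->//|/eqP/IH] /(_ nT)[E _]; exact: E.
exists i => //; by rewrite /tnames map_rcons mem_rcons mem_head.
Qed.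

Definition start (b : bool) : state :=
  if b then (roleU, roleQ, roleR) else (roleU, roleR, roleQ).

Lemma isperm_start b : isperm (start b).
Proof. by case: b. Qed.

Lemma size_item_pairs p T : size (item_pairs p T) = (size T).*2.
Proof. by elim: T p => //= [[i [h s]]] T IH p; rewrite /= IH. Qed.

Lemma crossings_code b T : crossings (code (start b) T) = size T.
Proof.
by rewrite /crossings (perm_size (code_perm T (isperm_start b))) size_item_pairs doubleK.
Qed.

(* The last region between the strand R and its neighbour is the outer one. *)
Definition merge (ec : bool) (rid k : nat) := if k == rid then (if ec then 1 else 0) else k.

Lemma merge_id ec rid : merge ec rid rid = merge ec rid (if ec then 1 else 0).
Proof. by rewrite /merge eqxx if_same. Qed.

Lemma right_junction (q : state) (rf : regions) : isperm q -> q.1.2 != roleR ->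
  region rf 0 = 0 -> region rf 3 = 1 ->
  let ec := q.1.1 == roleR in
  let mu := merge ec (region rf (if ec then 1 else 2)) in
  [/\ above mu roleU q rf = below mu roleQ q rf, below mu roleU q rf = above mu roleQ q rf,
      above mu roleR q rf = mu 1 & below mu roleR q rf = mu 0].
Proof.
case: q rf => [[u v] w] [[[r0 r1] r2] r3] pq vq /= -> ->.
move: pq vq; rewrite /above /below; case: u v w => [[]|] [[]|] [[]|] //= _ _;
  have m1 := merge_id true r1; have m2 := merge_id false r2; rewrite /= in m1 m2; by rewrite ?m1 ?m2.
Qed.

(** All base points are covered because a move is applied to a code rotated so that the move starts
    at its front. *)
Lemma code_rot_diagram b T m : uniq (tnames T) -> valid (start b) T ->
  diagram (rot m (code (start b) T)).
Proof.
set p := start b => uT vT; have pp : isperm p := isperm_start b.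
set G := rot m _; have gG : gauss_code G.
  by rewrite (gauss_perm (permEl (perm_rot _ _))); apply: code_gauss.
rewrite /diagram gG /=; case: (eqVneq T [::]) => [E|T0]; first by rewrite /G E.
(* The regions of index 1 and 3 have the same name: the one above U extends around the cap at the
   left end to the top. *)
pose r0 : regions := (0, 1, 2, 1).
pose rid := region (final_regions T r0) (if end_cap p T then 1 else 2).
pose mu := merge (end_cap p T) rid.
pose lab := plat_label mu T p r0.
have ok : labs_ok mu lab T p r0 := plat_labelP mu p r0 uT.
have [f0 f3] := final_regions03 T r0.
have cyc : cycle (label_edge lab) G.
  rewrite rot_cycle; apply: (@tchain_cycle _ (mu 1, mu 0)).
  have cU := tchain_strand roleU pp ok; have cQ := tchain_strand roleQ pp ok.
  have cR := tchain_strand roleR pp ok; rewrite /= in cU cQ cR.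
  have pf : isperm (final p T) by rewrite isperm_final.
  have [j1 j2 j3 j4] := right_junction pf vT f0 f3.
  rewrite -/(end_cap p T) -/rid -/mu in j1 j2 j3 j4.
  rewrite j1 j2 in cU; rewrite j3 j4 in cR.
  apply: (tchain_cat (s2 := (below mu roleQ (final p T) (final_regions T r0),
                        above mu roleQ (final p T) (final_regions T r0)))).
    by move: cU; rewrite /p /start; case: (b).
  apply: tchain_cat cQ _; by move: cR; rewrite /p /start; case: (b).
(* There are c + 3 names; [rid] is identified with another one, which leaves the c + 2 faces that
   Euler's formula asks for. *)
pose ids := [:: 0; 1; 2] ++ [seq i.+3 | i <- tnames T].
have u_ids : uniq ids.
  rewrite /ids cat_uniq map_inj_uniq ?uT; last by move=> i j [].
  by rewrite andbT /=; apply/hasPn => _ /mapP[i _ ->]; rewrite !inE.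
have rid_in : rid \in ids.
  by have := final_regions_in T r0 (if end_cap p T then 1 else 2); rewrite -/rid !mem_cat !inE /=;
    case/orP=> [/or4P[]|] ->; rewrite ?orbT.
have hit v : v \in rem rid ids -> exists a d, a \in G /\ lab a d = v.
  rewrite mem_rem_uniq // inE => /andP[vr vI].
  have muv : mu v = v by rewrite /mu /merge (negbTE vr).
  suff [a [d [aT E]]] : exists a d, a \in item_pairs p T /\ lab a d = mu v.
    by exists a, d; rewrite mem_rot (perm_mem (code_perm T pp)) aT E muv.
  move: vI; rewrite mem_cat => /orP[v3|/mapP[i iT ->]]; last exact: new_hit ok iT.
  have [v0|v0] := eqVneq v 0.
    rewrite v0; case: (boolP (has (fun t => ~~ t.2.1) T)) => hT; first exact: bottom_hit ok hT.
    have [E1 [i iT E2]] := all_top_final p r0 T0 hT.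
    have ec : end_cap p T = false by rewrite /end_cap E1 /p; case: (b).
    have [a [d [aT E]]] := new_hit ok iT; exists a, d; split=> //; rewrite E.
    by rewrite /mu /merge /rid ec E2 eqxx.
  move: ok; case: (T) T0 => // -[i [h s]] T' _ ok; apply: quadrant_hit ok _.
  by move: v3 v0; rewrite !inE; case: (h) => /or3P[] /eqP ->.
have lower := faces_ge gG cyc (rem_uniq rid u_ids) hit.
have cr : crossings G = size T by rewrite /crossings size_rot; apply: crossings_code.
have sG : size G = (size T).*2.
  by rewrite size_rot (perm_size (code_perm T pp)) size_item_pairs.
have upper : faces G <= crossings G + 2.
  by apply: faces_le => //; rewrite sG double_gt0 lt0n size_eq0.
rewrite /spherical; apply/orP; right; rewrite cr sG -addnn -addnA eqn_add2l eqn_leq.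
rewrite cr in upper; rewrite upper /=; apply: leq_trans lower.
by rewrite size_rem // /ids size_cat !size_map addnC.
Qed.

Lemma code_diagram b T : uniq (tnames T) -> valid (start b) T -> diagram (code (start b) T).
Proof. by move=> uT vT; rewrite -(rot0 (code _ _)); apply: code_rot_diagram. Qed.

(** * Reidemeister moves of plats *)

(** A move up to the choice of base points, since the constructors of [move] act at the front of a
    code. *)
Definition rmove (G H : seq letter) : Prop := exists G1 G2 H1 H2,
  [/\ G = G1 ++ G2, H = H1 ++ H2 & move (G2 ++ G1) (H2 ++ H1)].

Lemma same_knot_sym G H : same_knot G H -> same_knot H G.
Proof. exact: rst_sym. Qed.

Lemma same_knot_trans H G K : same_knot G H -> same_knot H K -> same_knot G K.
Proof. exact: rst_trans. Qed.

Lemma code_rmove b b' T T' : uniq (tnames T) -> valid (start b) T ->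
  uniq (tnames T') -> valid (start b') T' ->
  rmove (code (start b) T) (code (start b') T') ->
  same_knot (code (start b) T) (code (start b') T').
Proof.
move=> uT vT uT' vT' [G1 [G2 [H1 [H2 [EG EH mv]]]]].
have D b0 T0 S1 S2 : uniq (tnames T0) -> valid (start b0) T0 ->
    code (start b0) T0 = S1 ++ S2 -> diagram (S2 ++ S1).
  by move=> u v E; have := code_rot_diagram (size S1) u v; rewrite E rot_size_cat.
have dG := D _ _ _ _ uT vT EG; have dH := D _ _ _ _ uT' vT' EH.
apply: (@same_knot_trans (G2 ++ G1)).
  apply: rst_step; split=> //; first exact: code_diagram.
  by rewrite EG -(rot_size_cat G1 G2); apply: MoveBasePoint.
apply: (@same_knot_trans (H2 ++ H1)); first exact: rst_step.
apply: rst_sym; apply: rst_step; split=> //; first exact: code_diagram.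
by rewrite EH -(rot_size_cat H1 H2); apply: MoveBasePoint.
Qed.

Lemma rmove_R1 i o s P A : rmove (P ++ [:: (i, o, s); (i, ~~ o, s)] ++ A) (P ++ A).
Proof.
exists P, ([:: (i, o, s); (i, ~~ o, s)] ++ A), P, A; split=> //; rewrite -catA.
exact: MoveR1.
Qed.

Lemma rmove_R2l i j s d P A B : rmove
  (P ++ [:: (i, true, s); (j, true, ~~ s)] ++ A ++
     ordered_pair d (i, false, s) (j, false, ~~ s) ++ B)
  (P ++ A ++ B).
Proof.
exists P; eexists; exists P, (A ++ B); split; [reflexivity|by []|rewrite -!catA].
exact: MoveR2.
Qed.

Lemma rmove_R2r i j s d P A B : rmove
  (P ++ ordered_pair d (i, false, s) (j, false, ~~ s) ++ B ++
     [:: (i, true, s); (j, true, ~~ s)] ++ A)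
  (P ++ B ++ A).
Proof.
exists (P ++ ordered_pair d (i, false, s) (j, false, ~~ s) ++ B).
exists ([:: (i, true, s); (j, true, ~~ s)] ++ A), (P ++ B), A.
split; rewrite -?catA // [A ++ P ++ _]catA [A ++ P ++ _]catA.
exact: MoveR2.
Qed.

Definition loc3 X Y Z X' Y' Z' := forall A B C : seq letter,
  move (X ++ A ++ Y ++ B ++ Z ++ C) (X' ++ A ++ Y' ++ B ++ Z' ++ C).

(** A code is cyclic, so a third move may begin at any of its three strands. *)
Lemma rmove_loc3 X Y Z X' Y' Z' P A B C :
  loc3 X Y Z X' Y' Z' \/ loc3 Y Z X Y' Z' X' \/ loc3 Z X Y Z' X' Y' ->
  rmove (P ++ X ++ A ++ Y ++ B ++ Z ++ C) (P ++ X' ++ A ++ Y' ++ B ++ Z' ++ C).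
Proof.
case=> [H|[H|H]].
- exists P; eexists; exists P; eexists; split; [reflexivity|reflexivity|].
  by rewrite -!catA; apply: H.
- exists (P ++ X ++ A), (Y ++ B ++ Z ++ C), (P ++ X' ++ A), (Y' ++ B ++ Z' ++ C).
  by rewrite -!catA; split=> //; have := H B (C ++ P) A; rewrite -!catA.
- exists (P ++ X ++ A ++ Y ++ B), (Z ++ C), (P ++ X' ++ A ++ Y' ++ B), (Z' ++ C).
  by rewrite -!catA; split=> //; have := H (C ++ P) A B; rewrite -!catA.
Qed.

Lemma code_slots b P M T : let p := final (start b) P in let q := final p M in
  code (start b) (P ++ M ++ T) =
  strand roleU (start b) P ++ strand roleU p M ++
  (strand roleU q T ++ rev (strand roleQ q T)) ++ rev (strand roleQ p M) ++
  (rev (strand roleQ (start b) P) ++ strand roleR (start b) P) ++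
  strand roleR p M ++ strand roleR q T.
Proof. by move=> p q; rewrite /code !strand_cat !rev_cat !catA. Qed.

Lemma code_R3 b P T n1 n2 n3 s :
  rmove (code (start b) (P ++ [:: (n1, (false, s)); (n2, (true, s)); (n3, (false, s))] ++ T))
        (code (start b) (P ++ [:: (n3, (true, s)); (n2, (false, s)); (n1, (true, s))] ++ T)).
Proof.
rewrite !code_slots; set p := final (start b) P.
have pp : isperm p by rewrite isperm_final isperm_start.
have -> : final p [:: (n3, (true, s)); (n2, (false, s)); (n1, (true, s))] =
  final p [:: (n1, (false, s)); (n2, (true, s)); (n3, (false, s))] by [].
apply: rmove_loc3; move: pp; case: p => [[a0 a1] a2] pp.
pose r x := x != roleQ.
(* For [s = true] the strand [a0], which ascends through both others, is the top one and [a2] the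
   bottom one; for [s = false] these roles and the order of the crossings are reversed. The booleans
   of the move tell which strands run to the right, and e is chosen to give crossing i its sign. *)
have T1 := fun A B C => @MoveR3 n1 n2 n3 (r a0) (r a1) (r a2) (true == ((a0 == roleQ) (+) (a1 == roleQ)) == (r a2)) A B C.
have T1' := fun A B C => @MoveR3' n1 n2 n3 (r a0) (r a1) (r a2) (true == ((a0 == roleQ) (+) (a1 == roleQ)) == (r a2)) A B C.
have T2 := fun A B C => @MoveR3 n3 n2 n1 (~~ r a2) (~~ r a1) (~~ r a0) (false == ((a1 == roleQ) (+) (a2 == roleQ)) == (~~ r a0)) A B C.
have T2' := fun A B C => @MoveR3' n3 n2 n1 (~~ r a2) (~~ r a1) (~~ r a0) (false == ((a1 == roleQ) (+) (a2 == roleQ)) == (~~ r a0)) A B C.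
move: pp T1 T1' T2 T2'; case: a0 a1 a2 => [[]|] [[]|] [[]|] // _;
  case: s => T1 T1' T2 T2'; rewrite /loc3 /=;
  first [ left; first [exact: T1|exact: T1'|exact: T2|exact: T2']
        | right; left; first [exact: T1|exact: T1'|exact: T2|exact: T2']
        | right; right; first [exact: T1|exact: T1'|exact: T2|exact: T2']].
Qed.

Lemma code_cat b P T : code (start b) (P ++ T) =
  strand roleU (start b) P ++
  (strand roleU (final (start b) P) T ++ rev (strand roleQ (final (start b) P) T)) ++
  (rev (strand roleQ (start b) P) ++ strand roleR (start b) P) ++
  strand roleR (final (start b) P) T.
Proof. by rewrite -(cat0s T) code_slots. Qed.

Lemma rmove_R2_slots i j e d X Y Z P A B C :
  let O := [:: (i, true, e); (j, true, ~~ e)] in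
  let N := ordered_pair d (i, false, e) (j, false, ~~ e) in
  [\/ [/\ X = O, Y = N & Z = [::]], [/\ X = N, Y = O & Z = [::]],
      [/\ X = O, Z = N & Y = [::]] | [/\ X = N, Z = O & Y = [::]]] \/
  [\/ [/\ Y = O, Z = N & X = [::]] | [/\ Y = N, Z = O & X = [::]]] ->
  rmove (P ++ X ++ A ++ Y ++ B ++ Z ++ C) (P ++ A ++ B ++ C).
Proof.
move=> O N; case=> [[]|[]] [-> -> ->]; rewrite ?cat0s.
- exact: rmove_R2l.
- exact: rmove_R2r.
- by have := @rmove_R2l i j e d P (A ++ B) C; rewrite -!catA.
- by have := @rmove_R2r i j e d P C (A ++ B); rewrite -!catA.
- by have := @rmove_R2l i j e d (P ++ A) B C; rewrite -!catA.
- by have := @rmove_R2r i j e d (P ++ A) C B; rewrite -!catA.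
Qed.

Lemma code_R2 b P T n1 n2 h s :
  rmove (code (start b) (P ++ [:: (n1, (h, s)); (n2, (h, ~~ s))] ++ T)) (code (start b) (P ++ T)).
Proof.
rewrite code_slots code_cat; set p := final (start b) P.
have pp : isperm p by rewrite isperm_final isperm_start.
have -> : final p [:: (n1, (h, s)); (n2, (h, ~~ s))] = p.
  by case: (p) => [[? ?] ?]; case: (h).
(* A strand of role Q runs to the left and so meets the second of the two crossings first. *)
pose oQ := (if s then asc h p else desc h p) == roleQ.
pose uQ := (if s then desc h p else asc h p) == roleQ.
pose e := s == ((asc h p == roleQ) (+) (desc h p == roleQ)).
have H := @rmove_R2_slots (if oQ then n2 else n1) (if oQ then n1 else n2) (if oQ then ~~ e else e)
  (oQ == uQ).
apply: H; rewrite /oQ /uQ /e; move: pp; case: (p) => [[a0 a1] a2] pp {p oQ uQ e}.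
move: pp; case: h; case: s; case: a0 a1 a2 => [[]|] [[]|] [[]|] //= _;
  first [ left; constructor 1; by split | left; constructor 2; by split
        | left; constructor 3; by split | left; constructor 4; by split
        | right; left; by split | right; right; by split].
Qed.

(** U and Q are joined at the right end, so a last crossing between them is a kink. *)
Lemma code_right_R1 b P i h s : 
  let p := final (start b) P in asc h p != roleR -> desc h p != roleR ->
  rmove (code (start b) (P ++ [:: (i, (h, s))])) (code (start b) P).
Proof.
move=> p; have pp : isperm p by rewrite isperm_final isperm_start.
rewrite -{2}(cats0 P) !code_cat -/p -[rev (strand roleQ p [::])]/[::] /= !cats0 => aR dR.
pose o := if asc h p == roleU then s else ~~ s.
have := @rmove_R1 i o (item_sign h s p) (strand roleU (start b) P)
  (rev (strand roleQ (start b) P) ++ strand roleR (start b) P).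
rewrite /o; congr (rmove _ _); congr (_ ++ _).
move: pp aR dR; case: (p) => [[a0 a1] a2]; case: h {o}; case: a0 a1 a2 => [[]|] [[]|] [[]|] //= _ _ _;
  by rewrite ?negbK cats0.
Qed.

(** The upper strands are joined at the left end, so a first crossing between them is a kink.
    Undoing it exchanges the heights of Q and R, hence [~~ b]. *)
Lemma code_left_R1 b T i s :
  rmove (code (start b) ((i, (true, s)) :: T)) (code (start (~~ b)) T).
Proof.
rewrite /code; set q := start (~~ b).
have qE : turn true (start b) = q by rewrite /q; case: (b).
have := @rmove_R1 i (if b then s else ~~ s) (item_sign true s (start b))
   (strand roleU q T ++ rev (strand roleQ q T)) (strand roleR q T).
congr (rmove _ _); last by rewrite -catA.
rewrite -[(i, (true, s)) :: T]cat1s !strand_cat rev_cat.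
rewrite -[final (start b) _]/(turn true (start b)) qE -!catA.
by case: (b); rewrite /= ?negbK.
Qed.

(** R passes entirely over or entirely under the two strands joined at the right end, so their cap
    can be pulled off it. *)
Lemma code_right_R2 b P i j h s :
  let p := final (start b) P in (if h then p.2 else p.1.1) = roleR ->
  rmove (code (start b) (P ++ [:: (i, (h, s)); (j, (~~ h, s))])) (code (start b) P).
Proof.
move=> p; have pp : isperm p by rewrite isperm_final isperm_start.
rewrite -{2}(cats0 P) !code_cat -/p -[rev (strand roleQ p [::])]/[::] => hR.
pose over_R := s != h; pose mid_U := p.1.2 == roleU; pose e := item_sign h s p.
pose sw := ~~ over_R && ~~ mid_U.
have := @rmove_R2_slots (if sw then j else i) (if sw then i else j) (if sw then ~~ e else e) mid_U
  [::] (strand roleU p [:: (i, (h, s)); (j, (~~ h, s))] ++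
        rev (strand roleQ p [:: (i, (h, s)); (j, (~~ h, s))]))
  (strand roleR p [:: (i, (h, s)); (j, (~~ h, s))])
  (strand roleU (start b) P) [::] (rev (strand roleQ (start b) P) ++ strand roleR (start b) P) [::].
rewrite !cat0s !cats0; apply; rewrite /sw /over_R /mid_U /e.
move: pp hR; case: (p) => [[a0 a1] a2] {e mid_U over_R sw}.
case: h; case: s; case: a0 a1 a2 => [[]|] [[]|] [[]|] //= _ _;
  first [ right; left; by split | right; right; by split].
Qed.

(** * Plats of words and the half twist *)

Definition word := seq (bool * bool).
Definition turns (p : state) (W : word) : state := foldl (fun q t => turn t.1 q) p W.
Definition wvalid b W := (turns (start b) W).1.2 != roleR.
Definition numbered k (W : word) : seq item := zip (iota k (size W)) W.
Definition plat b W := code (start b) (numbered 0 W).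

Lemma final_turns p I : final p I = turns p (map snd I).
Proof. by elim: I p => //= t I IH p; rewrite IH. Qed.

Lemma valid_wvalid b I : valid (start b) I = wvalid b (map snd I).
Proof. by rewrite /valid final_turns. Qed.

Lemma numbered_snd k W : map snd (numbered k W) = W.
Proof. by rewrite /numbered -/unzip2 unzip2_zip // size_iota. Qed.

Lemma numbered_names k W : tnames (numbered k W) = iota k (size W).
Proof. by rewrite /tnames /numbered -/unzip1 unzip1_zip // size_iota. Qed.

Lemma strand_rename f r p I :
  strand r p [seq (f t.1, t.2) | t <- I] = map (rename f) (strand r p I).
Proof.
elim: I p => //= [[i [h s]]] I IH p; rewrite /= IH map_cat; congr (_ ++ _).
by do 2?case: ifP.
Qed.

Lemma code_rename f p I : code p [seq (f t.1, t.2) | t <- I] = map (rename f) (code p I).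
Proof. by rewrite /code !strand_rename !map_cat map_rev. Qed.

(** [MoveRename] asks for a map injective on all names; outside [ns] it is a shift beyond all of
    [ms]. *)
Lemma injective_extension (ns ms : seq nat) : uniq ns -> uniq ms -> size ns = size ms ->
  exists2 f : nat -> nat, injective f & map f ns = ms.
Proof.
move=> un um sz; pose M := (sumn ms).+1.
have ltM k : k \in ms -> k < M.
  by rewrite /M; elim: (ms) => //= m l IH; rewrite inE => /orP[/eqP ->|/IH]; lia.
pose f k := if k \in ns then nth 0 ms (index k ns) else k + M.
have fin k : k \in ns -> f k \in ms.
  by move=> kns; rewrite /f kns mem_nth // -sz index_mem.
exists f.
  move=> x y; rewrite /f; case: ifP => xn; case: ifP => yn.
  - move/eqP; rewrite nth_uniq -?sz ?index_mem // => /eqP E.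
    by rewrite -(nth_index 0 xn) E nth_index.
  - by have := ltM _ (fin _ xn); rewrite /f xn => lt E; rewrite E in lt; lia.
  - by have := ltM _ (fin _ yn); rewrite /f yn => lt E; rewrite -E in lt; lia.
  - by lia.
apply: (@eq_from_nth _ 0); rewrite ?size_map // => k lt.
by rewrite (nth_map 0) // /f mem_nth // index_uniq.
Qed.

Lemma code_plat b I : uniq (tnames I) -> valid (start b) I ->
  same_knot (code (start b) I) (plat b (map snd I)).
Proof.
move=> uI vI; have uN : uniq (tnames (numbered 0 (map snd I))) by rewrite numbered_names iota_uniq.
have sz : size (tnames I) = size (tnames (numbered 0 (map snd I))).
  by rewrite numbered_names size_iota !size_map.
have [f injf Ef] := injective_extension uI uN sz.
have E : plat b (map snd I) = map (rename f) (code (start b) I).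
  rewrite -code_rename /plat; congr code; rewrite /numbered size_map.
  have: map f (tnames I) = iota 0 (size I) by rewrite Ef numbered_names size_map.
  move: (iota _ _) => l; elim: (I) l => [|[i hs] I' IH] [|x l] //= [-> /IH ->] //.
rewrite E; apply: rst_step; split.
- exact: code_diagram.
- by rewrite -E; apply: code_diagram; rewrite // valid_wvalid numbered_snd -valid_wvalid.
- exact: MoveRename.
Qed.

Lemma plat_rmove b b' I I' : uniq (tnames I) -> valid (start b) I ->
  uniq (tnames I') -> valid (start b') I' ->
  rmove (code (start b) I) (code (start b') I') ->
  same_knot (plat b (map snd I)) (plat b' (map snd I')).
Proof.
move=> uI vI uI' vI' mv; apply: same_knot_trans (code_plat uI' vI').
apply: same_knot_trans (code_rmove uI vI uI' vI' mv).
by apply: same_knot_sym; apply: code_plat.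
Qed.

Lemma turns_cat p W1 W2 : turns p (W1 ++ W2) = turns (turns p W1) W2.
Proof. by rewrite /turns foldl_cat. Qed.

(* The half twist, which conjugates each crossing to the one at the other
   height. *)
Definition delta (s : bool) : word := [:: (false, s); (true, s); (false, s)].
Definition delta' (s : bool) : word := [:: (true, s); (false, s); (true, s)].

Lemma plat_R3 b P T s : wvalid b (P ++ delta s ++ T) ->
  same_knot (plat b (P ++ delta s ++ T)) (plat b (P ++ delta' s ++ T)).
Proof.
move=> vW.
have := @plat_rmove b b
  (* The names 0, 1, 2 are reserved for the crossings of the move. *)
  (numbered 3 P ++ [:: (0, (false, s)); (1, (true, s)); (2, (false, s))] ++ numbered (3 + size P) T)
  (numbered 3 P ++ [:: (2, (true, s)); (1, (false, s)); (0, (true, s))] ++ numbered (3 + size P) T).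
rewrite /tnames !valid_wvalid !map_cat !numbered_snd -!/(tnames _) !numbered_names; apply.
- by rewrite uniq_catCA -iotaD /= !iota_uniq ?inE !mem_iota.
- exact: vW.
- by rewrite uniq_catCA -iotaD /= !iota_uniq ?inE !mem_iota.
- move: vW; rewrite /wvalid !turns_cat; by case: (turns _ _) => [[? ?] ?].
- exact: code_R3.
Qed.

Lemma turns_R2 p h s s' : turns p [:: (h, s); (h, s')] = p.
Proof. by case: p => [[? ?] ?]; case: h. Qed.

Lemma plat_R2 b P T h s : wvalid b (P ++ T) ->
  same_knot (plat b (P ++ [:: (h, s); (h, ~~ s)] ++ T)) (plat b (P ++ T)).
Proof.
move=> vW.
have := @plat_rmove b b
  (numbered 3 P ++ [:: (0, (h, s)); (1, (h, ~~ s))] ++ numbered (3 + size P) T)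
  (numbered 3 P ++ numbered (3 + size P) T).
rewrite /tnames !valid_wvalid !map_cat !numbered_snd -!/(tnames _) !numbered_names; apply.
- by rewrite uniq_catCA -iotaD /= !iota_uniq ?inE !mem_iota.
- by move: vW; rewrite /wvalid !turns_cat turns_R2.
- by rewrite -iotaD iota_uniq.
- exact: vW.
- exact: code_R2.
Qed.

Lemma plat_right_R1 b P h s : wvalid b P ->
  asc h (turns (start b) P) != roleR -> desc h (turns (start b) P) != roleR ->
  same_knot (plat b (P ++ [:: (h, s)])) (plat b P).
Proof.
move=> vW aR dR.
have := @plat_rmove b b (numbered 3 P ++ [:: (0, (h, s))]) (numbered 3 P).
rewrite /tnames !valid_wvalid !map_cat !numbered_snd -!/(tnames _) !numbered_names; apply.
- by rewrite uniq_catC /= iota_uniq mem_iota.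
- move: vW aR dR; rewrite /wvalid !turns_cat; case: (turns _ _) => [[a0 a1] a2] /=.
  by case: (h).
- exact: iota_uniq.
- exact: vW.
- by apply: code_right_R1; rewrite final_turns numbered_snd.
Qed.

Lemma plat_right_R2 b P h s : 
  (if h then (turns (start b) P).2 else (turns (start b) P).1.1) = roleR ->
  same_knot (plat b (P ++ [:: (h, s); (~~ h, s)])) (plat b P).
Proof.
move=> hR; have := isperm_final (start b) (numbered 3 P); rewrite isperm_start final_turns numbered_snd => pp.
have := @plat_rmove b b (numbered 3 P ++ [:: (0, (h, s)); (1, (~~ h, s))]) (numbered 3 P).
rewrite /tnames !valid_wvalid !map_cat !numbered_snd -!/(tnames _) !numbered_names; apply.
- by rewrite uniq_catC /= iota_uniq ?inE !mem_iota.
- move: pp hR; rewrite /wvalid !turns_cat; case: (turns _ _) => [[a0 a1] a2] /=.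
  by case: (h) => /=; case: a0 a1 a2 => [[]|] [[]|] [[]|].
- exact: iota_uniq.
- move: pp hR; rewrite /wvalid; case: (turns _ _) => [[a0 a1] a2] /=.
  by case: (h) => /=; case: a0 a1 a2 => [[]|] [[]|] [[]|].
- by apply: code_right_R2; rewrite final_turns numbered_snd.
Qed.

Lemma plat_left_R1 b T s : wvalid (~~ b) T ->
  same_knot (plat b ((true, s) :: T)) (plat (~~ b) T).
Proof.
move=> vW.
have := @plat_rmove b (~~ b) ((0, (true, s)) :: numbered 1 T) (numbered 1 T).
rewrite /= !valid_wvalid /= !numbered_snd -!/(tnames _) !numbered_names; apply.
- by rewrite iota_uniq mem_iota.
- move: vW; rewrite /wvalid; by case: (b).
- exact: iota_uniq.
- exact: vW.
- exact: code_left_R1.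
Qed.

Definition flip (W : word) : word := [seq (~~ t.1, t.2) | t <- W].
Definition rev3 (p : state) : state := (p.2, p.1.2, p.1.1).

Lemma turns_delta p s : turns p (delta s) = rev3 p.
Proof. by case: p => [[? ?] ?]. Qed.

Lemma turns_flip p W : turns (rev3 p) (flip W) = rev3 (turns p W).
Proof.
elim: W p => //= [[h s]] W IH p; rewrite /= -IH; congr turns.
by case: p h => [[? ?] ?] [].
Qed.

Lemma flipK W : flip (flip W) = W.
Proof. by rewrite /flip -map_comp map_id_in // => -[h s] _ /=; rewrite negbK. Qed.

Lemma wvalid_delta b P s T : wvalid b (P ++ delta s ++ T) = wvalid b (P ++ flip T).
Proof.
rewrite /wvalid !turns_cat turns_delta; set q := turns _ P.
by have -> : turns (rev3 q) T = rev3 (turns q (flip T)) by rewrite -(turns_flip q) flipK.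
Qed.

(** A letter with the sign of the half twist passes it by one third move. A letter of the opposite
    sign cancels, up to a third move, against the end of the half twist and is recreated in front of
    it. *)
Lemma slide_one b P T s x : wvalid b (P ++ delta s ++ x :: T) ->
  same_knot (plat b (P ++ delta s ++ x :: T)) (plat b (P ++ (~~ x.1, x.2) :: delta s ++ T)).
Proof.
case: x => h s' vW.
have turnE : wvalid b (P ++ (~~ h, s') :: delta s ++ T).
  by move: vW; rewrite /wvalid !turns_cat; case: (turns (start b) P) => [[? ?] ?]; case: (h).
have v2 h' : h' = h -> wvalid b ((P ++ [:: (h', s); (~~ h', s)]) ++ T).
  move=> ->; move: vW; rewrite /wvalid -catA !turns_cat.
  by case: (turns (start b) P) => [[? ?] ?]; case: (h).
have [ss|ss] := eqVneq s' s.
  subst s'; case: h vW turnE {v2} => vW turnE.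
    have := @plat_R3 b (P ++ [:: (false, s)]) T s; rewrite -!catA => /(_ turnE).
    exact: same_knot_sym.
  exact: (plat_R3 (T := (false, s) :: T) vW).
have {ss}Es : s' = ~~ s by case: s s' ss {vW turnE v2} => [] [].
subst s'; case: h vW turnE v2 => vW turnE v2.
  apply: same_knot_trans (plat_R3 (T := (true, ~~ s) :: T) vW) _.
  have := plat_R2 true s (v2 true erefl); rewrite -!catA /= => H; apply: same_knot_trans H _.
  apply: same_knot_sym.
  have := plat_R2 (P := P) (T := [:: (true, s); (false, s)] ++ T) false (~~ s).
  by rewrite negbK catA; apply; apply: (v2 true).
have := plat_R2 false s (v2 false erefl); rewrite -!catA /= => H; apply: same_knot_trans H _.
apply: same_knot_sym.
have := @plat_R3 b (P ++ [:: (true, ~~ s)]) T s; rewrite -!catA => /(_ turnE) H.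
apply: same_knot_trans H _.
have := plat_R2 (P := P) (T := [:: (false, s); (true, s)] ++ T) true (~~ s).
by rewrite negbK catA; apply; apply: (v2 false).
Qed.

Lemma slide b P T s : wvalid b (P ++ delta s ++ T) ->
  same_knot (plat b (P ++ delta s ++ T)) (plat b (P ++ flip T ++ delta s)).
Proof.
elim: T P => [|x T IH] P vW; first by rewrite cats0; apply: rst_refl.
apply: same_knot_trans (slide_one vW) _.
have := IH (P ++ [:: (~~ x.1, x.2)]); rewrite -!catA; apply.
by move: vW; rewrite wvalid_delta catA wvalid_delta -catA.
Qed.

(** At the right end a half twist consists of R passing over or under the cap that joins U and Q,
    and of a kink in that cap. *)
Lemma absorb b P s : wvalid b P -> same_knot (plat b (P ++ delta s)) (plat b P).
Proof.
move=> vP; set p := turns (start b) P.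
have pp : isperm p by rewrite /p -(numbered_snd 0 P) -final_turns isperm_final isperm_start.
have [R0|R0] := eqVneq p.1.1 roleR.
  apply: (@same_knot_trans (plat b (P ++ [:: (false, s); (true, s)]))).
    have := @plat_right_R1 b (P ++ [:: (false, s); (true, s)]) false s.
    rewrite -catA; apply; rewrite /wvalid turns_cat -/p; move: pp R0; case: (p) => [[a0 a1] a2] /=;
      by case: a0 a1 a2 => [[]|] [[]|] [[]|].
  by apply: (@plat_right_R2 b P false); rewrite -/p R0.
have R2 : p.2 = roleR.
  by move: pp R0 vP; rewrite /wvalid -/p; case: (p) => [[a0 a1] a2] /=;
    case: a0 a1 a2 => [[]|] [[]|] [[]|].
apply: (@same_knot_trans (plat b (P ++ delta' s))).
  have := @plat_R3 b P [::] s; rewrite !cats0; apply.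
  by rewrite /wvalid turns_cat turns_delta.
apply: (@same_knot_trans (plat b (P ++ [:: (true, s); (false, s)]))).
  have := @plat_right_R1 b (P ++ [:: (true, s); (false, s)]) true s.
  rewrite -catA; apply; rewrite /wvalid turns_cat -/p; move: pp R2; case: (p) => [[a0 a1] a2] /=;
    by case: a0 a1 a2 => [[]|] [[]|] [[]|].
by apply: (@plat_right_R2 b P true); rewrite -/p R2.
Qed.

Lemma plat_delta b P T s : wvalid b (P ++ flip T) ->
  same_knot (plat b (P ++ delta s ++ T)) (plat b (P ++ flip T)).
Proof.
move=> vW; apply: same_knot_trans (slide _) _; first by rewrite wvalid_delta.
by rewrite catA; apply: absorb.
Qed.

Lemma plat_delta' b P T s : wvalid b (P ++ flip T) ->
  same_knot (plat b (P ++ delta' s ++ T)) (plat b (P ++ flip T)).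
Proof.
move=> vW; apply: same_knot_trans (plat_delta s vW).
by apply: same_knot_sym; apply: plat_R3; rewrite wvalid_delta.
Qed.

Lemma plat_double b P T h s : wvalid b (P ++ (~~ h, ~~ s) :: flip T) ->
  same_knot (plat b (P ++ [:: (h, s); (~~ h, s)] ++ T)) (plat b (P ++ (~~ h, ~~ s) :: flip T)).
Proof.
move=> vW.
apply: (@same_knot_trans (plat b ((P ++ [:: (~~ h, ~~ s)]) ++
    [:: (~~ h, s); (h, s); (~~ h, s)] ++ T))).
  apply: same_knot_sym.
  have := @plat_R2 b P ([:: (h, s); (~~ h, s)] ++ T) (~~ h) (~~ s).
  rewrite negbK -!catA; apply.
  move: vW; rewrite -[(~~ h, ~~ s) :: flip T]cat1s catA -(wvalid_delta _ _ s).
  rewrite /wvalid -!catA !turns_cat; congr (is_true (_.1.2 != _)).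
  by case: (turns (start b) P) => [[? ?] ?]; case: (h).
have := vW; rewrite -[(~~ h, ~~ s) :: flip T]cat1s catA => v.
by case: h {vW} v => v; [apply: plat_delta|apply: plat_delta'].
Qed.

(** A third move turns the three letters into [(true, ~~ s)], [(false, s)], [(true, s)]. The first
    is a kink at the left end, so its sign may be changed, and what results is the half twist
    [delta' s]. *)
Lemma plat_left b T s : wvalid b (flip T) ->
  same_knot (plat b ([:: (false, s); (true, s); (false, ~~ s)] ++ T)) (plat b (flip T)).
Proof.
move=> vT; have v3 : wvalid b (delta s ++ T) by rewrite -[_ ++ T]cat0s wvalid_delta.
have v2 : wvalid (~~ b) ([:: (false, s); (true, s)] ++ T).
  by move: v3; rewrite /wvalid !turns_cat; case: (b).
apply: (@same_knot_trans (plat b ([:: (true, ~~ s)] ++ [:: (false, s); (true, s)] ++ T))).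
  apply: (@same_knot_trans (plat b ([:: (true, ~~ s)] ++ delta' s ++ (false, ~~ s) :: T))).
    apply: same_knot_sym; have := @plat_R2 b [::] ([:: (false, s); (true, s); (false, ~~ s)] ++ T)
      true (~~ s); rewrite negbK; apply.
    exact: v3.
  apply: (@same_knot_trans (plat b ([:: (true, ~~ s)] ++ delta s ++ (false, ~~ s) :: T))).
    apply: same_knot_sym; apply: plat_R3.
    by move: v3; rewrite /wvalid !turns_cat; case: (b).
  have := @plat_R2 b [:: (true, ~~ s); (false, s); (true, s)] T false s; apply.
  by move: v3; rewrite /wvalid !turns_cat; case: (b).
apply: same_knot_trans (plat_left_R1 _ v2) _.
apply: (@same_knot_trans (plat b (delta' s ++ T))).
  apply: same_knot_sym; exact: (@plat_left_R1 b _ s v2).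
exact: (@plat_delta' b [::]).
Qed.

(** The cap of U and Q is pulled off R along the last two crossings; the first one is then a kink,
    whatever its sign [s']. *)
Lemma plat_right b P h s s' :
  (if h then (turns (start b) P).1.1 else (turns (start b) P).2) = roleR ->
  same_knot (plat b (P ++ [:: (h, s'); (~~ h, s); (h, s)])) (plat b P).
Proof.
set p := turns _ _ => pR.
have pp : isperm p by rewrite /p -(numbered_snd 0 P) -final_turns isperm_final isperm_start.
apply: (@same_knot_trans (plat b (P ++ [:: (h, s')]))).
  have := @plat_right_R2 b (P ++ [:: (h, s')]) (~~ h) s; rewrite negbK -catA; apply.
  by rewrite turns_cat -/p; move: pR; case: (p) => [[a0 a1] a2] /=; case: (h).
apply: plat_right_R1; rewrite /wvalid -/p; move: pR pp; case: (p) => [[a0 a1] a2] /=;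
  case: (h); by case: a0 a1 a2 => [[]|] [[]|] [[]|].
Qed.

(** * Words *)

(* The letter 0 (false) puts the ascending strand on top. *)
Fixpoint alt (h : bool) (w : seq bool) : word :=
  if w is x :: w' then (h, ~~ x) :: alt (~~ h) w' else [::].

(** The residue of the length mod 3 tells whether Q (residue 0) or R (residue 1) is the middle
    strand at the left end. *)
Definition bplat (w : seq bool) := plat (size w %% 3 == 0) (alt false w).

Lemma size_alt h w : size (alt h w) = size w.
Proof. by elim: w h => //= x w IH h; rewrite IH. Qed.

Lemma alt_cat h u v : alt h (u ++ v) = alt h u ++ alt (h (+) odd (size u)) v.
Proof.
elim: u h => [|x u IH] h /=; first by rewrite addbF.
by rewrite IH addNb addbN.
Qed.

Lemma flip_alt h w : flip (alt h w) = alt (~~ h) w.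
Proof. by elim: w h => //= x w IH h; rewrite IH. Qed.

(** Three alternating letters reverse the order of the strands, so three letters can be removed at a
    time; the parity of the length records the reversals. *)
Lemma endR w : size w %% 3 != 2 ->
  let p := turns (start (size w %% 3 == 0)) (alt false w) in
  (if odd (size w) then p.1.1 else p.2) = roleR.
Proof.
have [n] := ubnP (size w); elim: n w => // n IH [|x [|y [|z w]]] // lt_n.
have s3 : size [:: x, y, z & w] %% 3 = size w %% 3 by rewrite /= -addn3 modnDr.
rewrite s3 => ne; set b := (size w %% 3 == 0).
have -> : turns (start b) (alt false [:: x, y, z & w]) = rev3 (turns (start b) (alt false w)).
  by rewrite -turns_flip flip_alt; case: (b).
have lt_w : size w < n by move: lt_n => /=; lia.
have := IH w lt_w ne; rewrite -/b [odd (size (_ :: _))]/= !negbK.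
by case: (odd (size w)).
Qed.

Lemma isperm_turns b W : isperm (turns (start b) W).
Proof. by rewrite -(numbered_snd 0 W) -final_turns isperm_final isperm_start. Qed.

Lemma wvalid_alt w : size w %% 3 != 2 -> wvalid (size w %% 3 == 0) (alt false w).
Proof.
move=> /endR /=; rewrite /wvalid.
have := isperm_turns (size w %% 3 == 0) (alt false w).
by case: (odd _); case: (turns _ _) => [[a0 a1] a2] /=; case: a0 a1 a2 => [[]|] [[]|] [[]|].
Qed.

Lemma bplat_triple u s v : size (u ++ v) %% 3 != 2 ->
  same_knot (bplat (u ++ [:: s; s; s] ++ v)) (bplat (u ++ v)).
Proof.
move=> /wvalid_alt; rewrite /bplat.
have -> : size (u ++ [:: s; s; s] ++ v) %% 3 = size (u ++ v) %% 3.
  by rewrite !size_cat /= addnCA addnC modnDr.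
move: (_ == 0) => b; rewrite !alt_cat !addFb addbT; set h := odd (size u).
have -> : alt h v = flip (alt (~~ h) v) by rewrite flip_alt negbK.
by case: h => vW; [apply: plat_delta'|apply: plat_delta].
Qed.

Lemma bplat_left s x v : size v %% 3 != 2 -> same_knot (bplat ([:: s; s; x] ++ v)) (bplat v).
Proof.
move=> v2; have [->|xs] := eqVneq x s; first exact: (@bplat_triple [::] s v).
have {xs}-> : x = ~~ s by case: x s xs => [] [].
have := wvalid_alt v2; rewrite /bplat.
have -> : size ([:: s; s; ~~ s] ++ v) %% 3 = size v %% 3 by rewrite size_cat addnC modnDr.
move: (_ == 0) => b; have -> : alt false v = flip (alt true v) by rewrite flip_alt.
exact: plat_left.
Qed.

Lemma bplat_right s x v : size v %% 3 != 2 -> same_knot (bplat (v ++ [:: x; s; s])) (bplat v).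
Proof.
move=> v2; have := endR v2; rewrite /bplat.
have -> : size (v ++ [:: x; s; s]) %% 3 = size v %% 3 by rewrite size_cat modnDr.
move: (_ == 0) => b /= eR; rewrite alt_cat /= negbK; exact: plat_right.
Qed.

Definition push (st : seq bool) (x : bool) : seq bool :=
  if st is y :: z :: st' then if (x == y) && (y == z) then st' else x :: st else x :: st.
(* The word is kept in reverse order. *)
Definition red (w : seq bool) : seq bool := foldl push [::] w.
Fixpoint trim (w : seq bool) : seq bool :=
  if w is x :: y :: z :: w' then if x == y then trim w' else w else w.
(** As [red] keeps the word reversed, the inner [trim] acts on the right end of the word and the
    outer one on the left end. *)
Definition core (w : seq bool) : seq bool := trim (rev (trim (red w))).

Lemma bplat_push st w : size (rev st ++ w) %% 3 != 2 ->
  same_knot (bplat (rev st ++ w)) (bplat (rev (foldl push st w)))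
  /\ size (foldl push st w) = size (rev st ++ w) %[mod 3].
Proof.
elim: w st => [|x w IH] st h3; first by rewrite cats0 size_rev; split=> //; apply: rst_refl.
case E : (push st x == x :: st).
  rewrite -[foldl push st (x :: w)]/(foldl push (push st x) w) (eqP E).
  by move: h3; rewrite -cat_rcons -rev_cons; apply: IH.
move: E h3 => /=; case: st => [|y [|z st]] //=; rewrite ?eqxx //.
case: ifP => [/andP[/eqP <- /eqP <-] _|]; last by rewrite eqxx.
rewrite !rev_cons -!cats1 -!catA => h3.
have s3 : size (rev st ++ [:: x; x; x] ++ w) %% 3 = size (rev st ++ w) %% 3.
  by rewrite !size_cat /= addnCA addnC modnDr.
rewrite s3 in h3; have [H1 H2] := IH st h3; rewrite s3; split=> //.
by apply: same_knot_trans H1; apply: bplat_triple.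
Qed.

Lemma bplat_red w : size w %% 3 != 2 ->
  same_knot (bplat w) (bplat (rev (red w))) /\ size (red w) = size w %[mod 3].
Proof. exact: (@bplat_push [::] w). Qed.

Lemma bplat_trim w : size w %% 3 != 2 ->
  [/\ same_knot (bplat w) (bplat (trim w)), same_knot (bplat (rev w)) (bplat (rev (trim w))) &
      size (trim w) = size w %[mod 3]].
Proof.
have [n] := ubnP (size w); elim: n w => // n IH [|x [|y [|z w]]] lt_n h3;
  try by split; first [exact: rst_refl | by []].
rewrite [trim _]/=; case: eqP => [<-|_]; last by split; first [exact: rst_refl | by []].
have s3 : size [:: x, x, z & w] %% 3 = size w %% 3 by rewrite /= -addn3 modnDr.
rewrite s3 in h3 *; have [||H1 H2 H3] := IH w; [by move: lt_n => /=; lia|exact: h3|split=> //].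
  apply: same_knot_trans H1; exact: (@bplat_left x z w).
apply: same_knot_trans H2; have := @bplat_right x z (rev w); rewrite size_rev => /(_ h3).
by rewrite !rev_cons -!cats1 -!catA.
Qed.

Lemma bplat_core w : size w %% 3 != 2 ->
  same_knot (bplat w) (bplat (core w)) /\ size (core w) = size w %[mod 3].
Proof.
move=> h3; have [H1 E1] := bplat_red h3.
have h3' : size (red w) %% 3 != 2 by rewrite E1.
have [_ H2 E2] := bplat_trim h3'.
have h3'' : size (rev (trim (red w))) %% 3 != 2 by rewrite size_rev E2 E1.
have [H3 _ E3] := bplat_trim h3''.
split; last by rewrite /core E3 size_rev E2 E1.
by apply: same_knot_trans H1 _; apply: same_knot_trans H2 _.
Qed.

(* One height per block of equal letters: a block of two letters at heights
   h, ~~ h becomes a single crossing at height ~~ h. *)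
Fixpoint heights (h : bool) (w : seq bool) : seq bool :=
  match w with
  | x :: ((y :: v) as w') =>
      if x == y then ~~ h :: heights (~~ h) v else h :: heights (~~ h) w'
  | [:: _] => [:: h]
  | [::] => [::]
  end.

Definition blocks w := size (heights false w).

Fixpoint no3 (w : seq bool) : bool :=
  if w is x :: w' then
    ~~ (if w' is y :: z :: _ then (x == y) && (y == z) else false) && no3 w'
  else true.

Fixpoint last_single (w : seq bool) : bool :=
  if w is x :: w' then if w' is [:: y] then x != y else last_single w' else true.

Definition lastR (q : state) (h : bool) := (if h then q.2 else q.1.1) == roleR.

Lemma turns_double p h s T :
  turns p ((~~ h, ~~ s) :: flip T) = rev3 (turns p ([:: (h, s); (~~ h, s)] ++ T)).
Proof. by rewrite turns_cat -turns_flip; case: p => [[? ?] ?]; case: h. Qed.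

Lemma wvalid_double b P h s T :
  wvalid b (P ++ (~~ h, ~~ s) :: flip T) = wvalid b (P ++ [:: (h, s); (~~ h, s)] ++ T).
Proof. by rewrite /wvalid turns_cat turns_double -turns_cat. Qed.

Lemma heights_cons h x w : exists a l, heights h (x :: w) = a :: l.
Proof. by case: w => [|y w] /=; [|case: ifP => _]; do 2!eexists. Qed.

Lemma plat_heights b P h x w : no3 (x :: w) -> last_single (x :: w) ->
  wvalid b (P ++ alt h (x :: w)) ->
  lastR (turns (start b) (P ++ alt h (x :: w))) (h (+) odd (size w)) ->
  let W := typed (h (+) ~~ x) (heights h (x :: w)) in
  [/\ same_knot (plat b (P ++ alt h (x :: w))) (plat b (P ++ W)), wvalid b (P ++ W) &
      lastR (turns (start b) (P ++ W)) (last h (heights h (x :: w)))].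
Proof.
have [n] := ubnP (size w); elim: n w P h x => // n IH [|y w] P h x lt_n.
  move=> _ _ v l /=; rewrite addKb; split=> //; first exact: rst_refl.
  by move: l; rewrite addbF.
rewrite -[heights h [:: x, y & w]]/(if x == y then ~~ h :: heights (~~ h) w
  else h :: heights (~~ h) (y :: w)).
have [<-|nxy] := eqVneq x y.
  case: w lt_n => [|z w] lt_n; first by move=> _ /=; rewrite eqxx.
  rewrite -[no3 _]/(~~ ((x == x) && (x == z)) && (no3 [:: x, z & w])) eqxx andTb.
  case/andP=> nxz /andP[_ n3] ls v l.
  have zE : z = ~~ x by move: nxz; case: (x) (z) => [] [].
  have E : alt h [:: x, x, z & w] = [:: (h, ~~ x); (~~ h, ~~ x)] ++ alt h (z :: w).
    by rewrite -[LHS]/([:: (h, ~~ x); (~~ h, ~~ x)] ++ alt (~~ ~~ h) (z :: w)) negbK.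
  rewrite E in v l *.
  have ls' : last_single (z :: w) by move: ls; case: (w).
  have v' : wvalid b ((P ++ [:: (~~ h, ~~ ~~ x)]) ++ alt (~~ h) (z :: w)).
    by rewrite -catA cat1s -flip_alt wvalid_double.
  have l' : lastR (turns (start b) ((P ++ [:: (~~ h, ~~ ~~ x)]) ++ alt (~~ h) (z :: w)))
      (~~ h (+) odd (size w)).
    rewrite -catA cat1s -flip_alt turns_cat turns_double -turns_cat.
    by move: l; rewrite /lastR /= negbK; case: (h) (odd _) => [] [].
  have lt_w : size w < n by move: lt_n => /=; lia.
  have [S V L] := IH w (P ++ [:: (~~ h, ~~ ~~ x)]) (~~ h) z lt_w n3 ls' v' l'.
  have tE : P ++ typed (h (+) ~~ x) (~~ h :: heights (~~ h) (z :: w)) =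
      (P ++ [:: (~~ h, ~~ ~~ x)]) ++ typed (~~ h (+) ~~ z) (heights (~~ h) (z :: w)).
    rewrite -catA cat1s /typed map_cons zE; congr (_ ++ (_ , _) :: _); first by case: (h) (x) => [] [].
    by apply: eq_map => k; case: (h) (x) => [] [].
  cbv zeta; rewrite tE; split=> //.
  apply: same_knot_trans S; rewrite -catA cat1s -flip_alt.
  by apply: plat_double; rewrite wvalid_double.
move=> /= /andP[_ n3] ls v l.
have E : alt h [:: x, y & w] = [:: (h, ~~ x)] ++ alt (~~ h) (y :: w) by [].
rewrite -/(alt (~~ h) (y :: w)) in v l.
have ls' : last_single (y :: w) by move: ls; case: (w).
have v' : wvalid b ((P ++ [:: (h, ~~ x)]) ++ alt (~~ h) (y :: w)) by rewrite -catA.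
have l' : lastR (turns (start b) ((P ++ [:: (h, ~~ x)]) ++ alt (~~ h) (y :: w)))
    (~~ h (+) odd (size w)).
  by move: l; rewrite -catA addbN addNb.
have lt_w : size w < n by move: lt_n => /=; lia.
have [S V L] := IH w (P ++ [:: (h, ~~ x)]) (~~ h) y lt_w n3 ls' v' l'.
have yE : y = ~~ x by move: nxy; case: (x) (y) => [] [].
have tE : P ++ typed (h (+) ~~ x) (h :: heights (~~ h) (y :: w)) =
    (P ++ [:: (h, ~~ x)]) ++ typed (~~ h (+) ~~ y) (heights (~~ h) (y :: w)).
  rewrite -catA cat1s /typed map_cons yE addKb; congr (_ ++ _ :: _).
  by apply: eq_map => k; case: (h) (x) => [] [].
cbv zeta; rewrite -/(heights (~~ h) (y :: w)) tE; split=> //.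
  by apply: same_knot_trans S; rewrite -catA; apply: rst_refl.
by move: L; have [a [t ->]] := heights_cons (~~ h) y w.
Qed.

Lemma no3P w : reflect (forall u s v, w <> u ++ [:: s; s; s] ++ v) (no3 w).
Proof.
elim: w => [|x w IH]; first by left=> -[].
rewrite [no3 _]/=; apply: (iffP andP) => [[xw /IH n3] [|y u] s v|H].
- by move=> [E1 E2]; move: xw; rewrite E2 E1 !eqxx.
- by move=> [_ E]; apply: (n3 u s v).
split; last by apply/IH => u s v E; apply: (H (x :: u) s v); rewrite E.
case: w {IH} H => [|y [|z w]] // H; apply/negP => /andP[/eqP xy /eqP yz].
by apply: (H [::] x w); rewrite xy yz.
Qed.

Lemma last_singleP w : reflect (forall u s, w <> u ++ [:: s; s]) (last_single w).
Proof.
elim: w => [|x w IH]; first by left=> -[].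
case: w IH => [|y [|z w]] IH.
- by left=> -[|? [|? ?]].
- apply: (iffP idP) => [/= nxy [|a [|b [|? ?]]] s //|H] /=.
    by case=> E1 E2; rewrite E1 E2 eqxx in nxy.
  by apply/eqP => E; apply: (H [::] y); rewrite E.
apply: (iffP IH) => [H [|a u] s //|H u s E]; first by case=> _ E; apply: (H u s).
by apply: (H (x :: u) s); rewrite E.
Qed.

Lemma no3_rev w : no3 (rev w) = no3 w.
Proof.
have aux v : no3 v -> no3 (rev v).
  move=> /no3P H; apply/no3P => u s t E; apply: (H (rev t) s (rev u)).
  by rewrite -[v]revK E !rev_cat -catA.
by apply/idP/idP => [/aux|/aux //]; rewrite revK.
Qed.

Lemma no3_suffix u v : no3 (u ++ v) -> no3 v.
Proof. by move=> /no3P H; apply/no3P => a s b E; apply: (H (u ++ a) s b); rewrite E catA. Qed.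

Lemma last_single_suffix u v : last_single (u ++ v) -> last_single v.
Proof. by move=> /last_singleP H; apply/last_singleP => a s E; apply: (H (u ++ a) s); rewrite E catA. Qed.

Lemma no3_push st x : no3 st -> no3 (push st x).
Proof.
case: st => [|y [|z st]] //; rewrite [push _ _]/=; case: ifP => [_ n3|nxy n3].
  exact: (@no3_suffix [:: y; z]).
by rewrite -[no3 (x :: _)]/(~~ ((x == y) && (y == z)) && no3 [:: y, z & st]) nxy.
Qed.

Lemma no3_red w : no3 (red w).
Proof. by rewrite /red; elim/last_ind: w => // w x IH; rewrite foldl_rcons no3_push. Qed.

Lemma trim_suffix w : exists u, w = u ++ trim w.
Proof.
have [n] := ubnP (size w); elim: n w => // n IH [|x [|y [|z w]]] lt_n; try by exists [::].
rewrite [trim _]/=; case: ifP => _; last by exists [::].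
have [|u E] := IH w; first by move: lt_n => /=; lia.
by exists [:: x, y, z & u]; rewrite {1}E.
Qed.

Lemma trim_head w s v : trim w = [:: s, s & v] -> v = [::].
Proof.
have [n] := ubnP (size w); elim: n w => // n IH [|x [|y [|z w]]] lt_n //; first by case=> _ _ <-.
rewrite [trim _]/=; case: ifP => [_|nxy]; first by apply: IH; move: lt_n => /=; lia.
by case=> E1 E2; rewrite E1 E2 eqxx in nxy.
Qed.

Definition core_ok (r : seq bool) :=
  [&& 2 < size r, no3 r, last_single r & nth false r 0 != nth false r 1].

Lemma trim_last_single w : 2 < size (trim w) -> last_single (rev (trim w)).
Proof.
move=> lt2; apply/last_singleP => u s E.
have := @trim_head w s (rev u); rewrite -[trim w]revK E rev_cat => /(_ erefl) E0.
by move: lt2; rewrite -size_rev E -[u]revK E0.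
Qed.

Lemma core_okP w : 2 < size (core w) -> core_ok (core w).
Proof.
move=> lt2; apply/and4P; split=> //.
- have [u E] := trim_suffix (rev (trim (red w))); have [v E'] := trim_suffix (red w).
  apply: (@no3_suffix u); rewrite -E no3_rev; apply: (@no3_suffix v); rewrite -E'.
  exact: no3_red.
- have [u E] := trim_suffix (rev (trim (red w))).
  apply: (@last_single_suffix u); rewrite -E; apply: trim_last_single.
  by rewrite -size_rev E size_cat; apply: leq_trans lt2 (leq_addl _ _).
- have := @trim_head (rev (trim (red w))); rewrite -/(core w); move: lt2.
  case: (core w) => [|x [|y [|z v]]] //= _ H; apply/eqP => E.
  by have := H x (z :: v); rewrite E => /(_ erefl).
Qed.

(** * Crossing numbers of plats *)

Lemma crossing_number_le G H : same_knot G H -> crossing_number G <= crossings H.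
Proof.
move=> sGH; rewrite /crossing_number; case: ex_minnP => m _ min; apply: min.
by apply/asboolP; exists H.
Qed.

Lemma crossing_number_eq G H c : same_knot G H -> crossings H = c ->
  (forall K, same_knot H K -> c <= crossings K) -> crossing_number G = c.
Proof.
move=> sGH cH lb; apply/eqP; rewrite eqn_leq -{1}cH crossing_number_le //=.
rewrite /crossing_number; case: ex_minnP => m /asboolP[K sGK <-] _; apply: lb.
exact: same_knot_trans (same_knot_sym sGH) sGK.
Qed.

Lemma crossings_plat b W : crossings (plat b W) = size W.
Proof. by rewrite crossings_code /numbered size_zip size_iota minnn. Qed.

Lemma crossing_number_core G r : core_ok r -> size r %% 3 != 2 -> same_knot G (bplat r) ->
  crossing_number G = blocks r.
Proof.
case: r => [|x [|y [|z w]]] // /and4P[_ n3 ls nxy] h3 sG.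
set r := [:: x, y, z & w] in n3 ls h3 sG *; set b := size r %% 3 == 0.
have vr : wvalid b ([::] ++ alt false r) := wvalid_alt h3.
have lr : lastR (turns (start b) ([::] ++ alt false r)) (false (+) odd (size [:: y, z & w])).
  by have := endR h3; rewrite -/b /lastR /= negbK; case: (odd _) => /= ->.
have [S V L] := plat_heights n3 ls vr lr.
set W := typed _ _ in S V L; rewrite cat0s in S V L.
have [a [hs Eh]] := heights_cons true y (z :: w).
have Er : heights false r = false :: a :: hs.
  by move: nxy; rewrite /= => /negbTE nxy; rewrite -Eh /r /= nxy.
have sW : size W = blocks r by rewrite /W size_map.
apply: (@crossing_number_eq _ (plat b W)).
- exact: same_knot_trans sG S.
- by rewrite crossings_plat.
move=> K sK.
pose T := numbered 0 W.
have uT : uniq (tnames T) by rewrite numbered_names iota_uniq.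
have vT : valid (start b) T by rewrite valid_wvalid numbered_snd.
have ET : map snd T = typed (false (+) ~~ x) (false :: rcons (belast a hs) (~~ end_cap (start b) T)).
  rewrite numbered_snd /W Er; congr typed; congr (_ :: _); rewrite lastI; congr rcons.
  move: L; rewrite Er /= /lastR /end_cap final_turns numbered_snd.
  have := isperm_turns b W; move: V; rewrite /wvalid; case: (turns _ _) => [[a0 a1] a2] /=.
  by case: (last a hs); case: a0 a1 a2 => [[]|] [[]|] [[]|] //=.
have [k [c0 c1]] := alternating_coef uT vT ET.
have sT : size T = blocks r by rewrite -sW /T /numbered size_zip size_iota minnn.
by rewrite -sT; apply: (crossings_lower sK _ c0 c1); apply: code_diagram.
Qed.

Lemma crossing_number_bplat G w c : size w %% 3 != 2 -> same_knot G (bplat w) -> 2 < c ->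
  (crossing_number G = c) <-> ((2 < size (core w)) && (blocks (core w) == c)).
Proof.
move=> h3 sG c3; have [sC Es] := bplat_core h3.
have sGC := same_knot_trans sG sC.
have h3' : size (core w) %% 3 != 2 by rewrite Es.
have [lt2|ge2] := ltnP 2 (size (core w)).
  by rewrite (crossing_number_core (core_okP lt2) h3' sGC) andTb; apply: (rwP eqP).
(* A core of at most two letters gives a diagram with at most two crossings, too few for [c]. *)
split=> // E; have := crossing_number_le sGC; rewrite E /bplat crossings_plat size_alt; lia.
Qed.

(** * Billiard diagrams *)

(** The order of the strands just to the left of the line x = m + 1. Its period 6 is that of the
    height of the ball. *)
Fixpoint alt_state (b : bool) (m : nat) : state :=
  if m is m'.+1 then turn (odd m') (alt_state b m') else start b.

Lemma alt_state6 b m : alt_state b (m + 6) = alt_state b m.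
Proof.
rewrite !addnS addn0 /= !negbK; case: (alt_state b m) => [[? ?] ?].
by case: (odd m).
Qed.

Lemma alt_state_mod b m : alt_state b m = alt_state b (m %% 6).
Proof.
rewrite {1}(divn_eq m 6); elim: (m %/ 6) => // q IH.
have -> : q.+1 * 6 + m %% 6 = (q * 6 + m %% 6) + 6 by lia.
by rewrite alt_state6.
Qed.

Lemma strand_alt b r k w :
  strand r (alt_state b k) (zip (iota k.+1 (size w)) (alt (odd k) w)) =
  flatten [seq item_letter r (alt_state b x.-1) (x, (odd x.-1, ~~ nth false w (x - k.+1)))
          | x <- iota k.+1 (size w)].
Proof.
elim: w k => //= x w IH k; rewrite subnn /=; congr (_ ++ _).
rewrite -[turn (odd k) _]/(alt_state b k.+1) -[~~ odd k]/(odd k.+1) IH; congr flatten.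
apply/eq_in_map => y; rewrite mem_iota => /andP[ky _].
by rewrite -(subnSK ky).
Qed.

Section BilliardCode.
Variables (n : nat) (w : n.-tuple bool).
Hypothesis n3 : n %% 3 != 2.

Lemma bounce_small p t : t <= p -> bounce p t = t.
Proof.
move=> tp; rewrite /bounce; case: (posnP p) => [p0|p_gt0].
  by move: tp; rewrite p0 leqn0 => /eqP ->.
by rewrite modn_small ?tp //; lia.
Qed.

Lemma bounceE p t x : 0 < p -> t <= 3 * p ->
  (bounce p t == x) = [&& x <= p & t \in [:: x; 2 * p - x; 2 * p + x]].
Proof.
move=> p0 t3; rewrite /bounce !inE.
have [lt|ge] := ltnP t (2 * p).
  by rewrite modn_small //; case: leqP => ?; lia.
have -> : t %% (2 * p) = t - 2 * p.
  by rewrite -{1}(subnK ge) modnDr modn_small //; lia.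
by case: leqP => ?; lia.
Qed.

Lemma last_time : lcmn 3 n.+1 = 3 * n.+1.
Proof.
have cop : coprime 3 n.+1 by rewrite prime_coprime //; move: n3; lia.
by have := muln_lcm_gcd 3 n.+1; rewrite (eqP cop) muln1.
Qed.

Lemma column_times x : 0 < x <= n ->
  [seq t <- times n | bounce n.+1 t == x] = [:: x; 2 * n.+1 - x; 2 * n.+1 + x].
Proof.
move=> xn; apply: (irr_sorted_eq ltn_trans ltnn).
- by apply: sorted_filter; [apply: ltn_trans|apply: iota_ltn_sorted].
- by rewrite /=; apply/and3P; split=> //; lia.
move=> t; rewrite mem_filter mem_iota /= add0n ltnS last_time.
case: (leqP t (3 * n.+1)) => t3; last by rewrite andbF !inE; lia.
by rewrite andbT bounceE //; case/andP: xn => _ xn; rewrite (leqW xn).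
Qed.

Lemma other_timesE t x : 0 < x <= n -> t \in [:: x; 2 * n.+1 - x; 2 * n.+1 + x] ->
  other_times n t = [seq t' <- [:: x; 2 * n.+1 - x; 2 * n.+1 + x]
                    | (t' != t) && (bounce 3 t' == bounce 3 t)].
Proof.
move=> xn tx; rewrite -(column_times xn) -filter_predI /other_times; apply: eq_in_filter => t' _ /=.
have -> : bounce n.+1 t' == x = (bounce n.+1 t' == bounce n.+1 t).
  congr (_ == _); apply/esym/eqP; rewrite bounceE //; first by rewrite tx; lia.
  by move: tx; rewrite !inE; lia.
by rewrite /ball xpair_eqE -andbA [(bounce n.+1 t' == _) && _]andbC.
Qed.

(** The ball runs along U to the right, along Q back and along R to the right again; these are its
    times on the vertical line [x]. *)
Definition ptime (r : role) (x : nat) : nat :=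
  match r with None => x | Some false => 2 * n.+1 - x | Some true => 2 * n.+1 + x end.

Lemma bounce3E t : bounce 3 t = if t %% 6 <= 3 then t %% 6 else 6 - t %% 6.
Proof. by []. Qed.

(** Heights and directions depend only on [n %% 3] and on [x] mod 6, as 2(n + 1) is 2 or 4 mod 6.
    This leaves twelve cases for each strand. *)
Lemma passage_letter r x : 0 < x <= n ->
  item_letter r (alt_state (n %% 3 == 0) x.-1) (x, (odd x.-1, ~~ nth false w x.-1)) =
  if other_times n (ptime r x) != [::] then [:: passage w (ptime r x)] else [::].
Proof.
move=> xn; pose t1 := x; pose t2 := 2 * n.+1 - x; pose t3 := 2 * n.+1 + x.
have P1 : ptime None x = t1 by []; have P2 : ptime roleQ x = t2 by [].
have P3 : ptime roleR x = t3 by [].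
have n12 : (t1 == t2) = false by rewrite /t1 /t2; lia.
have n13 : (t1 == t3) = false by rewrite /t1 /t3; lia.
have n23 : (t2 == t3) = false by rewrite /t2 /t3; lia.
have B1 : bounce n.+1 t1 = x by apply/eqP; rewrite bounceE // ?inE ?eqxx /t1; lia.
have B2 : bounce n.+1 t2 = x by apply/eqP; rewrite bounceE // ?inE ?eqxx /t2; lia.
have B3 : bounce n.+1 t3 = x by apply/eqP; rewrite bounceE // ?inE ?eqxx /t3; lia.
have D1 : bounce_dir n.+1 t1 = 1%R by rewrite /bounce_dir /t1 modn_small; case: ltnP; lia.
have D2 : bounce_dir n.+1 t2 = (-1)%R by rewrite /bounce_dir /t2 modn_small; [case: ltnP; lia|lia].
have D3 : bounce_dir n.+1 t3 = 1%R.
  by rewrite /bounce_dir /t3 modnDl modn_small; [case: ltnP; lia|lia].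
have O r' : other_times n (ptime r' x) = [seq t' <- [:: t1; t2; t3]
    | (t' != ptime r' x) && (bounce 3 t' == bounce 3 (ptime r' x))].
  by apply: other_timesE => //; case: r' => [[]|]; rewrite !inE eqxx ?orbT.
have pred_mod : odd x.-1 = odd (x.-1 %% 6) by rewrite {1}(divn_eq x.-1 6) oddD oddM andbF.
have [q [j [jlt xE]]] : exists q j, j < 6 /\ x = 6 * q + j + 1.
  by exists (x.-1 %/ 6), (x.-1 %% 6); split; [exact: ltn_pmod|have := divn_eq x.-1 6; lia].
have m0 : x.-1 %% 6 = j by rewrite xE; lia.
have [k [e [elt nE]]] : exists k e, e < 2 /\ n = 3 * k + e.
  by exists (n %/ 3), (n %% 3); split; [move: n3; lia|have := divn_eq n 3; lia].
have m3 : n %% 3 = e by rewrite nE; lia.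
have m1 : t1 %% 6 = nth 0 [:: 1; 2; 3; 4; 5; 0] j.
  rewrite /t1 xE {P1 B1 D1 O m0 n12 n13}; case: j jlt xE => [|[|[|[|[|[|j]]]]]] //= *; lia.
have m2 : t2 %% 6 = nth 0 (if e == 0 then [:: 1; 0; 5; 4; 3; 2] else [:: 3; 2; 1; 0; 5; 4]) j.
  rewrite /t2; case: e elt nE {m3} => [|[|e]] //= _ nE; case: j jlt xE {m0 m1}
    => [|[|[|[|[|[|j]]]]]] //= _ xE; lia.
have m3' : t3 %% 6 = nth 0 (if e == 0 then [:: 3; 4; 5; 0; 1; 2] else [:: 5; 0; 1; 2; 3; 4]) j.
  rewrite /t3; case: e elt nE {m3 m2} => [|[|e]] //= _ nE; case: j jlt xE {m0 m1}
    => [|[|[|[|[|[|j]]]]]] //= _ xE; lia.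
have Y1 := bounce3E t1; have Y2 := bounce3E t2; have Y3 := bounce3E t3.
have dir3 t : bounce_dir 3 t = if t %% 6 < 3 then 1%R else (-1)%R by [].
have V1 := dir3 t1; have V2 := dir3 t2; have V3 := dir3 t3.
rewrite m1 in Y1 V1; rewrite m2 in Y2 V2; rewrite m3' in Y3 V3.
rewrite alt_state_mod pred_mod /passage /on_top /ascending /velocity /ball O [filter _ _]/=.
rewrite m0 m3 {O dir3 pred_mod m0 m3 m1 m2 m3'}; clearbody t1 t2 t3.
have n21 : (t2 == t1) = false by rewrite eq_sym.
have n31 : (t3 == t1) = false by rewrite eq_sym.
have n32 : (t3 == t2) = false by rewrite eq_sym.
clear nE xE; move: elt jlt Y1 V1 Y2 V2 Y3 V3; case: e => [|[|e]] // _;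
  case: j => [|[|[|[|[|[|j]]]]]] // _ /= Y1 V1 Y2 V2 Y3 V3;
  case: r => [[]|]; rewrite ?P1 ?P2 ?P3 ?Y1 ?Y2 ?Y3 /= ?eqxx ?n12 ?n13 ?n23 ?n21 ?n31 ?n32 /=;
  rewrite ?V1 ?V2 ?V3 ?D1 ?D2 ?D3 ?B1 ?B2 ?B3 //=; case: (nth false _ _) => //=.
Qed.

(** At these times the ball is on a vertical side. It meets each such side twice, at different
    heights because 3 does not divide n + 1. *)
Lemma corner_times t : t \in [:: 0; n.+1; 2 * n.+1; 3 * n.+1] -> other_times n t = [::].
Proof.
move=> tc; rewrite /other_times (@eq_in_filter _ _ pred0) ?filter_pred0 // => t'.
rewrite mem_iota add0n ltnS last_time /= => t'3; apply/negP => /andP[tt'].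
rewrite /ball xpair_eqE => /andP[Ex Ey].
have y0 : bounce 3 0 != bounce 3 (2 * n.+1).
  have [E|E] : (2 * n.+1) %% 6 = 2 \/ (2 * n.+1) %% 6 = 4 by move: n3; lia.
    by rewrite (bounce3E (2 * _)) E.
  by rewrite (bounce3E (2 * _)) E.
have yN : bounce 3 n.+1 != bounce 3 (3 * n.+1).
  have r1 : n.+1 %% 6 \in [:: 1; 2; 4; 5] by move: n3; rewrite !inE; lia.
  have r3 : (3 * n.+1) %% 6 \in [:: 0; 3] by rewrite !inE; lia.
  rewrite (bounce3E n.+1) (bounce3E (3 * _)); move: r1 r3; rewrite !inE.
  by case/or4P=> /eqP ->; case/orP=> /eqP ->.
have b0 : bounce n.+1 0 = 0 by rewrite bounce_small.
have b1 : bounce n.+1 n.+1 = n.+1 by rewrite bounce_small.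
have b2 : bounce n.+1 (2 * n.+1) = 0 by apply/eqP; rewrite bounceE // ?inE; lia.
have b3 : bounce n.+1 (3 * n.+1) = n.+1 by apply/eqP; rewrite bounceE // ?inE; lia.
move: tc Ex Ey tt'; rewrite !inE => /or4P[] /eqP ->; rewrite ?b0 ?b1 ?b2 ?b3 bounceE // !inE.
- case/andP=> _ /or3P[] /eqP ->; rewrite ?subn0 ?addn0 ?eqxx //; by rewrite eq_sym (negbTE y0).
- have -> : 2 * n.+1 - n.+1 = n.+1 by lia.
  have -> : 2 * n.+1 + n.+1 = 3 * n.+1 by lia.
  case/andP=> _ /or3P[] /eqP ->; rewrite ?eqxx //; by rewrite eq_sym (negbTE yN).
- case/andP=> _ /or3P[] /eqP ->; rewrite ?subn0 ?addn0 ?eqxx //; by rewrite (negbTE y0).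
- have -> : 2 * n.+1 - n.+1 = n.+1 by lia.
  have -> : 2 * n.+1 + n.+1 = 3 * n.+1 by lia.
  case/andP=> _ /or3P[] /eqP ->; rewrite ?eqxx //; by rewrite (negbTE yN).
Qed.

Lemma strand_passages r :
  strand r (start (n %% 3 == 0)) (zip (iota 1 n) (alt false w)) =
  [seq passage w t | t <- [seq ptime r x | x <- iota 1 n] & other_times n t != [::]].
Proof.
have := strand_alt (n %% 3 == 0) r 0 w; rewrite size_tuple => ->.
have -> : [seq passage w t | t <- [seq ptime r x | x <- iota 1 n] & other_times n t != [::]] =
  flatten [seq if other_times n (ptime r x) != [::] then [:: passage w (ptime r x)] else [::]
          | x <- iota 1 n].
  by elim: (iota 1 n) => //= x l IH; case: ifP => _ /=; rewrite IH.
congr flatten; apply/eq_in_map => x; rewrite mem_iota add1n ltnS => xn.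
by rewrite subn1 passage_letter.
Qed.

Lemma billiard_code :
  billiard_diagram w = code (start (n %% 3 == 0)) (zip (iota 1 n) (alt false w)).
Proof.
rewrite /billiard_diagram /times last_time /code !strand_passages.
have -> : iota 0 (3 * n.+1).+1 = [:: 0] ++ [seq ptime roleU x | x <- iota 1 n] ++ [:: n.+1] ++
    rev [seq ptime roleQ x | x <- iota 1 n] ++ [:: 2 * n.+1] ++
    [seq ptime roleR x | x <- iota 1 n] ++ [:: 3 * n.+1].
  have -> : [seq ptime roleU x | x <- iota 1 n] = iota 1 n by rewrite /= map_id.
  have -> : rev [seq ptime roleQ x | x <- iota 1 n] = iota n.+2 n.
    apply: (@eq_from_nth _ 0); rewrite size_rev size_map !size_iota // => i lt_i.
    rewrite nth_rev size_map size_iota // (nth_map 0) ?size_iota; last by lia.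
    by rewrite !nth_iota /=; lia.
  have -> : [seq ptime roleR x | x <- iota 1 n] = iota (2 * n.+1).+1 n.
    apply: (@eq_from_nth _ 0); rewrite size_map !size_iota // => i lt_i.
    by rewrite (nth_map 0) ?size_iota // !nth_iota //=; lia.
  have -> : (3 * n.+1).+1 = 1 + (n + (1 + (n + (1 + (n + 1))))) by lia.
  have i1 k : iota k 1 = [:: k] by [].
  rewrite !iotaD !i1; congr (_ ++ (_ ++ (_ ++ (_ ++ (_ ++ (_ ++ _))))));
    first [by [] | congr [:: _]; lia | congr iota; lia].
rewrite !filter_cat !map_cat !filter_rev !map_rev.
have corner t : t \in [:: 0; n.+1; 2 * n.+1; 3 * n.+1] ->
    [seq t' <- [:: t] | other_times n t' != [::]] = [::].
  by move=> tc; rewrite /= corner_times.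
by rewrite !corner ?inE ?eqxx ?orbT //= cats0.
Qed.

Lemma billiard_bplat : same_knot (billiard_diagram w) (bplat w).
Proof.
rewrite billiard_code /bplat size_tuple.
have snd_zip : map snd (zip (iota 1 n) (alt false w)) = alt false w.
  by rewrite -/unzip2 unzip2_zip // size_alt size_tuple size_iota.
rewrite -[X in plat _ X]snd_zip; apply: code_plat.
  by rewrite /tnames -/unzip1 unzip1_zip ?iota_uniq // size_alt size_tuple size_iota.
have := @wvalid_alt w; rewrite size_tuple valid_wvalid snd_zip; exact.
Qed.

End BilliardCode.

(** * Counting *)

(** Words grow at their last letter, which is the one that [red] processes last. *)
Fixpoint bitseqs (n : nat) : seq (seq bool) :=
  if n is n'.+1 then [seq rcons w false | w <- bitseqs n'] ++ [seq rcons w true | w <- bitseqs n']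
  else [:: [::]].

Lemma mem_bitseqs n w : (w \in bitseqs n) = (size w == n).
Proof.
elim: n w => [|n IH] w /=; first by rewrite inE; case: w.
rewrite mem_cat; case/lastP: w => [|w x].
  by apply/negP => /orP[] /mapP[[|? ?]].
rewrite size_rcons eqSS -IH; apply/orP/idP => [[] /mapP[v vn /rcons_inj[-> _]] //|wn].
by case: x; [right|left]; apply: map_f.
Qed.

Lemma uniq_bitseqs n : uniq (bitseqs n).
Proof.
elim: n => //= n IH; rewrite cat_uniq !map_inj_uniq ?IH ?andbT //=;
  try by move=> v w /rcons_inj[].
by apply/hasPn => _ /mapP[v _ ->]; apply/negP => /mapP[u _ /rcons_inj[]].
Qed.

Lemma card_bitseqs n (P : pred (seq bool)) :
  #|[pred w : n.-tuple bool | P w]| = count P (bitseqs n).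
Proof.
have pe : perm_eq [seq val w | w <- enum {: n.-tuple bool}] (bitseqs n).
  apply: uniq_perm; [|exact: uniq_bitseqs|].
    by rewrite (map_inj_uniq val_inj) enum_uniq.
  move=> w; rewrite mem_bitseqs; apply/mapP/eqP => [[v _ ->]|sz]; first exact: size_tuple.
  by exists (tcast sz (in_tuple w)); rewrite ?mem_enum // /= val_tcast.
by rewrite -(permP pe) count_map cardE size_filter -enumT.
Qed.

Lemma count_bitseqsS n P :
  count P (bitseqs n.+1) = count (fun w => P (rcons w false)) (bitseqs n) +
                           count (fun w => P (rcons w true)) (bitseqs n).
Proof. by rewrite /= count_cat !count_map. Qed.

Definition red_count n g := count (fun w => red w == g) (bitseqs n).

Lemma red_rcons w x : red (rcons w x) = push (red w) x.
Proof. by rewrite /red foldl_rcons. Qed.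

Lemma red_count_nil n : red_count n.+1 [::] = red_count n [:: false; false] + red_count n [:: true; true].
Proof.
rewrite /red_count count_bitseqsS; congr (_ + _); apply: eq_count => w; rewrite red_rcons;
  by case: (red w) => [|[] [|[] [|? ?]]].
Qed.

(** A last letter [a] has been put on top of [g], since a deletion would require three letters [a]
    on the stack; a last letter [~~ a] must have completed a triple. *)
Lemma red_count_cons n a g : no3 (a :: g) ->
  red_count n.+1 (a :: g) = red_count n g + red_count n [:: ~~ a, ~~ a, a & g].
Proof.
move=> n3; rewrite /red_count count_bitseqsS.
have same w : (push (red w) a == a :: g) = (red w == g).
  have := no3_red w; move: (red w) => st nst; apply/eqP/eqP => [|->].
    case: st nst => [|y [|z st]] /=; try by move=> _ [].
    case: ifP => [/andP[/eqP <- /eqP <-] + E|_ _ [] //].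
    by rewrite E /= !eqxx.
  by move: n3; case: g => [|y [|z g]] //=; case: ifP.
have diff w : (push (red w) (~~ a) == a :: g) = (red w == [:: ~~ a, ~~ a, a & g]).
  move: (red w) => st; apply/eqP/eqP => [|->]; last by rewrite /= eqxx.
  case: st => [|y [|z st]] /=; try by case: (a).
  by case: ifP => [/andP[/eqP <- /eqP <-] ->|_ []] //; case: (a).
have E x : count (fun w => red (rcons w x) == a :: g) (bitseqs n) =
    count (fun w => push (red w) x == a :: g) (bitseqs n).
  by apply: eq_count => w; rewrite red_rcons.
rewrite !E -(eq_count same) -(eq_count diff); case: (a) => //; exact: addnC.
Qed.

(** * Ballot numbers *)

Section ClosedForms.
Local Open Scope ring_scope.

Definition binr (n m : nat) : rat := 'C(n, m)%:R.
Definition binr_lt (n m : nat) : rat := \sum_(i < m) binr n i.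
(** For n = 3m + l this will be the number of words of length n that reduce to a given word of
    length l, where m is the number of deleted triples. It counts paths with steps +1 and -2, hence
    the name. *)
Definition ballot (n m : nat) : rat := binr n m - binr_lt n m.

Lemma binr_ltS n m : binr_lt n m.+1 = binr_lt n m + binr n m.
Proof. by rewrite /binr_lt big_ord_recr. Qed.

Lemma binrS n m : binr n.+1 m.+1 = binr n m.+1 + binr n m.
Proof. by rewrite /binr binS natrD. Qed.

Lemma binr0 n : binr n 0 = 1.
Proof. by rewrite /binr bin0. Qed.

Lemma binr_lt0 n : binr_lt n 0 = 0.
Proof. by rewrite /binr_lt big_ord0. Qed.

Lemma binr_ltSS n m : binr_lt n.+1 m.+1 = binr_lt n m.+1 + binr_lt n m.
Proof.
elim: m => [|m IH]; first by rewrite !binr_ltS !binr_lt0 !binr0 !add0r addr0.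
by rewrite binr_ltS IH binrS (binr_ltS n m.+1) (binr_ltS n m); ring.
Qed.

Lemma ballotS n m : ballot n.+1 m.+1 = ballot n m.+1 + ballot n m.
Proof. by rewrite /ballot binrS binr_ltSS; ring. Qed.

Lemma ballot0 n : ballot n 0 = 1.
Proof. by rewrite /ballot binr0 binr_lt0 subr0. Qed.

Lemma binr_step n m : (m.+1)%:R * binr n m.+1 = (n%:R - m%:R) * binr n m.
Proof.
have [le|lt] := leqP m n.
  by rewrite -natrB // /binr -!natrM mul_bin_left.
by rewrite /binr !bin_small ?mulr0 // ltnW.
Qed.

(** The boundary condition at the empty word, reached only from the two words of two equal letters.
    Besides Pascal's rule it uses that C(n, m + 1) is twice C(n, m) for n = 3m + 2. *)
Lemma ballot_wall m : ballot (3 * m.+1) m.+1 = 2 * ballot (3 * m.+1).-1 m.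
Proof.
have E : (3 * m.+1)%N = (3 * m.+1).-1.+1 by lia.
rewrite {1}E ballotS; set n := (3 * m.+1).-1.
have H : binr n m.+1 = 2 * binr n m.
  apply: (mulfI (x := (m.+1)%:R)); first by rewrite pnatr_eq0.
  have nE : n%:R = 3 * m%:R + 2 :> rat.
    have -> : n = (3 * m + 2)%N by rewrite /n; lia.
    by rewrite natrD natrM.
  by rewrite binr_step nE -natr1; ring.
by rewrite /ballot H binr_ltS; ring.
Qed.

Definition red_val (n l : nat) : rat :=
  if (l <= n)%N && (3 %| n - l)%N then ballot n ((n - l) %/ 3) else 0.

Lemma red_val_small n l : (n < l)%N -> red_val n l = 0.
Proof. by rewrite /red_val ltnNge => /negbTE ->. Qed.

Lemma red_valE m l : red_val (3 * m + l) l = ballot (3 * m + l) m.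
Proof. by rewrite /red_val leq_addl addnK dvdn_mulr // mulKn. Qed.

Lemma red_val_ndiv n l : (l <= n)%N -> ~~ (3 %| n - l)%N -> red_val n l = 0.
Proof. by rewrite /red_val => _ /negbTE ->; rewrite andbF. Qed.

Lemma red_val_cases n l : [\/ (n < l)%N, exists m, n = (3 * m + l)%N | (l <= n)%N /\ ~~ (3 %| n - l)%N].
Proof.
have [le|lt] := leqP l n; last by constructor 1.
case: (boolP (3 %| n - l)%N) => [/dvdnP[m E]|nd]; last by constructor 3.
by constructor 2; exists m; lia.
Qed.

Lemma red_valS n l : red_val n.+1 l.+1 = red_val n l + red_val n l.+3.
Proof.
have [lt|[m E]|[le nd]] := red_val_cases n l.
- by rewrite !red_val_small ?addr0 //; lia.
- rewrite E red_valE -addnS red_valE; case: m {E} => [|m].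
    by rewrite !ballot0 red_val_small ?addr0 //; lia.
  have -> : (3 * m.+1 + l.+1)%N = (3 * m + l.+3).+1 by lia.
  have -> : (3 * m.+1 + l)%N = (3 * m + l.+3)%N by lia.
  by rewrite red_valE ballotS.
rewrite (@red_val_ndiv n.+1 l.+1) // (@red_val_ndiv n l) // add0r.
have [le3|lt3] := leqP l.+3 n.
  by rewrite red_val_ndiv //; move: nd; lia.
by rewrite red_val_small.
Qed.

Lemma red_val0 n : red_val n.+1 0 = 2 * red_val n 2.
Proof.
have [lt|[m E]|[le nd]] := red_val_cases n.+1 0 => //.
  case: m E => // m E; rewrite E red_valE addn0 ballot_wall.
  have -> : (3 * m.+1).-1 = (3 * m + 2)%N by lia.
  have -> : n = (3 * m + 2)%N by lia.
  by rewrite red_valE.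
rewrite red_val_ndiv //; have [le3|lt3] := leqP 2 n.
  by rewrite red_val_ndiv ?mulr0 //; move: nd; lia.
by rewrite red_val_small ?mulr0.
Qed.

Lemma red_countE n g : no3 g -> (red_count n g)%:R = red_val n (size g).
Proof.
elim: n g => [|n IH] [|a g] n3 //.
- by rewrite /red_count /= (red_valE 0 0) ballot0.
- by rewrite red_count_nil natrD !IH //= red_val0; ring.
have n3g : no3 g by apply: (@no3_suffix [:: a]).
have n3' : no3 [:: ~~ a, ~~ a, a & g].
  by move: n3 => /= ->; case: (a) (g) => [] [|? ?].
by rewrite red_count_cons // natrD !IH //= red_valS.
Qed.

End ClosedForms.

(* The prefixes that [trim] removes from a word without three equal
   consecutive letters. *)
Definition ext (y : bool) (i : nat) : seq bool := flatten (nseq i [:: y; y; ~~ y]).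
Definition exts (n : nat) : seq (seq bool) :=
  [::] :: [seq ext false i | i <- iota 1 n] ++ [seq ext true i | i <- iota 1 n].

Lemma size_ext y i : size (ext y i) = 3 * i.
Proof. by elim: i => //= i IH; rewrite -/(ext y i) /= IH; lia. Qed.

Lemma ext_inj y : injective (ext y).
Proof. by move=> i j /(congr1 size); rewrite !size_ext; lia. Qed.

Lemma uniq_exts n : uniq (exts n).
Proof.
have nil_notin y : [::] \notin [seq ext y i | i <- iota 1 n].
  by apply/mapP => -[[|i]]; rewrite mem_iota.
rewrite /= mem_cat negb_or !nil_notin cat_uniq !map_inj_uniq ?iota_uniq ?andbT //=;
  try exact: ext_inj.
apply/hasPn => _ /mapP[[|i] + ->]; rewrite mem_iota // => _.
by apply/mapP => -[[|j]]; rewrite mem_iota.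
Qed.

Definition head_single (t : seq bool) := (1 < size t) && (nth false t 0 != nth false t 1).

Lemma trim_ext y i t : head_single t -> trim (ext y i ++ t) = t.
Proof.
case: t => [|a [|b t]] //; rewrite /head_single /= => /negbTE ab.
elim: i => [|i IH]; last by rewrite /= eqxx.
by case: (t) => //= z t'; rewrite ab.
Qed.

Lemma no3_ext y i t : no3 t -> head_single t -> no3 (ext y i ++ t).
Proof.
move=> nt ht; elim: i => //= i; rewrite -/(ext y i).
case: i => [|i]; last by rewrite /= !eqxx; case: (y) => /= ->.
move: ht nt; case: t => [|a [|b t]] //; rewrite /head_single /=.
by case: y a b => [] [] [] //= _ ->.
Qed.

(** Without three equal letters in a row, a removed prefix [x x z] has [z = ~~ x], and the next one
    must start with [x] again. So all that is removed is determined by its first letter and its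
    length. *)
Lemma trim_inv u : no3 u -> 2 < size (trim u) ->
  exists y i, u = ext y i ++ trim u /\ 3 * i + size (trim u) = size u.
Proof.
have [n] := ubnP (size u); elim: n u => // n IH [|x [|y [|z u]]] lt_n n3 //.
rewrite [trim _]/=; case: eqP => [xy|_ _]; last by exists x, 0.
move=> lt2; have n3u : no3 u by apply: (@no3_suffix [:: x; y; z]).
have lt_u : size u < n by move: lt_n => /=; lia.
have [y' [i [Eu Es]]] := IH u lt_u n3u lt2.
have zx : z = ~~ x by move: n3; rewrite -xy /= eqxx; case: (x) (z) => [] [].
case: i Eu Es => [|i] Eu Es.
  by exists x, 1; split; [rewrite {1}Eu -xy zx|rewrite /=; lia].
have yy : y' = x.
  by move: n3; rewrite {1}Eu -xy zx /=; case: (x) (y') => [] [].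
exists x, i.+2; split; last by rewrite /=; lia.
by rewrite {1}Eu yy -xy zx.
Qed.

(** At most one prefix fits. In this form the condition on the core can be exchanged with the sum
    over all words. *)
Lemma trim_sum n u t : no3 u -> size u <= n -> head_single t -> 2 < size t ->
  (trim u == t : nat) = \sum_(e <- exts n) (u == e ++ t).
Proof.
move=> n3 sz ht lt2.
have trimE e : e \in exts n -> trim (e ++ t) = t.
  rewrite /exts inE mem_cat => /orP[/eqP ->|]; first exact: (@trim_ext false 0).
  by case/orP=> /mapP[i _ ->]; apply: trim_ext.
have [Et|ne] := eqVneq (trim u) t; last first.
  rewrite big_seq big1 // => e /trimE E; case: eqP => // Eu.
  by rewrite Eu E eqxx in ne.
have [|y [i [Eu Es]]] := trim_inv n3; first by rewrite Et.
rewrite Et in Eu Es.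
have e_in : ext y i \in exts n.
  rewrite /exts inE mem_cat; case: i Eu Es => [|i] Eu Es; first by rewrite eqxx.
  have lt_i : i.+1 \in iota 1 n by rewrite mem_iota; lia.
  by case: y {Eu}; rewrite map_f ?orbT.
rewrite (bigD1_seq (ext y i)) ?uniq_exts //= -Eu eqxx big1 // => e ne.
case: eqP => // E; case/eqP: ne; move: E; rewrite Eu => /eqP.
have [se|] := eqVneq (size (ext y i)) (size e).
  by rewrite eqseq_cat // => /andP[/eqP ->].
by move=> se /eqP /(congr1 size); rewrite !size_cat => E; move: se; rewrite -(eqn_add2r (size t)) E eqxx.
Qed.

Lemma size_push st x : size (push st x) <= (size st).+1.
Proof. by case: st => [|y [|z st]] //=; case: ifP => //= _; lia. Qed.

Lemma size_red w : size (red w) <= size w.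
Proof.
elim/last_ind: w => // w x IH; rewrite red_rcons size_rcons.
exact: leq_trans (size_push _ _) _.
Qed.

Lemma size_trim w : size (trim w) <= size w.
Proof. by have [u E] := trim_suffix w; rewrite {2}E size_cat leq_addl. Qed.

Lemma core_ok_ext r y i : core_ok r -> let t := rev (ext y i ++ r) in
  [/\ no3 t, head_single t & 2 < size t].
Proof.
case/and4P=> lt2 n3 ls hd t; have hr : head_single r by rewrite /head_single ltnW.
split; last by rewrite size_rev size_cat; apply: leq_trans lt2 (leq_addl _ _).
  by rewrite no3_rev no3_ext.
rewrite /head_single size_rev size_cat (leq_trans (ltnW lt2)) ?leq_addl //=.
have ->: t = rev r ++ rev (ext y i) by rewrite /t rev_cat.
rewrite -[r]revK in lt2 ls *; move: (rev r) lt2 ls => q; rewrite revK.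
case: q => [|a [|b q]] // _ /last_singleP H /=; apply/eqP => E.
by apply: (H (rev q) a); rewrite E !rev_cons -!cats1 -catA.
Qed.

Definition core_count n r := count (fun w => core w == r) (bitseqs n).

(** Here [e2] is what was trimmed from the left end of the reduced word and [e1] what was trimmed
    from its right end. *)
Lemma core_countE n r : core_ok r ->
  core_count n r = \sum_(e2 <- exts n) \sum_(e1 <- exts n) red_count n (e1 ++ rev (e2 ++ r)).
Proof.
move=> okr; have /and4P[lt2 n3 ls hd] := okr.
have hr : head_single r by rewrite /head_single ltnW.
rewrite /core_count -sum1_count big_mkcond /=.
have step w : w \in bitseqs n -> (core w == r : nat) =
    \sum_(e2 <- exts n) \sum_(e1 <- exts n) (red w == e1 ++ rev (e2 ++ r)).
  rewrite mem_bitseqs => /eqP sw.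
  have n3t : no3 (trim (red w)).
    by have [u E] := trim_suffix (red w); apply: (@no3_suffix u); rewrite -E no3_red.
  rewrite /core (@trim_sum n) ?no3_rev //; last first.
    by rewrite size_rev (leq_trans (size_trim _)) // -sw size_red.
  apply: eq_big_seq => e2 e2in; rewrite -(inj_eq (can_inj revK)) revK.
  have [y [i ->]] : exists y i, e2 = ext y i.
    move: e2in; rewrite /exts inE mem_cat => /orP[/eqP ->|]; first by exists false, 0.
    by case/orP=> /mapP[i _ ->]; [exists false, i|exists true, i].
  have [n3' h' l'] := core_ok_ext y i okr.
  by rewrite (@trim_sum n) ?no3_red // -sw size_red.
rewrite (eq_big_seq (fun w => \sum_(e2 <- exts n) \sum_(e1 <- exts n)
    (red w == e1 ++ rev (e2 ++ r)))); last first.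
  by move=> w win; rewrite -step //; case: eqP.
rewrite exchange_big; apply: eq_bigr => e2 _; rewrite exchange_big; apply: eq_bigr => e1 _.
by rewrite /red_count -sum1_count [RHS]big_mkcond; apply: eq_bigr => w _; case: eqP.
Qed.

(** * The number of words with a given core *)

Section CoreValue.
Local Open Scope ring_scope.

Lemma sum_exts n (f : nat -> rat) :
  \sum_(e <- exts n) f (size e) = f 0%N + \sum_(1 <= i < n.+1) 2 * f (3 * i)%N.
Proof.
rewrite /exts big_cons big_cat !big_map /=; congr (_ + _).
rewrite /index_iota subSS subn0 -big_split; apply: eq_bigr => i _ /=.
by rewrite !size_ext; ring.
Qed.

(* There is one extension of length 0 and there are two of every length 3 i > 0. *)
Definition spill (f : nat -> rat) (m : nat) : rat := f m + 2 * \sum_(i < m) f i.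

Lemma spillS f m : spill f m.+1 = spill f m + f m.+1 + f m.
Proof. by rewrite /spill big_ord_recr /=; ring. Qed.

Lemma spill0 f : spill f 0 = f 0%N.
Proof. by rewrite /spill big_ord0 mulr0 addr0. Qed.

Lemma sum_exts_spill n l m (f g : nat -> rat) : n = (3 * m + l)%N ->
  (forall k, (n < k)%N -> g k = 0) -> (forall i, (i <= m)%N -> g (l + 3 * (m - i))%N = f i) ->
  \sum_(e <- exts n) g (l + size e)%N = spill f m.
Proof.
move=> nE gz gf; rewrite (sum_exts n (fun k => g (l + k)%N)) addn0 /spill.
congr (_ + _); first by rewrite -(gf m) // subnn muln0 addn0.
have mn : (m.+1 <= n.+1)%N by lia.
have tail0 : \sum_(m.+1 <= i < n.+1) 2 * g (l + 3 * i)%N = 0.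
  by rewrite big_nat; apply: big1 => i /andP[mi _]; rewrite gz ?mulr0 //; lia.
rewrite (@big_cat_nat _ _ _ m.+1 1) //= tail0 addr0.
rewrite -mulr_sumr; congr (2 * _); rewrite big_nat_rev /= big_add1 /= big_mkord.
apply: eq_bigr => i _; rewrite -gf; last by apply: ltnW.
by congr g; have := ltn_ord i; lia.
Qed.

Definition core_val (n l : nat) : rat :=
  \sum_(e2 <- exts n) \sum_(e1 <- exts n) red_val n (l + size e2 + size e1).

Lemma core_count_val n r : core_ok r -> (core_count n r)%:R = core_val n (size r).
Proof.
move=> okr; rewrite core_countE // natr_sum; apply: eq_big_seq => e2 e2in.
have [y [i Ee]] : exists y i, e2 = ext y i.
  move: e2in; rewrite /exts inE mem_cat => /orP[/eqP ->|]; first by exists false, 0%N.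
  by case/orP=> /mapP[i _ ->]; [exists false, i|exists true, i].
have [n3' h' l'] := core_ok_ext y i okr; rewrite -Ee in n3' h' l'.
rewrite natr_sum; apply: eq_big_seq => e1 e1in; rewrite red_countE; last first.
  move: e1in; rewrite /exts inE mem_cat => /orP[/eqP -> //|].
  by case/orP=> /mapP[j _ ->]; apply: no3_ext.
by rewrite size_cat size_rev size_cat; congr red_val; lia.
Qed.

(** There is one [spill] for each end of the word: three more letters before trimming mean one
    deleted triple fewer, at the same length n. *)
Lemma core_valE m l : core_val (3 * m + l) l = spill (spill (ballot (3 * m + l))) m.
Proof.
pose g k := \sum_(e1 <- exts (3 * m + l)) red_val (3 * m + l) (k + size e1).
apply: (@sum_exts_spill _ l m (spill (ballot (3 * m + l))) g) => //.
  by move=> k lt; rewrite /g big1 // => e _; rewrite red_val_small //; lia.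
move=> i im; rewrite /g; apply: sum_exts_spill; first by lia.
  by move=> k lt; rewrite red_val_small.
move=> j ji.
have E : (3 * m + l = 3 * j + (l + 3 * (m - i) + 3 * (i - j)))%N by lia.
by rewrite {1}E red_valE -E.
Qed.

Lemma core_val_small n l : (n < l)%N -> core_val n l = 0.
Proof.
move=> lt; rewrite /core_val big1 // => e2 _; rewrite big1 // => e1 _.
by rewrite red_val_small //; lia.
Qed.

Lemma size_exts n e : e \in exts n -> exists i, size e = (3 * i)%N.
Proof.
rewrite /exts inE mem_cat => /orP[/eqP ->|]; first by exists 0%N.
by case/orP=> /mapP[i _ ->]; exists i; rewrite size_ext.
Qed.

Lemma core_val_ndiv n l : (n != l %[mod 3])%N -> core_val n l = 0.
Proof.
move=> nd; rewrite /core_val big_seq big1 // => e2 /size_exts[i ->].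
rewrite big_seq big1 // => e1 /size_exts[j ->].
have [lt|[m E]|[le ndiv]] := red_val_cases n (l + 3 * i + 3 * j).
- exact: red_val_small.
- by exfalso; move: nd; lia.
- exact: red_val_ndiv.
Qed.

(** This reduces an identity to [ring] or [field] modulo one relation [z = 0] between binomial
    coefficients. *)
Lemma eq_mod_zero (x y z : rat) : z = 0 -> x - y = z -> x = y.
Proof. by move=> -> /eqP; rewrite subr_eq0 => /eqP. Qed.

Lemma spill_ballot n m :
  spill (ballot n) m = (1 - m%:R) * binr n m + (n%:R + 3 - 2 * m%:R) * binr_lt n m.
Proof.
elim: m => [|m IH]; first by rewrite spill0 ballot0 binr0 binr_lt0; ring.
have := binr_step n m; rewrite spillS IH /ballot binr_ltS -natr1 => E.
apply: (@eq_mod_zero _ _ ((m%:R + 1) * binr n m.+1 - (n%:R - m%:R) * binr n m)).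
  by rewrite E subrr.
ring.
Qed.

Lemma spill_spill_ballot n m : spill (spill (ballot n)) m =
  ((n%:R + 5) * m%:R - 2 * m%:R ^+ 2 + 2) / 2 * binr n m
  - (4 * m%:R ^+ 2 - 4 * n%:R * m%:R + n%:R ^+ 2 - 12 * m%:R + 7 * n%:R + 2) / 2 * binr_lt n m.
Proof.
elim: m => [|m IH].
  by rewrite spill0 spill_ballot binr0 binr_lt0; field.
have := binr_step n m; rewrite spillS IH !spill_ballot binr_ltS -natr1 => E.
(* The difference of the two sides is exactly this multiple of [binr_step]. *)
apply: (@eq_mod_zero _ _ (- (n%:R + 5 - 2 * m%:R) / 2 *
    ((m%:R + 1) * binr n m.+1 - (n%:R - m%:R) * binr n m))).
  by rewrite E subrr mulr0.
by field.
Qed.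

Lemma core_val_F m l : core_val (3 * m + l) l = F m%:Z l.
Proof.
rewrite core_valE spill_spill_ballot /F.
have -> : absz (3 * m%:Z + l%:Z) = (3 * m + l)%N by lia.
rewrite /binz /binz_lt -/(binr (3 * m + l) m).
have -> : (\sum_(i < m) 'C(3 * m + l, i))%:R = binr_lt (3 * m + l) m.
  by rewrite natr_sum.
have -> : (m%:Z%:~R : rat) = m%:R by [].
by rewrite natrD natrM; field.
Qed.

End CoreValue.

(** * Enumeration of the cores *)

Fixpoint build (x : bool) (ds : seq bool) : seq bool :=
  if ds is d :: ds' then (if d then [:: x; x] else [:: x]) ++ build (~~ x) ds' else [:: x].

(** The first and the last block have one letter; [ds] tells which of the blocks in between have
    two. As the blocks alternate, nothing but the first letter remains to be chosen. *)
Definition core_of (x : bool) (ds : seq bool) := x :: build (~~ x) ds.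

Lemma build_head x ds : exists t, build x ds = x :: t.
Proof. by case: ds => [|[] ds]; eexists. Qed.

Lemma size_build x ds : size (build x ds) = (size ds).+1 + count id ds.
Proof. by elim: ds x => // d ds IH x; rewrite /= size_cat IH; case: d => /=; lia. Qed.

Lemma build_spec x ds : [/\ no3 (build x ds), last_single (build x ds) &
  forall h, size (heights h (build x ds)) = (size ds).+1].
Proof.
elim: ds x => [|d ds IH] x //; have [n3 ls hs] := IH (~~ x); have [t Et] := build_head (~~ x) ds.
have nx : (x == ~~ x) = false by case: (x).
rewrite /= Et in n3 ls hs *; case: d; split.
- by rewrite -[no3 _]/(~~ ((x == x) && (x == ~~ x)) && (no3 [:: x, ~~ x & t])) nx andbF /= nx;
    move: n3 => /= ->; case: (t).
- by move: ls; case: (t) => [|a [|? ?]] //=; case: (x).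
- by move=> h; rewrite /= eqxx /= hs.
- by move: n3; rewrite /= nx => ->; case: (t).
- by move: ls; case: (t) => //=; case: (x).
- by move=> h; rewrite -[heights h _]/(if x == ~~ x then ~~ h :: heights (~~ h) t
    else h :: heights (~~ h) (~~ x :: t)) nx /= hs.
Qed.

Lemma build_surj x w : no3 (x :: w) -> last_single (x :: w) -> exists ds, x :: w = build x ds.
Proof.
have [n] := ubnP (size w); elim: n x w => // n IH x [|y w] lt_n n3 ls; first by exists [::].
have [xy|nxy] := eqVneq x y.
  subst y; case: w lt_n n3 ls => [|z w] lt_n n3 ls; first by move: ls => /=; rewrite eqxx.
  have zx : z = ~~ x by move: n3 => /=; rewrite eqxx; case: (x) (z) => [] [].
  have [|||ds Eds] := IH z w.
  - by move: lt_n => /=; lia.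
  - exact: (@no3_suffix [:: x; x]).
  - exact: (@last_single_suffix [:: x; x]).
  by exists (true :: ds); rewrite /= -zx -Eds.
have yx : y = ~~ x by move: nxy; case: (x) (y) => [] [].
have [|||ds Eds] := IH y w.
- by move: lt_n => /=; lia.
- exact: (@no3_suffix [:: x]).
- exact: (@last_single_suffix [:: x]).
by exists (false :: ds); rewrite /= -yx -Eds.
Qed.

Lemma build_inj x : injective (build x).
Proof.
move=> ds ds'; elim: ds ds' x => [|d ds IH] [|d' ds'] x //=.
- by have [t ->] := build_head (~~ x) ds'; case: d'.
- by have [t ->] := build_head (~~ x) ds; case: d.
have [t Et] := build_head (~~ x) ds; have [t' Et'] := build_head (~~ x) ds'.
case: d d' => [] [] /=.
- by case=> /IH ->.
- by rewrite Et' => -[]; case: (x).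
- by rewrite Et => -[]; case: (x).
- by case=> /IH ->.
Qed.

Definition cores (c : nat) : seq (seq bool) :=
  [seq core_of false ds | ds <- bitseqs (c - 2)] ++ [seq core_of true ds | ds <- bitseqs (c - 2)].

Lemma uniq_cores c : uniq (cores c).
Proof.
have inj x : injective (core_of x) by move=> ds ds' [/build_inj].
rewrite cat_uniq !map_inj_uniq ?uniq_bitseqs //= andbT.
by apply/hasPn => _ /mapP[ds _ ->]; apply/mapP => -[].
Qed.

Lemma blocks_core_of x ds : blocks (core_of x ds) = (size ds).+2.
Proof.
rewrite /blocks /core_of; have [_ _ hs] := build_spec (~~ x) ds.
have [t Et] := build_head (~~ x) ds; rewrite Et in hs *.
have nx : (x == ~~ x) = false by case: (x).
by rewrite -[heights _ _]/(if x == ~~ x then true :: heights true t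
    else false :: heights true (~~ x :: t)) nx /= hs.
Qed.

Lemma mem_cores c r : 2 < c -> (r \in cores c) = core_ok r && (blocks r == c).
Proof.
move=> c3; have mem x ds : ds \in bitseqs (c - 2) -> core_ok (core_of x ds) && (blocks (core_of x ds) == c).
  rewrite mem_bitseqs => /eqP sz; rewrite blocks_core_of sz; apply/andP; split; last by apply/eqP; lia.
  have [n3 ls hs] := build_spec (~~ x) ds; have [t Et] := build_head (~~ x) ds.
  have st := size_build (~~ x) ds; rewrite Et /= in st n3 ls.
  have nx : (x == ~~ x) = false by case: (x).
  rewrite /core_of Et; apply/and4P; split => //=; last by rewrite nx.
  - by rewrite st sz; lia.
  - by rewrite n3 nx; case: (t).
  - by case: (t) ls => //=; rewrite nx.
apply/idP/idP => [|/andP[/and4P[lt2 n3 ls hd] /eqP bl]].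
  by rewrite mem_cat => /orP[] /mapP[ds dsin ->]; apply: mem.
case: r lt2 n3 ls hd bl => [|x [|y r]] // lt2 n3 ls hd bl.
have yx : y = ~~ x by move: hd => /=; case: (x) (y) => [] [].
have [ds Eds] := build_surj (@no3_suffix [:: x] _ n3) (@last_single_suffix [:: x] _ ls).
have E : [:: x, y & r] = core_of x ds by rewrite /core_of Eds yx.
rewrite E in bl *; rewrite blocks_core_of in bl.
have dsin : ds \in bitseqs (c - 2) by rewrite mem_bitseqs -bl subn2.
by rewrite mem_cat; case: (x); rewrite map_f ?orbT.
Qed.

Lemma count_mem_sum (T : Type) (U : eqType) (f : T -> U) (l : seq T) (s : seq U) : uniq s ->
  count (fun w => f w \in s) l = \sum_(r <- s) count (fun w => f w == r) l.
Proof.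
elim: s => [|r s IH]; first by rewrite big_nil => _; rewrite (eq_count (a2 := pred0)) ?count_pred0.
case/andP=> rs us; rewrite big_cons -IH // -count_predUI.
rewrite [X in _ + X](eq_count (a2 := pred0)) ?count_pred0 ?addn0.
  by apply: eq_count => w; rewrite inE.
by move=> w /=; case: eqP => //= ->; rewrite (negbTE rs).
Qed.

Local Open Scope ring_scope.

Lemma sum_bitseqs m (f : nat -> rat) :
  \sum_(ds <- bitseqs m) f (count id ds) = \sum_(k < m.+1) 'C(m, k)%:R * f k.
Proof.
elim: m f => [|m IH] f; first by rewrite big_seq1 big_ord1 bin0 mul1r.
rewrite [bitseqs _]/= big_cat !big_map /=.
under eq_bigr => ds _ do rewrite -cats1 count_cat /= addn0 addn0.
under [X in _ + X]eq_bigr => ds _ do rewrite -cats1 count_cat /= addn0 addn1.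
rewrite IH (IH (fun k => f k.+1)).
rewrite [RHS]big_ord_recl [X in X + _ = _]big_ord_recl /= !bin0 -addrA; congr (_ + _).
under [RHS]eq_bigr => k _ do rewrite /bump /= add1n binS natrD mulrDl.
rewrite big_split /=; congr (_ + _); rewrite [RHS]big_ord_recr /= bin_small // mul0r addr0.
by apply: eq_bigr => k _.
Qed.

Theorem theorem5p1 (n c : nat)
    (n_gt0 : (0 < n)%N)
    (n_mod3 : (n %% 3 = 0)%N \/ (n %% 3 = 1)%N)
    (c_range : (3 <= c <= n)%N) :
  uniform_prob (fun w : n.-tuple bool =>
    crossing_number (billiard_diagram w) = c)
  = \sum_(k < (c - 2).+1 | (c + k == n %[mod 3])%N)
      'C(c - 2, k)%:R / 2 ^+ (n - 1) *
      F ((n%:Z - c%:Z - k%:Z) %/ 3)%Z (c + k).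
Proof.
have n3 : (n %% 3 != 2)%N by case: n_mod3 => ->.
case/andP: c_range => c3 _.
have E : #|[pred w : n.-tuple bool | `[< crossing_number (billiard_diagram w) = c >]]| =
    (\sum_(r <- cores c) core_count n r)%N.
  rewrite -(count_mem_sum core _ (uniq_cores c)) -card_bitseqs; apply: eq_card => w.
  have h3 : (size w %% 3 != 2)%N by rewrite size_tuple.
  rewrite !inE mem_cores //; apply/asboolP/andP.
    case/(crossing_number_bplat h3 (billiard_bplat w n3) c3)/andP=> lt2 bl.
    by split=> //; apply: core_okP.
  case=> /and4P[lt2 _ _ _] bl; apply/(crossing_number_bplat h3 (billiard_bplat w n3) c3).
  by rewrite lt2.
have core_okE r : r \in cores c -> core_ok r by rewrite mem_cores // => /andP[].
rewrite /uniform_prob E natr_sum card_tuple card_bool.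
rewrite (eq_big_seq (fun r => core_val n (size r))); last first.
  by move=> r /core_okE okr; rewrite core_count_val.
(* A core with c blocks, k of them double, has c + k letters. *)
have half x : \sum_(ds <- bitseqs (c - 2)) core_val n (size (core_of x ds)) =
    \sum_(k < (c - 2).+1) 'C(c - 2, k)%:R * core_val n (c + k).
  rewrite -(sum_bitseqs (c - 2) (fun k => core_val n (c + k))); apply: eq_big_seq => ds.
  rewrite mem_bitseqs => /eqP sz; rewrite /= size_build sz; congr core_val; lia.
(* The two choices of the first letter give equal sums and cancel one factor 2 of 2^n. *)
rewrite /cores big_cat !big_map !half /= -mulr2n.
have -> : (2 ^ n)%N%:R = 2 * 2 ^+ (n - 1) :> rat.
  by rewrite natrX -exprS subn1 prednK.
have cancel2 (S X : rat) : X != 0 -> S *+ 2 / (2 * X) = S / X.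
  by move=> X0; rewrite -mulr_natr; field.
rewrite cancel2 ?expf_neq0 // mulr_suml [RHS]big_mkcond; apply: eq_bigr => k _.
have [eq3|ne3] := ifP; last first.
  by rewrite core_val_ndiv ?mulr0 ?mul0r // eq_sym ne3.
rewrite mulrAC; congr (_ * _).
have [le|lt] := leqP (c + k) n.
  have [m Em] : exists m, n = (3 * m + (c + k))%N.
    by exists ((n - (c + k)) %/ 3)%N; move: eq3 le; lia.
  rewrite {1}Em core_val_F; congr F; lia.
(* A core longer than n does not occur; on the other side the first argument of [F] is negative,
   where both binomial terms are 0 by convention. *)
rewrite core_val_small // /F.
have : ((n%:Z - c%:Z - k%:Z) %/ 3)%Z < 0 by lia.
case: ((n%:Z - c%:Z - k%:Z) %/ 3)%Z => // m _.
by rewrite /binz /binz_lt !mulr0 subr0.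
Qed.
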